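(* Let $E,F\to M$ be hermitian vector bundles with metric preserving connections over a Riemannian manifold $M$; denote by $\nabla$ the connection on $E$. Let $A\in C^\infty(M;T^*M\otimes\operatorname{End}(E))$ satisfy $A^*=-A$ (that is, $A(X)^*=-A(X)$ for every real vector field $X$), and let $\widetilde\nabla=\nabla+A$. Let $m\in\mathbb N$. Then: (i) $\mathrm{biDiff}^{2m}_{\nabla}(M;E,F)=\mathrm{biDiff}^{2m}_{\widetilde\nabla}(M;E,F)$. (ii) If $A\in C^\infty_b(M;T^*M\otimes\operatorname{End}(E))$, then $\mathrm{biDiff}^{2m}_{b,\nabla}(M;E,F)=\mathrm{biDiff}^{2m}_{b,\widetilde\nabla}(M;E,F)$.
   Context: $M$ is a smooth Riemannian manifold without boundary. All vector bundles are smooth, complex, of finite rank, hermitian, with metric preserving connections, generically denoted $\nabla$. Tensor products and $\operatorname{Hom}$-bundles carry the induced metrics and connections, and $T^*M$ carries the Levi-Civita connection. $\nabla^j$ is the $j$-fold iterated connection, with values in sections of $T^{*\otimes j}M\otimes E$. $C^\infty_b(M;V)$ is the space of bounded smooth sections of $V$ all of whose covariant derivatives are bounded. $\overline F$ is the complex conjugate bundle of $F$, and $E\boxtimes\overline F\to M\times M$ is the external tensor product, with fiber $E_{x_1}\otimes\overline F_{x_2}$ over $(x_1,x_2)$; $M$ is embedded diagonally in $M\times M$. A $\nabla$-bidifferential operator on $(E,F)$ is a linear map $\mathfrak b:C^\infty_c(M\times M;E\boxtimes\overline F)\to C^\infty_c(M)$ of the form $\mathfrak b v=(Pv)|_M$,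 where $P:C^\infty_c(M\times M;E\boxtimes\overline F)\to C^\infty_c(M\times M)$ is of the form $P=\sum_ja^{[j]}\nabla^j$ (finite sum) with smooth coefficients. Equivalently, $\mathfrak b$ has a canonical form: for $u\in C^\infty_c(M;E)$, $w\in C^\infty_c(M;F)$, $$\mathfrak b(u\otimes\overline w)(x)=\sum_{i,j}\big(\mathfrak a_{ij}(x)\nabla^iu(x),\nabla^jw(x)\big)_{T^{*\otimes j}M\otimes F}$$ (finite sum), with $\mathfrak a_{ij}\in C^\infty(M;\operatorname{Hom}(T^{*\otimes i}M\otimes E;T^{*\otimes j}M\otimes F))$. The operator $\mathfrak b$ has order $\le2m$ if the $\mathfrak a_{ij}$ can be chosen with $\mathfrak a_{ij}=0$ whenever $i>m$ or $j>m$, and has $C^\infty_b$-coefficients if the $\mathfrak a_{ij}$ can be chosen in $C^\infty_b$. $\mathrm{biDiff}^{2m}_\nabla(M;E,F)$ is the space of $\nabla$-bidifferential operators of order $\le2m$ and $\mathrm{biDiff}^{2m}_{b,\nabla}(M;E,F)$ is the subspace of those with $C^\infty_b$-coefficients. The spaces with index $\widetilde\nabla$ are defined in the same way, using $\widetilde\nabla$ on $E$ and the given connection on $F$. *)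

(* Defs.v *)
From HB Require Import structures.
From mathcomp Require Import all_boot all_order all_algebra.
From mathcomp Require Import all_classical all_reals all_analysis.
From mathcomp Require Import complex.

Set Implicit Arguments.
Unset Strict Implicit.
Unset Printing Implicit Defensive.

Import Order.TTheory GRing.Theory Num.Theory.
Import numFieldNormedType.Exports.

Local Open Scope classical_set_scope.
Local Open Scope ring_scope.
Local Open Scope complex_scope.

(* Conventions.  Bundles are complex, so cotangent tensors are taken over the
   complexified tangent bundle: T*M (x) V is Hom_C(T_C M, V), and a tangent
   vector v is real when it is the image under realvec of a real one.
   A section is an arbitrary function x |-> u x in the fibre over x; smoothness
   is a separate predicate, local at a point.
   The records mfd, rmfd and bundle carry data only; their laws are the
   predicates manifold_ok, riemannian and hermitian_bundle, and the constructions
   below (Hom, dual, conjugate, pull-back, product) act on the data. *)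

Section SmoothFunctionsOfVectors.
Variables (R : realType) (n : nat).

Fixpoint ctimes (k : nat) (U : set 'rV[R]_n) (f : 'rV[R]_n -> R) : Prop :=
  match k with
  | 0 => forall p, U p -> {for p, continuous f}
  | k'.+1 => (forall p, U p -> differentiable f p) /\
             forall v : 'rV[R]_n, ctimes k' U (fun p => 'D_v f p)
  end.

Definition csmooth_at (p : 'rV[R]_n) (f : 'rV[R]_n -> R) : Prop :=
  exists U : set 'rV[R]_n, [/\ open U, U p & forall k, ctimes k U f].

Definition realvec (v : 'rV[R]_n) : 'rV[R[i]]_n := map_mx (real_complex R) v.

End SmoothFunctionsOfVectors.

(* The atlas is indexed by the points: chart x is a chart around x with domain
   cdom x and inverse cinv x, and T_xM is identified with 'rV_mdim through it. *)
Record mfd (R : realType) := Mfd {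
  pt :> topologicalType;
  mdim : nat;
  cdom : pt -> set pt;
  chart : pt -> pt -> 'rV[R]_mdim;
  cinv : pt -> 'rV[R]_mdim -> pt }.

Section Manifolds.
Variables (R : realType) (M : mfd R).
Local Notation C := R[i].
Local Notation n := (mdim M).

Record manifold_ok : Prop := {
  mfd_hausdorff : hausdorff_space M;
  mfd_countable : @second_countable M;
  cdom_open : forall x : M, open (cdom x);
  cdom_mem : forall x : M, cdom x x;
  chart_open : forall x : M, open (chart x @` cdom x);
  chartK : forall x y : M, cdom x y -> cinv x (chart x y) = y;
  chart_cont : forall x y : M, cdom x y -> {for y, continuous (chart x)};
  cinv_cont : forall x y : M, cdom x y ->
    {for chart x y, continuous (cinv (m := M) x)};
  chart_smooth : forall (x y z : M) (k : 'I_n), cdom x z -> cdom y z ->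
    csmooth_at (chart x z) (fun p => chart y (cinv x p) 0 k) }.

Definition smooth_near (x : M) (f : M -> C) : Prop :=
  csmooth_at (chart x x) (fun p => complex.Re (f (cinv x p))) /\
  csmooth_at (chart x x) (fun p => complex.Im (f (cinv x p))).

Definition pder (f : M -> C) (x : M) (k : 'I_n) : C :=
  'D_(delta_mx 0 k) (fun p => complex.Re (f (cinv x p))) (chart x x) +i*
  'D_(delta_mx 0 k) (fun p => complex.Im (f (cinv x p))) (chart x x).

(* df_x(v), complex linear in v *)
Definition dfun (f : M -> C) (x : M) (v : 'rV[C]_n) : C :=
  \sum_(k < n) v 0 k * pder f x k.

(* the same for a function with values in one fixed vector space *)
Definition dvec (W : vectType C) (f : M -> W) (x : M) (v : 'rV[C]_n) : W :=
  \sum_(a < \dim {:W})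
    dfun (fun y => coord (vbasis {:W}) a (f y)) x v *: (vbasis {:W})`_a.

End Manifolds.

(* frame x is a local frame around x.  A connection is recorded as the operator
   u |-> nabla u on local sections: conn u x is meaningful when u is smooth
   near x, and conn u x v is nabla_v u. *)
Record bundle (R : realType) (M : mfd R) := Bundle {
  fib : M -> vectType R[i];
  rank : M -> nat;
  frame : forall x y : M, (rank x).-tuple (fib y);
  herm : forall x : M, fib x -> fib x -> R[i];
  conn : (forall y : M, fib y) -> forall x : M, 'Hom('rV[R[i]]_(mdim M), fib x) }.

Section Bundles.
Variables (R : realType) (M : mfd R).
Local Notation C := R[i].
Local Notation n := (mdim M).
Implicit Types V W : bundle M.

Definition section V := forall x : M, fib V x.

Definition smooth_sec_near V (x : M) (u : section V) : Prop :=
  forall a : 'I_(rank V x), smooth_near x (fun y => coord (frame V x y) a (u y)).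

Definition smooth_sec V (u : section V) : Prop :=
  forall x : M, smooth_sec_near x u.

Definition vnorm V (x : M) (w : fib V x) : R := Num.sqrt (complex.Re (herm w w)).

Definition test_sec V (u : section V) : Prop :=
  smooth_sec u /\ compact (closure [set x : M | u x != 0]).

(* C_c^infty(M; V) *)
Definition csec V := {u : section V | test_sec u}.

Record vector_bundle V : Prop := {
  frame_basis : forall x : M,
    \forall y \near x, basis_of {: fib V y} (frame V x y);
  frame_smooth : forall x : M, \forall y \near x,
    forall a, @smooth_sec_near V y (fun z => tnth (frame V x z) a) }.

Record hermitian_metric V : Prop := {
  herm_linear : forall (x : M) (c : C) (u v w : fib V x),
    herm (c *: u + v) w = c * herm u w + herm v w;
  herm_sym : forall (x : M) (u w : fib V x), herm u w = (herm w u)^*;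
  herm_pos : forall (x : M) (u : fib V x), u != 0 -> 0 < herm u u;
  herm_smooth : forall (x : M) a b,
    smooth_near x (fun y => herm (tnth (frame V x y) a) (tnth (frame V x y) b)) }.

Definition metric_preserving V : Prop :=
  forall (x : M) (u w : section V) (v : 'rV[R]_n),
    smooth_sec_near x u -> smooth_sec_near x w ->
    dfun (fun y => herm (u y) (w y)) x (realvec v) =
    herm (conn u x (realvec v)) (w x) + herm (u x) (conn w x (realvec v)).

(* The metric on Hom(V, W) is the Hilbert-Schmidt one, written in the possibly
   non-orthonormal frame of V through its Gram matrix; the connection is given by
   (nabla_v c) e = nabla_v (c e) - c (nabla_v e) on the frame of V. *)
Definition homb V W : bundle M := {|
  fib := fun x => 'Hom(fib V x, fib W x);
  rank := fun x => #|{: 'I_(rank V x) * 'I_(rank W x)}|;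
  frame := fun x y => [tuple
    linfun (fun e => coord (frame V x y) (enum_val k).1 e *:
                     tnth (frame W x y) (enum_val k).2)
    | k < #|{: 'I_(rank V x) * 'I_(rank W x)}| ];
  herm := fun x c d =>
    let e := tnth (frame V x x) in
    let G := \matrix_(a, b) herm (e a) (e b) in
    \sum_a \sum_b invmx G b a * herm (c (e a)) (d (e b));
  conn := fun c x => linfun (fun v => linfun (fun w =>
    \sum_(a < rank V x) coord (frame V x x) a w *:
      (conn (fun y => c y (tnth (frame V x y) a)) x v -
       c x (conn (fun y => tnth (frame V x y) a) x v)))) |}.

Definition trivb : bundle M := {|
  fib := fun=> C^o : vectType C;
  rank := fun=> 1%N;
  frame := fun _ _ => [tuple (1 : C^o)];
  herm := fun _ z w => z * w^*;
  conn := fun f x => linfun (fun v => dfun f x v : C^o) |}.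

End Bundles.

Section ConjugateVectorSpace.
Import VectorInternalTheory.
Variables (R : realType) (V : vectType R[i]).

Definition conjv : Type := V.

HB.instance Definition _ := GRing.Zmodule.on conjv.

Definition conjv_scale (c : R[i]) (v : conjv) : conjv := (c^* *: (v : V)).

Fact conjv_scalerA a b v :
  conjv_scale a (conjv_scale b v) = conjv_scale (a * b) v.
Proof. by rewrite /conjv_scale scalerA rmorphM. Qed.

Fact conjv_scale1r : left_id 1 conjv_scale.
Proof. by move=> v; rewrite /conjv_scale rmorph1 scale1r. Qed.

Fact conjv_scalerDr : right_distributive conjv_scale +%R.
Proof. by move=> a u v; rewrite /conjv_scale; exact: scalerDr. Qed.

Fact conjv_scalerDl v : {morph conjv_scale^~ v : a b / a + b}.
Proof. by move=> a b; rewrite /conjv_scale rmorphD; exact: scalerDl. Qed.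

HB.instance Definition _ := GRing.Zmodule_isLmodule.Build R[i] conjv
  conjv_scalerA conjv_scale1r conjv_scalerDr conjv_scalerDl.

Fact conjv_vect_axiom : Vector.axiom (dim V) conjv.
Proof.
exists (fun v : conjv => map_mx conjc (v2r (v : V))).
  move=> a u v; apply/rowP=> k.
  have -> : v2r ((a *: u + v : conjv) : V) =
            a^* *: v2r (u : V) +
            v2r (v : V).
    change ((a *: u + v : conjv) : V) with (a^* *: (u : V) + (v : V)).
    by rewrite linearD linearZ.
  by rewrite !mxE rmorphD rmorphM /= conjcK.
exists (fun r => r2v (map_mx conjc r) : V).
  move=> v; rewrite -map_mx_comp map_mx_id ?v2rK //.
  exact: conjcK.
move=> r; rewrite r2vK -map_mx_comp map_mx_id //.
exact: conjcK.
Qed.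

HB.instance Definition _ := Lmodule_hasFinDim.Build R[i] conjv conjv_vect_axiom.

End ConjugateVectorSpace.

Section ConjugateAndTensor.
Variables (R : realType) (M : mfd R).
Local Notation C := R[i].

(* The connection of the conjugate bundle is nabla itself along real vectors,
   extended complex linearly in the vector, whence the conjugate of v. *)
Definition conjb (V : bundle M) : bundle M := {|
  fib := fun x => conjv (fib V x) : vectType C;
  rank := rank V;
  frame := fun x y => frame V x y : (rank V x).-tuple (conjv (fib V y));
  herm := fun x (u w : conjv (fib V x)) => herm (w : fib V x) (u : fib V x);
  conn := fun u x =>
    linfun (fun v => conn (u : section V) x (map_mx conjc v) : conjv (fib V x)) |}.

(* V (x) W as Hom(W^*, V) *)
Definition tensb (V W : bundle M) : bundle M := homb (homb W (trivb M)) V.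

End ConjugateAndTensor.

Section ProductManifold.
Variables (R : realType) (M N : mfd R).
Local Notation C := R[i].

Definition prodm : mfd R := {|
  pt := (M * N)%type : topologicalType;
  mdim := mdim M + mdim N;
  cdom := fun x => cdom x.1 `*` cdom x.2;
  chart := fun x y => row_mx (chart x.1 y.1) (chart x.2 y.2);
  cinv := fun x p => (cinv x.1 (lsubmx p), cinv x.2 (rsubmx p)) |}.

(* pull-backs along the two projections, with the pull-back connection *)
Definition pull1 (V : bundle M) : bundle prodm := {|
  fib := fun x : prodm => fib V x.1;
  rank := fun x : prodm => rank V x.1;
  frame := fun x y : prodm => frame V x.1 y.1;
  herm := fun (x : prodm) u w => herm u w;
  conn := fun u (x : prodm) => linfun (fun v =>
    conn (fun y : M => u (y, x.2)) x.1 (lsubmx v) +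
    dvec (W := fib V x.1) (fun z : N => u (x.1, z)) x.2 (rsubmx v)) |}.

Definition pull2 (V : bundle N) : bundle prodm := {|
  fib := fun x : prodm => fib V x.2;
  rank := fun x : prodm => rank V x.2;
  frame := fun x y : prodm => frame V x.2 y.2;
  herm := fun (x : prodm) u w => herm u w;
  conn := fun u (x : prodm) => linfun (fun v =>
    dvec (W := fib V x.2) (fun y : M => u (y, x.2)) x.1 (lsubmx v) +
    conn (fun z : N => u (x.1, z)) x.2 (rsubmx v)) |}.

End ProductManifold.

(* metric x is the Gram matrix of the Riemannian metric at x in chart x; lc is the
   Levi-Civita connection (complex linearly extended), characterized in riemannian. *)
Record rmfd (R : realType) := Rmfd {
  base :> mfd R;
  metric : base -> 'M[R]_(mdim base);
  lc : (base -> 'rV[R[i]]_(mdim base)) ->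
       base -> 'Hom('rV[R[i]]_(mdim base), 'rV[R[i]]_(mdim base)) }.

Section Riemannian.
Variables (R : realType) (M : rmfd R).
Local Notation C := R[i].
Local Notation n := (mdim M).

(* the complexified tangent bundle; the frame around x consists of the coordinate
   vector fields of chart x, expressed at y in chart y *)
Definition tanb : bundle M := {|
  fib := fun=> 'rV[C]_n : vectType C;
  rank := fun=> n;
  frame := fun x y => [tuple
    realvec (\row_k 'D_(delta_mx 0 a) (fun p => chart y (cinv x p) 0 k) (chart x y))
    | a < n];
  herm := fun x v w =>
    (v *m map_mx (real_complex R) (metric x) *m (map_mx conjc w)^T) 0 0;
  conn := @lc R M |}.

Record is_connection (V : bundle M) : Prop := {
  conn_local : forall (x : M) (u w : section V),
    (\forall y \near x, u y = w y) -> conn u x = conn w x;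
  conn_add : forall (x : M) (u w : section V),
    smooth_sec_near x u -> smooth_sec_near x w ->
    conn (fun y => u y + w y) x = conn u x + conn w x;
  conn_leibniz : forall (x : M) (f : M -> C) (u : section V) (v : 'rV[C]_n),
    smooth_near x f -> smooth_sec_near x u ->
    conn (fun y => f y *: u y) x v = dfun f x v *: u x + f x *: conn u x v;
  conn_smooth : forall (x : M) (u : section V),
    smooth_sec_near x u -> @smooth_sec_near R M (homb tanb V) x (conn u) }.

Record hermitian_bundle (V : bundle M) : Prop := {
  hb_vector : vector_bundle V;
  hb_metric : hermitian_metric V;
  hb_conn : is_connection V;
  hb_preserving : metric_preserving V }.

Definition is_real (v : 'rV[C]_n) : Prop := exists v0, v = realvec v0.

Record riemannian : Prop := {
  riem_manifold : manifold_ok M;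
  riem_metric : hermitian_metric tanb;
  lc_connection : is_connection tanb;
  lc_real : forall (x : M) (Y : section tanb) (v : 'rV[C]_n),
    smooth_sec_near x Y -> (forall y, is_real (Y y)) -> is_real v ->
    is_real (conn Y x v);
  lc_metric : metric_preserving tanb;
  (* nabla_X Y - nabla_Y X = [X, Y] *)
  lc_torsion_free : forall (x : M) (X Y : section tanb) (f : M -> C),
    smooth_sec_near x X -> smooth_sec_near x Y -> smooth_near x f ->
    dfun f x (conn Y x (X x) - conn X x (Y x)) =
    dfun (fun y => dfun f y (Y y)) x (X x) -
    dfun (fun y => dfun f y (X y)) x (Y x) }.

(* T^{* (x) j} M (x) V *)
Fixpoint ctens (j : nat) (V : bundle M) : bundle M :=
  match j with
  | 0 => V
  | j'.+1 => homb tanb (ctens j' V)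
  end.

Fixpoint nabla (V : bundle M) (u : section V) (j : nat) : section (ctens j V) :=
  match j with
  | 0 => u
  | j'.+1 => conn (nabla u j')
  end.

(* C_b^infty(M; V) *)
Definition bounded_sec (V : bundle M) (u : section V) : Prop :=
  smooth_sec u /\
  forall j, exists K : R, forall x : M, vnorm (nabla u j x) <= K.

(* the bundle V with the connection nabla + A *)
Definition perturb (V : bundle M) (A : section (homb tanb (homb V V))) : bundle M := {|
  fib := fib V;
  rank := rank V;
  frame := frame V;
  herm := @herm R M V;
  conn := fun u x => conn u x +
    linfun (fun v : 'rV[C]_n => (A x v : 'Hom(fib V x, fib V x)) (u x)) |}.

Definition skew_form (V : bundle M) (A : section (homb tanb (homb V V))) : Prop :=
  forall (x : M) (v : 'rV[R]_n) (e f : fib V x),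
    herm ((A x (realvec v) : 'Hom(fib V x, fib V x)) e) f =
    - herm e ((A x (realvec v) : 'Hom(fib V x, fib V x)) f).

End Riemannian.

(* Product metric; the Levi-Civita connection of a product metric is the direct sum
   of the pulled-back ones. *)
Definition rprod (R : realType) (M N : rmfd R) : rmfd R := {|
  base := prodm M N;
  metric := fun x : prodm M N => block_mx (metric x.1) 0 0 (metric x.2);
  lc := fun (Y : prodm M N -> 'rV[R[i]]_(mdim M + mdim N)) (x : prodm M N) =>
    linfun (fun v => row_mx
      (@conn R _ (pull1 N (tanb M)) (fun y => lsubmx (Y y)) x v)
      (@conn R _ (pull2 M (tanb N)) (fun y => rsubmx (Y y)) x v)) |}.

Section Bidifferential.
Variables (R : realType) (M : rmfd R).
Local Notation C := R[i].
Local Notation M2 := (rprod M M).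

Definition etens (E F : bundle M) : bundle M2 :=
  tensb (pull1 M E) (pull2 M (conjb F)).

(* the section u (x) \bar w of the external tensor product *)
Definition etens_sec (E F : bundle M) (u : section E) (w : section F) :
    section (etens E F) :=
  fun x : M2 => linfun (fun l : 'Hom(conjv (fib F x.2), C^o) =>
    (l (w x.2 : conjv (fib F x.2)) : C) *: u x.1).

Section Operators.
Variables E F : bundle M.

Definition bimap := csec (etens E F) -> M -> C.

Definition bilin_coef := forall i j : nat, section (homb (ctens i E) (ctens j F)).

(* b v = (P v)|_M with P a finite sum of a_j nabla^j *)
Definition restr_diffop (b : bimap) : Prop :=
  exists (N : nat) (a : forall j, section (homb (ctens j (etens E F)) (trivb M2))),
    (forall j, smooth_sec (a j)) /\
    forall (v : csec (etens E F)) (x : M),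
      b v x = \sum_(j < N)
        (a j ((x, x) : M2) (nabla (sval v) j ((x, x) : M2)) : C).

Definition has_canonical_form (b : bimap) (N : nat) (a : bilin_coef) : Prop :=
  forall (u : section E) (w : section F), test_sec u -> test_sec w ->
  forall v : csec (etens E F), (forall x, sval v x = etens_sec u w x) ->
  forall x : M,
    b v x = \sum_(i < N) \sum_(j < N) herm (a i j x (nabla u i x)) (nabla w j x).

Record bidiffop (b : bimap) : Prop := {
  bidiff_linear : forall (c : C) (u v w : csec (etens E F)),
    (forall x, sval w x = c *: sval u x + sval v x) ->
    forall x, b w x = c * b u x + b v x;
  bidiff_range : forall v, @test_sec R M (trivb M) (b v);
  bidiff_form : restr_diffop b }.

Definition order_le (m : nat) (b : bimap) : Prop :=
  exists (N : nat) (a : bilin_coef),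
    [/\ forall i j, smooth_sec (a i j),
        forall i j, (m < i)%N \/ (m < j)%N -> forall x, a i j x = 0
      & has_canonical_form b N a].

Definition bounded_coef (b : bimap) : Prop :=
  exists (N : nat) (a : bilin_coef),
    (forall i j, bounded_sec (a i j)) /\ has_canonical_form b N a.

Definition biDiff (m : nat) : set bimap :=
  [set b | bidiffop b /\ order_le m b].

Definition biDiffb (m : nat) : set bimap :=
  [set b | biDiff m b /\ bounded_coef b].

End Operators.
End Bidifferential.

Arguments biDiff {R M} E F m.
Arguments biDiffb {R M} E F m.

(* Main.v *)
Require Import Defs.
From HB Require Import structures.
From mathcomp Require Import all_boot all_order all_algebra.
From mathcomp Require Import all_classical all_reals all_analysis.
From mathcomp Require Import complex ring lra spectral.

Set Implicit Arguments.
Unset Strict Implicit.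
Unset Printing Implicit Defensive.

Import Order.TTheory GRing.Theory Num.Theory.
Import numFieldNormedType.Exports.

Local Open Scope classical_set_scope.
Local Open Scope ring_scope.
Local Open Scope complex_scope.

(** Why the theorem holds.  Let [E'] be the bundle [E] with the connection
    [nabla + A], and let [J] be the identity, seen as a section of [Hom(E', E)].
    The Leibniz rule for [J u], iterated, gives
      [nabla^i u = sum_(k <= i) c_ik (nabla'^k u)]
    with sections [c_ik] of [Hom(ctens k E', ctens i E)] obtained from [J] by
    covariant differentiation and parallel operations ([coef],
    [nabla_expansion]).  Substituting this in the canonical form with
    coefficients [a_ij] gives a canonical form for the other connection with
    coefficients [sum_i a_ij c_ik], and orders do not increase because
    [c_ik = 0] for [i < k] ([transfer_order]).  The same computation for the
    external tensor product bundles over [M * M], followed by restriction to the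
    diagonal, treats the form [(P v)|_M] ([restr_diffop_change]).  As the argument
    is symmetric in the two connections, (i) follows.

    For (i) all the bundles concerned have to be shown to be smooth vector
    bundles with a connection: Hom bundles, conjugates, pull-backs to the
    product, and the tangent bundles of [M] and of [M * M].  The main tools are
    that a section of a Hom bundle is smooth as soon as it maps smooth sections to
    smooth sections ([homb_smoothP]), and that an operator with the usual local
    expression is a connection ([connection_of_frame_formula]).

    For (ii) the covariant derivatives of [c_ik] have to be bounded.  By
    construction this reduces to [J], and [nabla J = - A J], so bounds on [J] to
    order [k] and on [A] give bounds on [J] to order [k + 1]
    ([id_from_bounded]); in the opposite direction [nabla J = J A]
    ([id_to_bounded]).  Since the operator norm of [J] is one while its
    Hilbert-Schmidt norm depends on the rank, the [c_ik] are bounded in operator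
    norm ([coef_bounded]); the product of a Hilbert-Schmidt bounded coefficient
    with an operator bounded one is Hilbert-Schmidt bounded ([vnorm_pre]).
    Boundedness is propagated by the Leibniz rule for parallel pairings
    ([bounded_upto_pairing]), with the iterated derivatives measured one tangent
    direction at a time ([bounded_upto]). *)

(** * Smooth functions of several real variables *)

Section Calculus.
Variable R : realType.

(** The difference of the two functions vanishes near the point, so it is
    differentiable there with zero differential. *)
Lemma near_eq_differentiable (V W : normedModType R) (f g : V -> W) (x : V) :
  (\forall y \near x, f y = g y) -> differentiable f x -> differentiable g x.
Proof.
move=> fg df.
pose h := g \- f.
have hnear : \forall y \near x, h y = 0.
  by near do rewrite /h /= (near fg _) ?subrr//.
have hx := nbhs_singleton hnear.
have ho : h \o shift x = cst (h x) + (\0 : V -> W) +o_ 0 id.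
  apply/eqaddoP => e e0; rewrite hx.
  have H : \forall y \near (0 : V), h (y + x) = 0.
    rewrite (near_shift x) /=; near=> y.
    by rewrite /= sub0r subrK (near hnear y).
  near=> y; rewrite !fctE /= (near H y)//.
  by rewrite !addr0 subr0 normr0 mulr_ge0// ltW.
have dh : differentiable h x.
  have c0 : continuous (\0 : {linear V -> W}) by exact: cst_continuous.
  have hE := diff_unique c0 ho.
  by apply/diff_locallyP; rewrite hE; split=> //.
have -> : g = f + h by apply/funext => y; rewrite /h !fctE addrC subrK.
exact: differentiableD.
Unshelve. all: by end_near. Qed.

Section FixedDimension.
Variable n : nat.
Implicit Types (U : set 'rV[R]_n) (f g : 'rV[R]_n -> R).

Lemma ctimes_weak k U f : ctimes k.+1 U f -> ctimes k U f.
Proof.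
elim: k f => [|k IH] f [df Df].
  by move=> p /df /differentiable_continuous.
by split => // v; apply: IH.
Qed.

Lemma ctimes_eq k U f g : open U -> (forall p, U p -> f p = g p) ->
  ctimes k U f -> ctimes k U g.
Proof.
move=> oU; elim: k f g => [|k IH] f g fg.
  move=> cf p Up; have cfp : f @ p --> f p := cf p Up.
  change (g @ p --> g p); rewrite -(fg p Up); move: cfp.
  move=> cfp; apply: (cvg_trans _ cfp); apply: (@near_eq_cvg _ _ (nbhs p)).
  exact: filterS fg (open_nbhs_nbhs (conj oU Up)).
have fgn p : U p -> {near p, f =1 g}.
  by move=> Up; exact: filterS fg (open_nbhs_nbhs (conj oU Up)).
move=> [df Df]; split.
  by move=> p Up; apply: near_eq_differentiable (df p Up); exact: fgn.
move=> v; apply: (IH _ _ _ (Df v)) => p Up.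
by apply: near_eq_derive; exact: fgn.
Qed.

Lemma ctimes_sub k U V f : V `<=` U -> ctimes k U f -> ctimes k V f.
Proof.
move=> VU; elim: k f => [|k IH] f; first by move=> cf p /VU; exact: cf.
by case=> df Df; split; [move=> p /VU; exact: df|move=> v; exact: IH (Df v)].
Qed.

Lemma ctimes_cst k U (c : R) : ctimes k U (fun=> c).
Proof.
elim: k c => [|k IH] c; first by move=> p _; exact: cst_continuous.
split; first by move=> p _; exact: differentiable_cst.
move=> v.
have -> : (fun p => 'D_v (fun=> c) p) = fun=> 0 by apply/funext => p; exact: derive_cst.
exact: IH.
Qed.

Lemma ctimesD k U f g : open U ->
  ctimes k U f -> ctimes k U g -> ctimes k U (fun p => f p + g p).
Proof.
move=> oU; elim: k f g => [|k IH] f g.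
  by move=> cf cg p Up; apply: continuousD; [exact: cf|exact: cg].
move=> [df Df] [dg Dg]; split.
  by move=> p Up; apply: differentiableD; [exact: df|exact: dg].
move=> v; apply: ctimes_eq (IH _ _ (Df v) (Dg v)) => // p Up.
by rewrite deriveD//; apply: diff_derivable; [exact: df|exact: dg].
Qed.

Lemma ctimesM k U f g : open U ->
  ctimes k U f -> ctimes k U g -> ctimes k U (fun p => f p * g p).
Proof.
move=> oU; elim: k f g => [|k IH] f g.
  by move=> cf cg p Up; apply: continuousM; [exact: cf|exact: cg].
move=> Hf Hg; have [df Df] := Hf; have [dg Dg] := Hg; split.
  by move=> p Up; apply: differentiableM; [exact: df|exact: dg].
move=> v.
have H1 := IH _ _ (ctimes_weak Hf) (Dg v).
have H2 := IH _ _ (ctimes_weak Hg) (Df v).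
apply: ctimes_eq (ctimesD oU H1 H2) => // p Up.
by rewrite (deriveM (f := f) (g := g))//; apply: diff_derivable; [exact: df|exact: dg].
Qed.

(** Since [(1/f)' = - f' / f^2], one order of smoothness of [1/f] follows from
    the previous one and the product rule. *)
Lemma ctimesV k U f : open U -> (forall p, U p -> f p != 0) ->
  ctimes k U f -> ctimes k U (fun p => (f p)^-1).
Proof.
move=> oU f0; elim: k => [|k IH].
  by move=> cf p Up; apply: continuousV; [exact: f0|exact: cf].
move=> Hf; have [df Df] := Hf; split.
  by move=> p Up; apply: differentiableV; [exact: df|exact: f0].
move=> v; have HV := IH (ctimes_weak Hf).
have H1 := ctimesM oU (ctimesM oU HV HV) (ctimesM oU (ctimes_cst k U (-1)) (Df v)).
apply: ctimes_eq H1 => // p Up.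
rewrite deriveV; [|exact: f0|by apply: diff_derivable; exact: df].
rewrite -[RHS]/(- (f p) ^- 2 * 'D_v f p).
have -> : (f p) ^- 2 = (f p)^-1 * (f p)^-1 by rewrite -expr2 exprVn.
by ring.
Qed.

Lemma derive_coord (j : 'I_n) (p v : 'rV[R]_n) :
  'D_v (fun p : 'rV[R]_n => p 0 j) p = v 0 j.
Proof.
have /derive_mx : derivable (id : 'rV[R]_n -> 'rV[R]_n) p v by exact: derivable_id.
by rewrite derive_id => /matrixP/(_ 0 j); rewrite !mxE => ->.
Qed.

Lemma ctimes_coord k U (j : 'I_n) : ctimes k U (fun p => p 0 j).
Proof.
case: k => [|k]; first by move=> p _; exact: coord_continuous.
split; first by move=> p _; exact: differentiable_coord.
move=> v.
have -> : (fun p => 'D_v (fun p : 'rV[R]_n => p 0 j) p) = fun=> v 0 j.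
  by apply/funext => p; exact: derive_coord.
exact: ctimes_cst.
Qed.

Lemma ctimes_sum k U (I : Type) (s : seq I) (f : I -> 'rV[R]_n -> R) : open U ->
  (forall i, ctimes k U (f i)) -> ctimes k U (fun p => \sum_(i <- s) f i p).
Proof.
move=> oU Hf; elim: s => [|i s IH].
  by apply: ctimes_eq (ctimes_cst k U 0) => // p _; rewrite big_nil.
by apply: ctimes_eq (ctimesD oU (Hf i) IH) => // p _; rewrite big_cons.
Qed.

(** Here differentiability enters, rather than the mere existence of
    directional derivatives. *)
Lemma derive_partial f (p v : 'rV[R]_n) : differentiable f p ->
  'D_v f p = \sum_(j < n) v 0 j * 'D_(delta_mx 0 j) f p.
Proof.
move=> df; rewrite deriveE// {1}[v]row_sum_delta linear_sum /=.
by apply: eq_bigr => j _; rewrite linearZ /= deriveE.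
Qed.

End FixedDimension.

(** A row-valued map is the sum of its components times the basis vectors; this
    reduces continuity and differentiability to scalar functions. *)
Lemma continuous_row (T : topologicalType) n (g : T -> 'rV[R]_n) (p : T) :
  (forall j, {for p, continuous (fun q => g q 0 j)}) ->
  {for p, continuous g}.
Proof.
move=> cg.
have -> : g = fun q => \sum_(j < n) g q 0 j *: (delta_mx 0 j : 'rV[R]_n).
  by apply/funext => q; rewrite {1}[g q]row_sum_delta.
elim: (index_enum _) => [|j s IH].
  have -> : (fun q => \sum_(j <- [::]) g q 0 j *: (delta_mx 0 j : 'rV[R]_n)) = cst 0.
    by apply/funext => q; rewrite big_nil.
  exact: cst_continuous.
have -> : (fun q => \sum_(j <- j :: s) g q 0 j *: (delta_mx 0 j : 'rV[R]_n)) =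
    fun q => g q 0 j *: (delta_mx 0 j : 'rV[R]_n) +
             \sum_(j <- s) g q 0 j *: (delta_mx 0 j : 'rV[R]_n).
  by apply/funext => q; rewrite big_cons.
have cj : {for p, continuous (fun q => g q 0 j *: (delta_mx 0 j : 'rV[R]_n))}.
  by apply: (@continuousZr_tmp _ _ _ (fun q => g q 0 j)); exact: cg.
exact: (@continuousD _ _ _ _ _ p cj IH).
Qed.

Section Composition.
Variables m n : nat.
Implicit Types (U : set 'rV[R]_m) (V : set 'rV[R]_n) (f : 'rV[R]_n -> R)
  (g : 'rV[R]_m -> 'rV[R]_n).

Lemma differentiable_row g p : (forall j, differentiable (fun q => g q 0 j) p) ->
  differentiable g p.
Proof.
move=> dg.
have -> : g = \sum_(j < n) (fun q => g q 0 j *: (delta_mx 0 j : 'rV[R]_n)).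
  by apply/funext => q; rewrite fct_sumE {1}[g q]row_sum_delta.
by apply: differentiable_sum => j; exact: differentiableZl.
Qed.

Lemma derive_comp f g p v : (forall j, differentiable (fun q => g q 0 j) p) ->
  differentiable f (g p) ->
  'D_v (fun q => f (g q)) p =
  \sum_(j < n) 'D_v (fun q => g q 0 j) p * 'D_(delta_mx 0 j) f (g p).
Proof.
move=> dg df; have dgr := differentiable_row dg.
rewrite deriveE; last exact: differentiable_comp.
rewrite diff_comp //= -deriveE// (derive_partial _ df).
apply: eq_bigr => j _; congr (_ * _).
rewrite -deriveE// derive_mx; last exact: diff_derivable.
by rewrite mxE.
Qed.

(** By the chain rule a derivative of [f \o g] is a sum of products of
    derivatives of the components of [g] with compositions [f' \o g], which are
    smooth to one order less. *)
Lemma ctimes_comp k U V f g : open U ->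
  (forall p, U p -> V (g p)) -> (forall j, ctimes k U (fun q => g q 0 j)) ->
  ctimes k V f -> ctimes k U (fun q => f (g q)).
Proof.
move=> oU; elim: k f => [|k IH] f gUV Hg Hf.
  move=> p Up; apply: (@continuous_comp _ _ _ g f); last exact: Hf (gUV _ Up).
  by apply: continuous_row => j; exact: Hg.
have [df Df] := Hf; split.
  move=> p Up; apply: (differentiable_comp (f := g) (g := f)); last exact/df/gUV.
  by apply: differentiable_row => j; have [dg _] := Hg j; exact: dg.
move=> v.
have H j : ctimes k U (fun q => 'D_v (fun q => g q 0 j) q *
    'D_(delta_mx 0 j) f (g q)).
  apply: ctimesM => //; first by have [_] := Hg j; apply.
  by apply: (IH _ gUV (fun i => ctimes_weak (Hg i)) (Df _)).
apply: ctimes_eq (ctimes_sum _ oU H) => // p Up.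
rewrite derive_comp//; last exact/df/gUV.
by move=> j; have [dg _] := Hg j; exact: dg.
Qed.

End Composition.
End Calculus.

Section SmoothAtAPoint.
Variables (R : realType) (n : nat).
Implicit Types (f g : 'rV[R]_n -> R) (p v : 'rV[R]_n).

Lemma csmooth_on_near f p : csmooth_at p f ->
  \forall q \near p, csmooth_at q f.
Proof.
move=> [U [oU Up Hf]]; apply: filterS (open_nbhs_nbhs (conj oU Up)) => q Uq.
by exists U.
Qed.

(** Smoothness is local: intersecting the witnessing open set with the
    interior of a neighbourhood does no harm. *)
Lemma csmooth_shrink f p (P : set 'rV[R]_n) : csmooth_at p f -> nbhs p P ->
  exists U, [/\ open U, U p, U `<=` P & forall k, ctimes k U f].
Proof.
move=> [U [oU Up Hf]] nP; exists (interior (U `&` P)); split.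
- exact: open_interior.
- by apply: filterI => //; exact: open_nbhs_nbhs.
- by apply: subset_trans (@subIsetr _ U P); exact: interior_subset.
- move=> k; apply: ctimes_sub (Hf k).
  by apply: subset_trans (@subIsetl _ U P); exact: interior_subset.
Qed.

Lemma csmooth_near_eq f g p : (\forall q \near p, f q = g q) ->
  csmooth_at p f -> csmooth_at p g.
Proof.
move=> fg /csmooth_shrink /(_ fg) [U [oU Up UP Hf]].
by exists U; split=> // k; apply: ctimes_eq (Hf k).
Qed.

Lemma csmooth_ext f g p : (forall q, f q = g q) ->
  csmooth_at p f -> csmooth_at p g.
Proof. by move=> /funext ->. Qed.

Lemma csmooth_cst p (c : R) : csmooth_at p (fun=> c).
Proof. by exists setT; split=> //; [exact: openT|move=> k; exact: ctimes_cst]. Qed.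

Lemma csmooth_coord p (j : 'I_n) : csmooth_at p (fun q => q 0 j).
Proof. by exists setT; split=> //; [exact: openT|move=> k; exact: ctimes_coord]. Qed.

Lemma csmooth_common f g p : csmooth_at p f -> csmooth_at p g ->
  exists U, [/\ open U, U p & forall k, ctimes k U f /\ ctimes k U g].
Proof.
move=> [U [oU Up Hf]] [V [oV Vp Hg]]; exists (U `&` V); split=> //.
  exact: openI.
by move=> k; split; [apply: ctimes_sub (Hf k)|apply: ctimes_sub (Hg k)] => q [].
Qed.

Lemma csmoothD f g p : csmooth_at p f -> csmooth_at p g ->
  csmooth_at p (fun q => f q + g q).
Proof.
move=> Hf Hg; have [U [oU Up H]] := csmooth_common Hf Hg.
by exists U; split=> // k; apply: ctimesD => //; have [] := H k.
Qed.

Lemma csmoothM f g p : csmooth_at p f -> csmooth_at p g ->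
  csmooth_at p (fun q => f q * g q).
Proof.
move=> Hf Hg; have [U [oU Up H]] := csmooth_common Hf Hg.
by exists U; split=> // k; apply: ctimesM => //; have [] := H k.
Qed.

Lemma csmoothN f p : csmooth_at p f -> csmooth_at p (fun q => - f q).
Proof.
move=> Hf; have := csmoothM (csmooth_cst p (-1)) Hf.
by apply: csmooth_ext => q; rewrite mulN1r.
Qed.

Lemma csmooth_continuous f p : csmooth_at p f -> {for p, continuous f}.
Proof. by case=> U [_ Up /(_ 0%N)]; apply. Qed.

Lemma csmooth_differentiable f p : csmooth_at p f -> differentiable f p.
Proof. by case=> U [_ Up /(_ 1%N) [df _]]; exact: df. Qed.

Lemma csmooth_derivable f p v : csmooth_at p f -> derivable f p v.
Proof. by move=> /csmooth_differentiable; exact: diff_derivable. Qed.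

Lemma csmooth_neq0 f p : csmooth_at p f -> f p != 0 ->
  \forall q \near p, f q != 0.
Proof.
move=> /csmooth_continuous cf fp0.
exact: cvgr_neq0 cf fp0.
Qed.

Lemma csmoothV f p : f p != 0 -> csmooth_at p f ->
  csmooth_at p (fun q => (f q)^-1).
Proof.
move=> fp0 Hf; have [U [oU Up Uf H]] := csmooth_shrink Hf (csmooth_neq0 Hf fp0).
by exists U; split=> // k; apply: ctimesV.
Qed.

Lemma csmooth_derive f p v : csmooth_at p f -> csmooth_at p ('D_v f).
Proof. by case=> U [oU Up H]; exists U; split=> // k; have [_] := H k.+1; apply. Qed.

End SmoothAtAPoint.

(** The witnessing open sets of the components of [g] and the preimage of the
    one of [f] are intersected; that preimage is a neighbourhood by continuity. *)
Lemma csmooth_comp (R : realType) (m n : nat) (f : 'rV[R]_n -> R)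
    (g : 'rV[R]_m -> 'rV[R]_n) (p : 'rV[R]_m) :
  (forall j, csmooth_at p (fun q => g q 0 j)) -> csmooth_at (g p) f ->
  csmooth_at p (fun q => f (g q)).
Proof.
move=> Hg [V [oV Vp Hf]].
have cg : {for p, continuous g}.
  by apply: continuous_row => j; exact: csmooth_continuous.
have [Us HUs] : exists Us : 'I_n -> set 'rV[R]_m, forall j,
    [/\ open (Us j), Us j p & forall k, ctimes k (Us j) (fun q => g q 0 j)].
  by exists (fun j => sval (cid (Hg j))) => j; exact: svalP (cid (Hg j)).
pose P := [set q | V (g q)] `&` [set q | forall j, Us j q].
have nP : nbhs p P.
  apply: (@filterI _ (nbhs p)); first by apply: cg; exact: open_nbhs_nbhs.
  apply: (@filter_forall _ _ _ (nbhs p)) => j; apply: open_nbhs_nbhs.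
  by have [? ? _] := HUs j.
exists (interior P); split; [exact: open_interior|exact: nP|move=> k].
apply: (ctimes_comp (V := V)) => //; first exact: open_interior.
  by move=> q /interior_subset[].
move=> j; have [_ _ /(_ k)] := HUs j; apply: ctimes_sub => q.
by move=> /interior_subset[_]; apply.
Qed.

Section ComplexValued.
Variables (R : realType).
Local Notation C := R[i].

Definition ccsmooth_at n (p : 'rV[R]_n) (f : 'rV[R]_n -> C) : Prop :=
  csmooth_at p (fun q => complex.Re (f q)) /\
  csmooth_at p (fun q => complex.Im (f q)).

Definition cderive n (v : 'rV[R]_n) (f : 'rV[R]_n -> C) (p : 'rV[R]_n) : C :=
  'D_v (fun q => complex.Re (f q)) p +i* 'D_v (fun q => complex.Im (f q)) p.

Section Fixed.
Variable n : nat.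
Implicit Types (f g : 'rV[R]_n -> C) (p v : 'rV[R]_n).

Lemma ReD (x y : C) : complex.Re (x + y) = complex.Re x + complex.Re y.
Proof. by case: x; case: y. Qed.
Lemma ImD (x y : C) : complex.Im (x + y) = complex.Im x + complex.Im y.
Proof. by case: x; case: y. Qed.
Lemma ReM (x y : C) : complex.Re (x * y) =
  complex.Re x * complex.Re y - complex.Im x * complex.Im y.
Proof. by case: x; case: y. Qed.
Lemma ImM (x y : C) : complex.Im (x * y) =
  complex.Re x * complex.Im y + complex.Im x * complex.Re y.
Proof. by case: x; case: y. Qed.

Lemma ccsmooth_near_eq f g p : (\forall q \near p, f q = g q) ->
  ccsmooth_at p f -> ccsmooth_at p g.
Proof.
move=> fg [H1 H2]; split.
  by apply: csmooth_near_eq H1; apply: filterS fg => q ->.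
by apply: csmooth_near_eq H2; apply: filterS fg => q ->.
Qed.

Lemma ccsmooth_ext f g p : (forall q, f q = g q) ->
  ccsmooth_at p f -> ccsmooth_at p g.
Proof. by move=> /funext ->. Qed.

Lemma ccsmooth_near f p : ccsmooth_at p f -> \forall q \near p, ccsmooth_at q f.
Proof. by case=> /csmooth_on_near H1 /csmooth_on_near H2; exact: filterS2 H1 H2. Qed.

Lemma ccsmooth_cst p (c : C) : ccsmooth_at p (fun=> c).
Proof. by split; exact: csmooth_cst. Qed.

Lemma ccsmoothD f g p : ccsmooth_at p f -> ccsmooth_at p g ->
  ccsmooth_at p (fun q => f q + g q).
Proof.
move=> [f1 f2] [g1 g2]; split.
  by apply: (csmooth_ext _ (csmoothD f1 g1)) => q; rewrite ReD.
by apply: (csmooth_ext _ (csmoothD f2 g2)) => q; rewrite ImD.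
Qed.

Lemma ccsmoothM f g p : ccsmooth_at p f -> ccsmooth_at p g ->
  ccsmooth_at p (fun q => f q * g q).
Proof.
move=> [f1 f2] [g1 g2]; split.
  apply: (csmooth_ext _ (csmoothD (csmoothM f1 g1) (csmoothN (csmoothM f2 g2)))) => q.
  by rewrite ReM.
apply: (csmooth_ext _ (csmoothD (csmoothM f1 g2) (csmoothM f2 g1))) => q.
by rewrite ImM.
Qed.

Lemma ccsmooth_conj f p : ccsmooth_at p f -> ccsmooth_at p (fun q => (f q)^*).
Proof.
move=> [f1 f2]; split.
  by apply: (csmooth_ext _ f1) => q; case: (f q).
by apply: (csmooth_ext _ (csmoothN f2)) => q; case: (f q).
Qed.

Lemma complex_sqr_norm (z : C) : z != 0 ->
  complex.Re z * complex.Re z + complex.Im z * complex.Im z != 0.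
Proof.
case: z => a b; rewrite eq_complex /= negb_and => H.
rewrite -!expr2 paddr_eq0 ?sqr_ge0// !sqrf_eq0 negb_and.
exact: H.
Qed.

(** [1/z] is the conjugate of [z] divided by the squared modulus. *)
Lemma ccsmoothV f p : f p != 0 -> ccsmooth_at p f ->
  ccsmooth_at p (fun q => (f q)^-1).
Proof.
move=> fp0 [f1 f2].
have N := csmoothD (csmoothM f1 f1) (csmoothM f2 f2).
have NV := csmoothV (complex_sqr_norm fp0) N.
split.
  apply: (csmooth_ext _ (csmoothM f1 NV)) => q.
  by case: (f q) => a b /=; rewrite !expr2.
apply: (csmooth_ext _ (csmoothN (csmoothM f2 NV))) => q.
by case: (f q) => a b /=; rewrite !expr2.
Qed.

Lemma ccsmooth_sum (I : Type) (s : seq I) (F : I -> 'rV[R]_n -> C) p :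
  (forall i, ccsmooth_at p (F i)) -> ccsmooth_at p (fun q => \sum_(i <- s) F i q).
Proof.
move=> HF; elim: s => [|i s IH].
  by apply: (ccsmooth_ext _ (ccsmooth_cst p 0)) => q; rewrite big_nil.
by apply: (ccsmooth_ext _ (ccsmoothD (HF i) IH)) => q; rewrite big_cons.
Qed.

Lemma ccsmooth_prod (I : Type) (s : seq I) (F : I -> 'rV[R]_n -> C) p :
  (forall i, ccsmooth_at p (F i)) -> ccsmooth_at p (fun q => \prod_(i <- s) F i q).
Proof.
move=> HF; elim: s => [|i s IH].
  by apply: (ccsmooth_ext _ (ccsmooth_cst p 1)) => q; rewrite big_nil.
by apply: (ccsmooth_ext _ (ccsmoothM (HF i) IH)) => q; rewrite big_cons.
Qed.

Lemma ccsmooth_real (f : 'rV[R]_n -> R) p : csmooth_at p f ->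
  ccsmooth_at p (fun q => (f q)%:C).
Proof. by move=> Hf; split => //; exact: csmooth_cst. Qed.

Lemma ccsmooth_cderive f p v : ccsmooth_at p f -> ccsmooth_at p (cderive v f).
Proof. by case=> f1 f2; split; exact: csmooth_derive. Qed.

Lemma cderive_near_eq f g p v : (\forall q \near p, f q = g q) ->
  cderive v f p = cderive v g p.
Proof.
by move=> fg; congr (_ +i* _); apply: near_eq_derive; apply: filterS fg => q ->.
Qed.

Lemma cderive_cst (c : C) p v : cderive v (fun=> c) p = 0.
Proof. by rewrite /cderive !derive_cst. Qed.

Lemma cderiveD f g p v : ccsmooth_at p f -> ccsmooth_at p g ->
  cderive v (fun q => f q + g q) p = cderive v f p + cderive v g p.
Proof.
move=> [f1 f2] [g1 g2]; rewrite /cderive.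
under eq_fun do rewrite ReD.
under [X in _ +i* 'D_v X p]eq_fun do rewrite ImD.
rewrite [X in X +i* _]deriveD; [|exact: csmooth_derivable|exact: csmooth_derivable].
rewrite [X in _ +i* X]deriveD; [|exact: csmooth_derivable|exact: csmooth_derivable].
by [].
Qed.

Lemma cderiveM f g p v : ccsmooth_at p f -> ccsmooth_at p g ->
  cderive v (fun q => f q * g q) p = cderive v f p * g p + f p * cderive v g p.
Proof.
move=> [f1 f2] [g1 g2]; rewrite /cderive.
under eq_fun do rewrite ReM.
under [X in _ +i* 'D_v X p]eq_fun do rewrite ImM.
have Df1 := csmooth_derivable (v := v) f1; have Df2 := csmooth_derivable (v := v) f2.
have Dg1 := csmooth_derivable (v := v) g1; have Dg2 := csmooth_derivable (v := v) g2.
have D11 := derivableM Df1 Dg1; have D22 := derivableM Df2 Dg2.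
have D12 := derivableM Df1 Dg2; have D21 := derivableM Df2 Dg1.
rewrite [X in X +i* _](deriveB D11 D22) [X in _ +i* X](deriveD D12 D21).
rewrite (deriveM Df1 Dg1) (deriveM Df2 Dg2) (deriveM Df1 Dg2) (deriveM Df2 Dg1).
rewrite /GRing.scale /=; case: (f p) => a b; case: (g p) => c d.
move: ('D_v (fun q => complex.Re (f q)) p) ('D_v (fun q => complex.Im (f q)) p)
  ('D_v (fun q => complex.Re (g q)) p) ('D_v (fun q => complex.Im (g q)) p).
by move=> x1 x2 y1 y2; congr (_ +i* _) => /=; ring.
Qed.

Lemma cderive_conj f p v : ccsmooth_at p f ->
  cderive v (fun q => (f q)^*) p = (cderive v f p)^*.
Proof.
move=> [f1 f2]; rewrite /cderive.
have -> : (fun q => complex.Re (f q)^*) = fun q => complex.Re (f q).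
  by apply/funext => q; case: (f q).
have -> : (fun q => complex.Im (f q)^*) = - fun q => complex.Im (f q).
  by apply/funext => q; rewrite !fctE; case: (f q).
by rewrite deriveN //; exact: csmooth_derivable.
Qed.

End Fixed.

Lemma ccsmooth_comp m n (f : 'rV[R]_n -> C) (g : 'rV[R]_m -> 'rV[R]_n) p :
  (forall j, csmooth_at p (fun q => g q 0 j)) -> ccsmooth_at (g p) f ->
  ccsmooth_at p (fun q => f (g q)).
Proof.
move=> Hg [f1 f2]; split.
  exact: (csmooth_comp (f := fun q => complex.Re (f q))).
exact: (csmooth_comp (f := fun q => complex.Im (f q))).
Qed.

Lemma cderive_comp m n (f : 'rV[R]_n -> C) (g : 'rV[R]_m -> 'rV[R]_n) p v :
  (forall j, csmooth_at p (fun q => g q 0 j)) -> ccsmooth_at (g p) f ->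
  cderive v (fun q => f (g q)) p =
  \sum_(j < n) ('D_v (fun q => g q 0 j) p)%:C * cderive (delta_mx 0 j) f (g p).
Proof.
move=> Hg [f1 f2].
have dg j : differentiable (fun q => g q 0 j) p by exact: csmooth_differentiable.
rewrite /cderive.
rewrite (derive_comp (f := fun q => complex.Re (f q))) //; last exact: csmooth_differentiable.
rewrite (derive_comp (f := fun q => complex.Im (f q))) //; last exact: csmooth_differentiable.
apply: (big_ind3 (fun a b (c : C) => a +i* b = c)) => //.
  by move=> a1 a2 b1 b2 c1 c2 <- <-.
by move=> j _; rewrite /real_complex_def /= /GRing.mul /= !mul0r subr0 addr0.
Qed.

End ComplexValued.

(** * Smooth functions on a manifold and their differentials *)

Section ChartLaws.
Variable R : realType.

(** The part of the manifold axioms that differential calculus uses, phrased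
    through neighbourhoods so that it passes to products. *)
Record chart_laws (M : mfd R) : Prop := {
  cl_open : forall x y : M, cdom x y -> \forall z \near y, cdom x z;
  cl_mem : forall x : M, cdom x x;
  cl_K : forall x y : M, cdom x y -> cinv x (chart x y) = y;
  cl_chart : forall x y : M, cdom x y -> {for y, continuous (chart x)};
  cl_cinv : forall x y : M, cdom x y ->
    {for chart x y, continuous (cinv (m := M) x)};
  cl_inv : forall x y : M, cdom x y ->
    \forall p \near chart x y, chart x (cinv x p) = p;
  cl_smooth : forall (x y z : M) (k : 'I_(mdim M)), cdom x z -> cdom y z ->
    csmooth_at (chart x z) (fun p => chart y (cinv x p) 0 k) }.

Lemma manifold_chart_laws (M : mfd R) : manifold_ok M -> chart_laws M.
Proof.
case=> _ _ oD mD oI K cC cI sC; split=> // x y xy.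
  exact: open_nbhs_nbhs (conj (oD x) xy).
have : nbhs (chart x y) (chart x @` cdom x).
  by apply: open_nbhs_nbhs; split => //; exists y.
by apply: filterS => p [z xz <-]; rewrite K.
Qed.

Variables (M : mfd R) (cl : chart_laws M).
Local Notation C := R[i].
Local Notation n := (mdim M).
Implicit Types (f g : M -> C) (x y z : M).

Lemma near_cinv x z (P : set M) : cdom x z -> (\forall y \near z, P y) ->
  \forall p \near chart x z, P (cinv x p).
Proof. by move=> xz nP; apply: (cl_cinv cl xz); rewrite /= (cl_K cl xz). Qed.

Lemma near_chart x z (P : set 'rV[R]_n) : cdom x z ->
  (\forall p \near chart x z, P p) -> \forall y \near z, P (chart x y).
Proof. by move=> xz nP; exact: (cl_chart cl xz). Qed.

(** In the chart around [x] the function is its expression in the chart around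
    [y], composed with the change of charts. *)
Lemma ccsmooth_chart_change x y z f : cdom x z -> cdom y z ->
  ccsmooth_at (chart y z) (fun p => f (cinv y p)) ->
  ccsmooth_at (chart x z) (fun p => f (cinv x p)).
Proof.
move=> xz yz Hf.
have Hn := near_cinv xz (cl_open cl yz).
apply: (@ccsmooth_near_eq _ _ (fun p => f (cinv y (chart y (cinv x p))))).
  by apply: filterS Hn => p yp; rewrite (cl_K cl yp).
apply: (ccsmooth_comp (f := fun p => f (cinv y p))
  (g := fun p => chart y (cinv x p))).
  by move=> j; exact: cl_smooth.
by rewrite (cl_K cl xz).
Qed.

Lemma smooth_nearE x z f : cdom x z ->
  smooth_near z f <-> ccsmooth_at (chart x z) (fun p => f (cinv x p)).
Proof.
by move=> xz; split; apply: ccsmooth_chart_change => //; exact: cl_mem.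
Qed.

(** Smoothness near [x] refers to the chart around [x] and smoothness near [y]
    to the one around [y]; the change of charts connects them. *)
Lemma smooth_near_near x f : smooth_near x f -> \forall y \near x, smooth_near y f.
Proof.
move=> /ccsmooth_near /(near_chart (cl_mem cl x)) H.
apply: filterS2 H (cl_open cl (cl_mem cl x)) => y Hy xy.
by apply/(smooth_nearE _ xy).
Qed.

Lemma smooth_near_eq x f g : (\forall y \near x, f y = g y) ->
  smooth_near x f -> smooth_near x g.
Proof.
move=> fg; apply: ccsmooth_near_eq.
exact: (near_cinv (P := fun y => f y = g y) (cl_mem cl x)).
Qed.

Lemma smooth_near_ext x f g : (forall y, f y = g y) ->
  smooth_near x f -> smooth_near x g.
Proof. by move=> /funext ->. Qed.

(** Functions of the coordinates; [chart x] inverts [cinv x] only near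
    [chart x z], whence the hypothesis that [z] lies in the chart domain. *)
Lemma smooth_near_chart x z (G : 'rV[R]_n -> C) : cdom x z ->
  ccsmooth_at (chart x z) G -> smooth_near z (fun y => G (chart x y)).
Proof.
move=> xz HG; apply/(smooth_nearE _ xz); apply: ccsmooth_near_eq HG.
by apply: filterS (cl_inv cl xz) => p ->.
Qed.

Lemma smooth_near_cst x (c : C) : smooth_near x (fun=> c).
Proof. exact: ccsmooth_cst. Qed.

Lemma smooth_nearD x f g : smooth_near x f -> smooth_near x g ->
  smooth_near x (fun y => f y + g y).
Proof. exact: ccsmoothD. Qed.

Lemma smooth_nearM x f g : smooth_near x f -> smooth_near x g ->
  smooth_near x (fun y => f y * g y).
Proof. exact: ccsmoothM. Qed.

Lemma smooth_near_conj x f : smooth_near x f -> smooth_near x (fun y => (f y)^*).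
Proof. exact: ccsmooth_conj. Qed.

Lemma smooth_nearV x f : f x != 0 -> smooth_near x f ->
  smooth_near x (fun y => (f y)^-1).
Proof.
by move=> fx0; apply: ccsmoothV; rewrite (cl_K cl (cl_mem cl x)).
Qed.

Lemma smooth_near_sum x (I : Type) (s : seq I) (F : I -> M -> C) :
  (forall i, smooth_near x (F i)) -> smooth_near x (fun y => \sum_(i <- s) F i y).
Proof. exact: (@ccsmooth_sum _ _ _ s (fun i p => F i (cinv x p))). Qed.

Lemma smooth_near_prod x (I : Type) (s : seq I) (F : I -> M -> C) :
  (forall i, smooth_near x (F i)) -> smooth_near x (fun y => \prod_(i <- s) F i y).
Proof. exact: (@ccsmooth_prod _ _ _ s (fun i p => F i (cinv x p))). Qed.

Lemma pderE f x k :
  pder f x k = cderive (delta_mx 0 k) (fun p => f (cinv x p)) (chart x x).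
Proof. by []. Qed.

Lemma dfun_near_eq f g x v : (\forall y \near x, f y = g y) ->
  dfun f x v = dfun g x v.
Proof.
move=> fg; apply: eq_bigr => k _; congr (_ * _); apply: cderive_near_eq.
exact: (near_cinv (P := fun y => f y = g y) (cl_mem cl x)).
Qed.

Lemma dfun_linear f x c u v : dfun f x (c *: u + v) = c * dfun f x u + dfun f x v.
Proof.
rewrite /dfun mulr_sumr -big_split /=; apply: eq_bigr => k _.
by rewrite !mxE mulrDl mulrA.
Qed.

Lemma dfun0 f x : dfun f x 0 = 0.
Proof. by rewrite /dfun big1// => k _; rewrite mxE mul0r. Qed.

Lemma dfun_combination f x (I : Type) (s : seq I) (c : I -> C) (v : I -> 'rV[C]_n) :
  dfun f x (\sum_(i <- s) c i *: v i) = \sum_(i <- s) c i * dfun f x (v i).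
Proof.
elim: s => [|i s IH]; first by rewrite !big_nil dfun0.
by rewrite !big_cons dfun_linear IH.
Qed.

Lemma dfun_cst (c : C) x v : dfun (fun=> c) x v = 0.
Proof. by rewrite /dfun big1// => k _; rewrite pderE cderive_cst mulr0. Qed.

Lemma dfunD f g x v : smooth_near x f -> smooth_near x g ->
  dfun (fun y => f y + g y) x v = dfun f x v + dfun g x v.
Proof.
move=> Hf Hg; rewrite /dfun -big_split /=; apply: eq_bigr => k _.
by rewrite !pderE cderiveD// mulrDr.
Qed.

Lemma dfunM f g x v : smooth_near x f -> smooth_near x g ->
  dfun (fun y => f y * g y) x v = dfun f x v * g x + f x * dfun g x v.
Proof.
move=> Hf Hg; rewrite /dfun mulr_suml mulr_sumr -big_split /=.
apply: eq_bigr => k _.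
rewrite !pderE cderiveM// (cl_K cl (cl_mem cl x)); ring.
Qed.

Lemma dfun_conj f x v : smooth_near x f ->
  dfun (fun y => (f y)^*) x v = (dfun f x (map_mx conjc v))^*.
Proof.
move=> Hf; rewrite /dfun rmorph_sum; apply: eq_bigr => k _.
by rewrite rmorphM mxE /= conjcK !pderE cderive_conj.
Qed.

Lemma dfun_sum (I : Type) (s : seq I) (F : I -> M -> C) x v :
  (forall i, smooth_near x (F i)) ->
  dfun (fun y => \sum_(i <- s) F i y) x v = \sum_(i <- s) dfun (F i) x v.
Proof.
move=> HF; elim: s => [|i s IH].
  rewrite big_nil (_ : (fun _ => _) = fun=> 0) ?dfun_cst//.
  by apply/funext => y; rewrite big_nil.
rewrite big_cons -IH -dfunD//; last exact: smooth_near_sum.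
by congr (dfun _ x v); apply/funext => y; rewrite big_cons.
Qed.

(** The coordinate field number [a] of the chart around [x], at [y] and in the
    chart around [y]; it is the frame of the tangent bundle. *)
Definition cvec x y (a : 'I_n) : 'rV[C]_n :=
  realvec (\row_k 'D_(delta_mx 0 a) (fun p => chart y (cinv x p) 0 k) (chart x y)).

(** Chain rule: differentiating along a coordinate field is taking a partial
    derivative in the chart that the field comes from. *)
Lemma dfun_cvec x z f a : cdom x z -> smooth_near z f ->
  dfun f z (cvec x z a) =
  cderive (delta_mx 0 a) (fun p => f (cinv x p)) (chart x z).
Proof.
move=> xz Hf.
have zz := cl_mem cl z.
have Hn := near_cinv xz (cl_open cl zz).
rewrite (@cderive_near_eq _ _ _ (fun p => f (cinv z (chart z (cinv x p))))); last first.
  by apply: filterS Hn => p yp; rewrite (cl_K cl yp).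
rewrite (cderive_comp (f := fun p => f (cinv z p)) (g := fun p => chart z (cinv x p))).
- by rewrite (cl_K cl xz); apply: eq_bigr => j _; rewrite !mxE.
- by move=> j; exact: cl_smooth.
- by rewrite (cl_K cl xz).
Qed.

Lemma smooth_dfun_cvec x z f a : cdom x z -> smooth_near z f ->
  smooth_near z (fun y => dfun f y (cvec x y a)).
Proof.
move=> xz Hf.
have H : ccsmooth_at (chart x z) (cderive (delta_mx 0 a) (fun p => f (cinv x p))).
  by apply: ccsmooth_cderive; apply/(smooth_nearE _ xz).
apply: smooth_near_eq (smooth_near_chart xz H).
apply: filterS2 (cl_open cl xz) (smooth_near_near Hf) => y xy fy.
by rewrite dfun_cvec.
Qed.

Lemma smooth_near_det x m (A : M -> 'M[C]_m) :
  (forall i j, smooth_near x (fun y => A y i j)) ->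
  smooth_near x (fun y => \det (A y)).
Proof.
move=> HA; apply: smooth_near_sum => s; apply: smooth_nearM.
  exact: smooth_near_cst.
by apply: smooth_near_prod => i; exact: HA.
Qed.

(** Cramer's rule: the entries are polynomials in those of [A] divided by the
    determinant. *)
Lemma smooth_near_invmx x m (A : M -> 'M[C]_m) :
  (forall i j, smooth_near x (fun y => A y i j)) ->
  (\forall y \near x, A y \in unitmx) ->
  forall i j, smooth_near x (fun y => invmx (A y) i j).
Proof.
move=> HA nA i j.
have dA := smooth_near_det HA.
have d0 : \det (A x) != 0 by have := nbhs_singleton nA; rewrite unitmxE unitfE.
have sadj : smooth_near x (fun y => (\adj (A y)) i j).
  apply: (@smooth_near_ext _ (fun y => (-1) ^+ (j + i) *
      \det (row' j (col' i (A y))))).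
    by move=> y; rewrite mxE /cofactor.
  apply: smooth_nearM; first exact: smooth_near_cst.
  apply: smooth_near_det => a b.
  by apply: (smooth_near_ext _ (HA (lift j a) (lift i b))) => y; rewrite !mxE.
apply: smooth_near_eq (smooth_nearM (smooth_nearV d0 dA) sadj).
by apply: filterS nA => y Ay; rewrite /invmx Ay [RHS]mxE.
Qed.

End ChartLaws.

(** * Smooth sections of a vector bundle *)

Section BundleSections.
Variables (R : realType) (M : mfd R).
Local Notation C := R[i].
Local Notation n := (mdim M).
Hypothesis cl : chart_laws M.

Lemma basis_coordE (W : vectType C) r (b : r.-tuple W) (w : W) :
  basis_of {:W} b -> w = \sum_(a < r) coord b a w *: tnth b a.
Proof.
move=> bb; rewrite {1}(coord_basis bb (memvf w)).
by apply: eq_bigr => a _; rewrite (tnth_nth 0).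
Qed.

Lemma coord_basis_tnth (W : vectType C) r (b : r.-tuple W) (i j : 'I_r) :
  basis_of {:W} b -> coord b i (tnth b j) = (i == j)%:R.
Proof. by move=> bb; rewrite (tnth_nth 0) coord_free ?(basis_free bb)// eq_sym. Qed.

Variables (V : bundle M).
Hypothesis vb : vector_bundle V.
Implicit Types (u w : section V) (x y z : M) (f : M -> C).

Lemma frame_basis_at x : basis_of {: fib V x} (frame V x x).
Proof. exact: nbhs_singleton (frame_basis vb x). Qed.

Lemma smooth_sec_near_eq x u w : (\forall y \near x, u y = w y) ->
  smooth_sec_near x u -> smooth_sec_near x w.
Proof.
move=> uw Hu a; apply: (smooth_near_eq cl) (Hu a).
by apply: filterS uw => y ->.
Qed.

Lemma smooth_sec_nearD x u w : smooth_sec_near x u -> smooth_sec_near x w ->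
  smooth_sec_near x (fun y => u y + w y).
Proof.
move=> Hu Hw a.
by apply: (smooth_near_ext _ (smooth_nearD (Hu a) (Hw a))) => y; rewrite linearD.
Qed.

Lemma smooth_sec_nearZ x f u : smooth_near x f -> smooth_sec_near x u ->
  smooth_sec_near x (fun y => f y *: u y).
Proof.
move=> Hf Hu a.
by apply: (smooth_near_ext _ (smooth_nearM Hf (Hu a))) => y; rewrite linearZ.
Qed.

Lemma smooth_sec_near0 x : smooth_sec_near (V := V) x (fun=> 0).
Proof.
by move=> a; apply: (smooth_near_ext _ (smooth_near_cst x 0)) => y; rewrite linear0.
Qed.

Lemma smooth_sec_near_sum x (I : Type) (s : seq I) (F : I -> section V) :
  (forall i, smooth_sec_near x (F i)) ->
  smooth_sec_near x (fun y => \sum_(i <- s) F i y).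
Proof.
move=> HF a; have H := smooth_near_sum s (fun i => HF i a).
by apply: (smooth_near_ext _ H) => y; rewrite linear_sum.
Qed.

Lemma smooth_sec_nearN x u : smooth_sec_near x u ->
  smooth_sec_near x (fun y => - u y).
Proof.
move=> Hu a; have := smooth_nearM (smooth_near_cst x (-1)) (Hu a).
by apply: smooth_near_ext => y; rewrite linearN mulN1r.
Qed.

Lemma smooth_frame x a : smooth_sec_near x (fun y => tnth (frame V x y) a).
Proof. exact: nbhs_singleton (frame_smooth vb x) a. Qed.

(** The coefficients solve a linear system whose matrix consists of the
    coefficients of the sections [e] in the distinguished frame; its inverse is
    smooth by Cramer's rule. *)
Lemma smooth_coord z r (e : forall y : M, r.-tuple (fib V y)) (w : section V) i :
  (\forall y \near z, basis_of {: fib V y} (e y)) ->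
  (forall j, smooth_sec_near z (fun y => tnth (e y) j)) ->
  smooth_sec_near z w -> smooth_near z (fun y => coord (e y) i (w y)).
Proof.
move=> eb es ws.
have fb := frame_basis vb z.
have rk : r = rank V z.
  by rewrite -(size_basis (nbhs_singleton eb)) -(size_basis (nbhs_singleton fb)).
move: fb es ws; rewrite /smooth_sec_near.
move: (frame V z) => fr; move: (rank V z) rk fr => r' rk; subst r' => fr fb es ws.
pose T y := \matrix_(a, j) coord (fr y) a (tnth (e y) j).
have Tu : \forall y \near z, T y \in unitmx.
  apply: filterS2 eb fb => y ey fy.
  have : T y *m (\matrix_(j, a) coord (e y) j (tnth (fr y) a)) = 1%:M.
    apply/matrixP => a b; rewrite !mxE -(coord_basis_tnth a b fy).
    rewrite (basis_coordE (tnth (fr y) b) ey) linear_sum /=.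
    by apply: eq_bigr => j _; rewrite linearZ /= !mxE mulrC.
  by move=> /mulmx1_unit[].
have sT a j : smooth_near z (fun y => T y a j).
  by apply: smooth_near_ext (es j a) => y; rewrite mxE.
have H : smooth_near z (fun y => \sum_a invmx (T y) i a * coord (fr y) a (w y)).
  apply: smooth_near_sum => a; apply: smooth_nearM; last exact: ws.
  exact: smooth_near_invmx.
apply: (smooth_near_eq cl) H; near=> y.
have ey : basis_of {: fib V y} (e y) by near: y.
have Ty : T y \in unitmx by near: y.
pose c := \col_j coord (e y) j (w y).
have wc : \col_a coord (fr y) a (w y) = T y *m c.
  apply/matrixP => a b; rewrite !mxE {1}(basis_coordE (w y) ey) linear_sum /=.
  by apply: eq_bigr => j _; rewrite linearZ /= !mxE mulrC.
transitivity ((invmx (T y) *m (\col_a coord (fr y) a (w y))) i 0).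
  by rewrite mxE; apply: eq_bigr => a _; rewrite mxE.
by rewrite wc mulKmx// mxE.
Unshelve. all: by end_near. Qed.

(** The coefficients in the frame around [x] stay smooth at nearby points, and
    so do the frame sections themselves, by the compatibility of frames. *)
Lemma smooth_sec_near_near x u : smooth_sec_near x u ->
  \forall y \near x, smooth_sec_near y u.
Proof.
move=> Hu.
have Hc : \forall y \near x, forall a,
    smooth_near y (fun z => coord (frame V x z) a (u z)).
  by apply: filter_forall => a; exact: smooth_near_near.
have Hb : \forall y \near x, \forall z \near y, basis_of {: fib V z} (frame V x z).
  exact: nbhs_interior (frame_basis vb x).
apply: filterS3 Hc Hb (frame_smooth vb x) => y cy by_ fy.
apply: (@smooth_sec_near_eq _ (fun z =>
    \sum_a coord (frame V x z) a (u z) *: tnth (frame V x z) a)).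
  by apply: filterS by_ => z bz; rewrite -basis_coordE.
apply: smooth_sec_near_sum => a; apply: smooth_sec_nearZ; first exact: cy.
exact: fy.
Qed.

(** Identities between derivatives of Hom-valued sections are checked on vectors,
    and this extends a vector to a smooth section. *)
Definition const_ext x (w : fib V x) : section V :=
  fun y => \sum_a coord (frame V x x) a w *: tnth (frame V x y) a.

Lemma const_ext_val x (w : fib V x) : const_ext w x = w.
Proof. by rewrite /const_ext -basis_coordE//; exact: frame_basis_at. Qed.

Lemma smooth_const_ext x (w : fib V x) : smooth_sec_near x (const_ext w).
Proof.
apply: smooth_sec_near_sum => a.
by apply: smooth_sec_nearZ; [exact: smooth_near_cst|exact: smooth_frame].
Qed.

Lemma frame_expansion x u :
  \forall y \near x, u y = \sum_a coord (frame V x y) a (u y) *: tnth (frame V x y) a.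
Proof. by apply: filterS (frame_basis vb x) => y; exact: basis_coordE. Qed.

End BundleSections.

(** * The Hom bundle and its connection *)

Section LinearMaps.
Variables (K : fieldType) (U W : vectType K).

Lemma linfun_lin (f : U -> W) (v : U) : linear f -> linfun f v = f v.
Proof.
move=> lf.
pose g : {linear U -> W} := HB.pack f (GRing.isLinear.Build K U W _ f lf).
exact: (lfunE g v).
Qed.

End LinearMaps.

Section HomBundle.
Variables (R : realType) (M : rmfd R).
Local Notation C := R[i].
Local Notation n := (mdim M).
Hypotheses (cl : chart_laws M).

Section Frames.
Variables V W : bundle M.
Hypotheses (vV : vector_bundle V) (vW : vector_bundle W).
Local Notation K x := {: 'I_(rank V x) * 'I_(rank W x)}.

Lemma homb_frameE x y (k : 'I_#|K x|) (e : fib V y) :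
  (tnth (frame (homb V W) x y) k : 'Hom(fib V y, fib W y)) e =
  coord (frame V x y) (enum_val k).1 e *: tnth (frame W x y) (enum_val k).2.
Proof.
rewrite /= tnth_mktuple linfun_lin// => c u v.
by rewrite linearP scalerDl scalerA.
Qed.

(** The elementary maps sending one frame vector of [V] to one of [W] span the
    maps from [V] to [W]; the coefficients are the matrix entries. *)
Lemma homb_frame_sum x y (c : 'Hom(fib V y, fib W y)) :
  basis_of {: fib V y} (frame V x y) -> basis_of {: fib W y} (frame W x y) ->
  c = \sum_(k < #|K x|) coord (frame W x y) (enum_val k).2
        (c (tnth (frame V x y) (enum_val k).1)) *:
      (tnth (frame (homb V W) x y) k : 'Hom(fib V y, fib W y)).
Proof.
move=> bV bW; apply/lfunP => e.
rewrite sum_lfunE {1}(basis_coordE e bV) linear_sum /=.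
under [RHS]eq_bigr do rewrite scale_lfunE homb_frameE.
pose G (ab : K x) := coord (frame W x y) ab.2 (c (tnth (frame V x y) ab.1)) *:
   (coord (frame V x y) ab.1 e *: tnth (frame W x y) ab.2).
transitivity (\sum_(ab in {: K x}) G ab); last by rewrite (big_enum_val G).
transitivity (\sum_a \sum_b G (a, b)); last first.
  by rewrite pair_bigA; apply: eq_big => // -[a b].
apply: eq_bigr => a _; rewrite linearZ /= {1}(basis_coordE (c _) bW) scaler_sumr.
by apply: eq_bigr => b _; rewrite /G /= !scalerA [in LHS]mulrC.
Qed.

Lemma homb_basis x y :
  basis_of {: fib V y} (frame V x y) -> basis_of {: fib W y} (frame W x y) ->
  basis_of {: fib (homb V W) y} (frame (homb V W) x y).
Proof.
move=> bV bW; rewrite basisEdim; apply/andP; split.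
  apply/subvP => c _; rewrite (homb_frame_sum c bV bW).
  apply: memv_suml => k _; apply: memvZ; apply: memv_span; exact: mem_tnth.
have E : #|{: K x}| = (rank V x * rank W x)%N by rewrite card_prod !card_ord.
rewrite size_tuple dimvf [rank _ _]E.
rewrite -(size_basis bV) -(size_basis bW) !dimvf.
exact: leqnn.
Qed.

Lemma homb_coord x y (c : fib (homb V W) y) k :
  basis_of {: fib V y} (frame V x y) -> basis_of {: fib W y} (frame W x y) ->
  coord (frame (homb V W) x y) k c =
  coord (frame W x y) (enum_val k).2
    ((c : 'Hom(fib V y, fib W y)) (tnth (frame V x y) (enum_val k).1)).
Proof.
move=> bV bW; pose F (k : 'I_(rank (homb V W) x)) : C := coord (frame W x y) (enum_val k).2
  ((c : 'Hom(fib V y, fib W y)) (tnth (frame V x y) (enum_val k).1)).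
have cE : c = \sum_k F k *: (frame (homb V W) x y)`_k.
  rewrite {1}(homb_frame_sum c bV bW).
  by apply: eq_bigr => j _; rewrite /F -tnth_nth; reflexivity.
rewrite {1}cE; exact: (coord_sum_free F k (basis_free (homb_basis bV bW))).
Qed.

Lemma homb_near_bases x : \forall y \near x,
  basis_of {: fib V y} (frame V x y) /\ basis_of {: fib W y} (frame W x y).
Proof. by apply: filterS2 (frame_basis vV x) (frame_basis vW x) => y. Qed.

(** The coefficients of [c] are those of the images under [c] of the frame
    sections of [V].  This lemma and its converse [homb_smoothP] replace
    computations with coefficients in smoothness proofs. *)
Lemma homb_smooth_apply x (c : section (homb V W)) (u : section V) :
  smooth_sec_near x c -> smooth_sec_near x u ->
  smooth_sec_near x (fun y => (c y : 'Hom(fib V y, fib W y)) (u y)).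
Proof.
move=> Hc Hu.
have H : smooth_sec_near x (fun y => \sum_a \sum_b
   (coord (frame V x y) a (u y) *
   coord (frame (homb V W) x y) (enum_rank ((a, b) : K x)) (c y)) *:
      tnth (frame W x y) b).
  apply: smooth_sec_near_sum => a; apply: smooth_sec_near_sum => b.
  by apply: smooth_sec_nearZ; [exact: smooth_nearM|exact: (smooth_frame vW)].
apply: (smooth_sec_near_eq cl) H; apply: filterS (homb_near_bases x) => y [bV bW].
rewrite [in RHS](basis_coordE (u y) bV) linear_sum; apply: eq_bigr => a _.
rewrite linearZ /= [in RHS](basis_coordE (c y _) bW) scaler_sumr.
by apply: eq_bigr => b _; rewrite homb_coord// enum_rankK scalerA.
Qed.

Lemma homb_smoothP x (c : section (homb V W)) :
  (forall u : section V, smooth_sec_near x u ->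
     smooth_sec_near x (fun y => (c y : 'Hom(fib V y, fib W y)) (u y))) ->
  smooth_sec_near x c.
Proof.
move=> H k; have := H _ (smooth_frame vV (enum_val k).1) (enum_val k).2.
apply: (smooth_near_eq cl); apply: filterS (homb_near_bases x) => y [bV bW].
by rewrite homb_coord.
Qed.

Lemma homb_vector_bundle : vector_bundle (homb V W).
Proof.
split=> x.
  by apply: filterS (homb_near_bases x) => y [bV bW]; exact: homb_basis.
apply: filterS3 (nbhs_interior (frame_basis vV x)) (frame_smooth vV x)
  (frame_smooth vW x) => y bV sV sW k.
apply: homb_smoothP => u Hu.
have -> : (fun z => (tnth (frame (homb V W) x z) k : 'Hom(fib V z, fib W z)) (u z)) =
    fun z => coord (frame V x z) (enum_val k).1 (u z) *: tnth (frame W x z) (enum_val k).2.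
  by apply/functional_extensionality_dep => z; rewrite homb_frameE.
by apply: smooth_sec_nearZ; [exact: (smooth_coord cl vV)|exact: sW].
Qed.

End Frames.

Section ConnectionRules.
Variable V : bundle M.
Hypotheses (vV : vector_bundle V) (cV : is_connection V).

Lemma conn0 x v : conn (fun y => 0 : fib V y) x v = 0.
Proof.
have := conn_leibniz cV v (smooth_near_cst x 0) (@smooth_sec_near0 _ _ V x).
rewrite dfun_cst scaler0 !scale0r addr0 => <-.
by apply: (f_equal (fun c => conn c x v)); apply/functional_extensionality_dep => y; rewrite scale0r.
Qed.

Lemma conn_sum x (I : Type) (s : seq I) (F : I -> section V) v :
  (forall i, smooth_sec_near x (F i)) ->
  conn (fun y => \sum_(i <- s) F i y) x v = \sum_(i <- s) conn (F i) x v.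
Proof.
move=> HF; elim: s => [|i s IH].
  rewrite big_nil -[RHS](conn0 x v).
  by apply: (f_equal (fun c => conn c x v)); apply/functional_extensionality_dep => y; rewrite big_nil.
rewrite big_cons -IH -add_lfunE -conn_add//; last exact: smooth_sec_near_sum.
by apply: (f_equal (fun c => conn c x v)); apply/functional_extensionality_dep => y; rewrite big_cons.
Qed.

Lemma connN x (u : section V) v : smooth_sec_near x u ->
  conn (fun y => - u y) x v = - conn u x v.
Proof.
move=> Hu.
have := conn_leibniz cV v (smooth_near_cst x (-1)) Hu.
rewrite dfun_cst scale0r add0r scaleN1r => <-.
by apply: (f_equal (fun c => conn c x v)); apply/functional_extensionality_dep => y; rewrite scaleN1r.
Qed.

(** Covariant derivatives are computed in any local smooth family, by locality,
    additivity and the Leibniz rule. *)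
Lemma conn_combination x r (f : 'I_r -> M -> C) (e : 'I_r -> section V)
    (u : section V) v :
  (forall a, smooth_near x (f a)) -> (forall a, smooth_sec_near x (e a)) ->
  (\forall y \near x, u y = \sum_a f a y *: e a y) ->
  conn u x v = \sum_a (dfun (f a) x v *: e a x + f a x *: conn (e a) x v).
Proof.
move=> Hf He uE; rewrite (conn_local cV uE) conn_sum; last first.
  by move=> a; exact: smooth_sec_nearZ.
by apply: eq_bigr => a _; rewrite conn_leibniz.
Qed.

End ConnectionRules.

Section HomConnection.
Variables V W : bundle M.
Hypotheses (vV : vector_bundle V) (vW : vector_bundle W).
Hypotheses (cV : is_connection V) (cW : is_connection W).
Hypothesis vT : vector_bundle (tanb M).

Lemma homb_connE (c : section (homb V W)) x v w :
  (conn c x v : 'Hom(fib V x, fib W x)) w =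
  \sum_(a < rank V x) coord (frame V x x) a w *:
      (conn (fun y => (c y : 'Hom(fib V y, fib W y)) (tnth (frame V x y) a)) x v -
       (c x : 'Hom(fib V x, fib W x)) (conn (fun y => tnth (frame V x y) a) x v)).
Proof.
have L (v0 : 'rV[C]_n) : linear (fun w : fib V x =>
    \sum_(a < rank V x) coord (frame V x x) a w *:
      (conn (fun y => (c y : 'Hom(fib V y, fib W y)) (tnth (frame V x y) a)) x v0 -
       (c x : 'Hom(fib V x, fib W x)) (conn (fun y => tnth (frame V x y) a) x v0))).
  move=> k u u'; rewrite scaler_sumr -big_split /=; apply: eq_bigr => a _.
  by rewrite linearP scalerDl scalerA.
rewrite /= linfun_lin; first by rewrite linfun_lin.
move=> k u u'; apply/lfunP => w0.
rewrite add_lfunE scale_lfunE !linfun_lin// scaler_sumr -big_split /=.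
apply: eq_bigr => a _; rewrite !linearP /= !scalerA [in RHS]mulrC -scalerA -scalerDr.
by congr (_ *: _); rewrite scalerBr addrACA scalerN.
Qed.

(** Both sides are expanded in the frame of [V] around [x]: the defining
    formula of the connection of the Hom bundle holds for the frame sections,
    and the terms with derivatives of the coefficients of [u] agree.  In
    particular that connection depends on the frame only apparently. *)
Lemma hom_leibniz x (c : section (homb V W)) (u : section V) v :
  smooth_sec_near x c -> smooth_sec_near x u ->
  conn (fun y => (c y : 'Hom(fib V y, fib W y)) (u y)) x v =
  (conn c x v : 'Hom(fib V x, fib W x)) (u x) +
  (c x : 'Hom(fib V x, fib W x)) (conn u x v).
Proof.
move=> Hc Hu.
have uE := @frame_expansion _ _ _ vV x u.
have se a := smooth_frame vV a (x := x).
rewrite (conn_combination cV v Hu (se) uE) homb_connE linear_sum -big_split /=.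
have cuE : \forall y \near x, (c y : 'Hom(fib V y, fib W y)) (u y) =
    \sum_a coord (frame V x y) a (u y) *:
      (c y : 'Hom(fib V y, fib W y)) (tnth (frame V x y) a).
  apply: filterS uE => y {1}->; rewrite linear_sum; apply: eq_bigr => a _.
  by rewrite linearZ.
rewrite (conn_combination cW (f := fun a y => coord (frame V x y) a (u y)) v _ _ cuE) //; last first.
  by move=> a; exact: homb_smooth_apply.
apply: eq_bigr => a _.
rewrite [c x (_ + _)]linearD /= 2!linearZ /= scalerBr.
by rewrite [RHS]addrACA addNr addr0 addrC.
Qed.

(** Smoothness of [conn c] is tested on smooth sections [X] and [w], on which
    the Leibniz rule expresses it through the connections of [V] and [W]. *)
Lemma homb_is_connection : is_connection (homb V W).
Proof.
have vH := homb_vector_bundle vV vW.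
have ap x (c : section (homb V W)) a : smooth_sec_near x c -> smooth_sec_near x
    (fun y => (c y : 'Hom(fib V y, fib W y)) (tnth (frame V x y) a)).
  by move=> Hc; apply: homb_smooth_apply => //; exact: smooth_frame.
split.
- move=> x c d cd; apply/lfunP => v; apply/lfunP => w; rewrite !homb_connE.
  apply: eq_bigr => a _; rewrite (nbhs_singleton cd); congr (_ *: (_ - _)).
  congr (fun_of_lfun _ v); apply: (conn_local cW).
  by apply: filterS cd => y ->.
- move=> x c d Hc Hd; apply/lfunP => v; apply/lfunP => w.
  rewrite !add_lfunE !homb_connE -big_split /=; apply: eq_bigr => a _.
  rewrite -scalerDr; congr (_ *: _).
  have -> : (fun y => (c y + d y : 'Hom(fib V y, fib W y)) (tnth (frame V x y) a)) =
    fun y => (c y : 'Hom(fib V y, fib W y)) (tnth (frame V x y) a) +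
             (d y : 'Hom(fib V y, fib W y)) (tnth (frame V x y) a).
    by apply/functional_extensionality_dep => y; rewrite add_lfunE.
  by rewrite (conn_add cW)// ?add_lfunE; [rewrite opprD addrACA|exact: ap|exact: ap].
- move=> x f c v Hf Hc; apply/lfunP => w.
  rewrite add_lfunE !scale_lfunE !homb_connE scaler_sumr.
  rewrite {2}(basis_coordE w (frame_basis_at vV x)) linear_sum scaler_sumr -big_split.
  apply: eq_bigr => a _ /=.
  have -> : (fun y => (f y *: c y : 'Hom(fib V y, fib W y)) (tnth (frame V x y) a)) =
    fun y => f y *: (c y : 'Hom(fib V y, fib W y)) (tnth (frame V x y) a).
    by apply/functional_extensionality_dep => y; rewrite scale_lfunE.
  rewrite (conn_leibniz cW)//; last exact: ap.
  rewrite scale_lfunE [c x (_ *: tnth _ _)]linearZ /= -addrA -scalerBr.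
  by rewrite scalerDr !scalerA ![coord _ _ _ * _]mulrC.
- move=> x c Hc.
  apply: (homb_smoothP vT vH) => X HX; apply: (homb_smoothP vV vW) => w Hw.
  have H1 := homb_smooth_apply vT vW (conn_smooth cW (homb_smooth_apply vV vW Hc Hw)) HX.
  have H2 := homb_smooth_apply vV vW Hc (homb_smooth_apply vT vV (conn_smooth cV Hw) HX).
  apply: (smooth_sec_near_eq cl) (smooth_sec_nearD H1 (smooth_sec_nearN H2)).
  apply: filterS2 (smooth_sec_near_near cl vH Hc) (smooth_sec_near_near cl vV Hw).
  by move=> y Hcy Hwy; rewrite hom_leibniz// addrK.
Qed.

End HomConnection.
End HomBundle.

(** * The tangent bundle, and bundles derived from it by elementary operations *)

Section TangentBundle.
Variables (R : realType) (M : rmfd R).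
Local Notation C := R[i].
Local Notation n := (mdim M).
Hypothesis cl : chart_laws M.

Lemma tanb_frameE (x y : M) a : tnth (frame (tanb M) x y) a = cvec x y a.
Proof. by rewrite /= tnth_mktuple. Qed.

(** The Jacobian matrix of the change from the chart around [x] to the one
    around [y]; its rows are the coordinate fields. *)
Definition jac (x y : M) (p : 'rV[R]_n) : 'M[R]_n :=
  \matrix_(a, k) 'D_(delta_mx 0 a) (fun q => chart y (cinv x q) 0 k) p.

Lemma cvec_jac (x y : M) a :
  cvec x y a = row a (map_mx (real_complex R) (jac x y (chart x y))).
Proof. by apply/rowP => k; rewrite !mxE. Qed.

(** The chain rule for changes of charts. *)
Lemma jac_comp (x y z w : M) : cdom x w -> cdom y w -> cdom z w ->
  jac x z (chart x w) = jac x y (chart x w) *m jac y z (chart y w).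
Proof.
move=> xw yw zw; apply/matrixP => a k; rewrite !mxE.
have Hn := near_cinv cl xw (cl_open cl yw).
rewrite (@near_eq_derive _ _ _ _ (fun q : 'rV[R]_n => chart z (cinv y (chart y (cinv x q))) 0 k)).
  rewrite (derive_comp (f := fun q => chart z (cinv y q) 0 k)
    (g := fun q => chart y (cinv x q))).
  - by rewrite (cl_K cl xw); apply: eq_bigr => j _; rewrite !mxE.
  - by move=> j; apply: csmooth_differentiable; exact: cl_smooth.
  - by rewrite (cl_K cl xw); apply: csmooth_differentiable; exact: cl_smooth.
by apply: filterS Hn => q yq; rewrite (cl_K cl yq).
Qed.

Lemma jac_id (x w : M) : cdom x w -> jac x x (chart x w) = 1%:M.
Proof.
move=> xw; apply/matrixP => a k; rewrite !mxE.
rewrite (@near_eq_derive _ _ _ _ (fun q : 'rV[R]_n => q 0 k : R)).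
  by rewrite derive_coord mxE eqxx /= eq_sym.
by apply: filterS (cl_inv cl xw) => q ->.
Qed.

Lemma jac_unit (x y w : M) : cdom x w -> cdom y w ->
  jac x y (chart x w) \in unitmx.
Proof.
move=> xw yw; have := jac_comp xw yw xw; rewrite jac_id// => /esym.
by move=> /mulmx1_unit[].
Qed.

Lemma tanb_basis (x y : M) : cdom x y ->
  basis_of {: fib (tanb M) y} (frame (tanb M) x y).
Proof.
move=> xy; set J := map_mx (real_complex R) (jac x y (chart x y)).
have Ju : J \in unitmx by rewrite map_unitmx; apply: jac_unit => //; exact: cl_mem.
rewrite basisEdim; apply/andP; split; last first.
  by rewrite size_tuple dimvf /= /dim /= mul1n.
apply/subvP => v _; have -> : v = v *m invmx J *m J by rewrite mulmxKV.
rewrite mulmx_sum_row; apply: memv_suml => a _; apply: memvZ; apply: memv_span.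
by rewrite -cvec_jac -tanb_frameE; exact: mem_tnth.
Qed.

Lemma cvec_change (x y z : M) a : cdom x z -> cdom y z ->
  cvec x z a = \sum_b ((jac x y (chart x z)) a b)%:C *: cvec y z b.
Proof.
move=> xz yz; rewrite cvec_jac (jac_comp xz yz (cl_mem cl z)) map_mxM row_mul mulmx_sum_row.
by apply: eq_bigr => b _; rewrite !mxE cvec_jac.
Qed.

(** The entries of the Jacobian matrices are the coefficients of the coordinate
    fields of one chart in those of another. *)
Lemma tanb_vector_bundle : vector_bundle (tanb M).
Proof.
split=> x.
  by apply: filterS (cl_open cl (cl_mem cl x)) => y; exact: tanb_basis.
apply: filterS (cl_open cl (cl_mem cl x)) => y xy a b.
have H : smooth_near y (fun z => ((jac x y (chart x z)) a b)%:C).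
  apply: (smooth_near_chart cl (G := fun p => ((jac x y p) a b)%:C) xy).
  apply: ccsmooth_real.
  apply: (csmooth_ext _ (csmooth_derive (delta_mx 0 a)
     (cl_smooth cl b xy (cl_mem cl y)))) => p.
  by rewrite mxE.
apply: (smooth_near_eq cl) H.
apply: filterS2 (cl_open cl xy) (cl_open cl (cl_mem cl y)) => z xz yz.
rewrite tanb_frameE (cvec_change _ xz yz).
under eq_bigr do rewrite -tanb_frameE (tnth_nth 0).
by rewrite coord_sum_free// (basis_free (tanb_basis yz)).
Qed.

Lemma smooth_dfun x (f : M -> C) (X : section (tanb M)) :
  smooth_near x f -> smooth_sec_near x X -> smooth_near x (fun y => dfun f y (X y)).
Proof.
move=> Hf HX.
have H : smooth_near x (fun y => \sum_a coord (frame (tanb M) x y) a (X y) *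
    dfun f y (cvec x y a)).
  apply: smooth_near_sum => a; apply: smooth_nearM; first exact: HX.
  exact: (smooth_dfun_cvec cl a (cl_mem cl x)).
apply: (smooth_near_eq cl) H.
apply: filterS (frame_basis tanb_vector_bundle x) => y by_.
rewrite [in RHS](basis_coordE (X y) by_).
symmetry; etransitivity; first exact: (dfun_combination f y (index_enum 'I_n)
  (fun a => coord (frame (tanb M) x y) a (X y)) (fun a => tnth (frame (tanb M) x y) a)).
by apply: eq_bigr => a _; rewrite tanb_frameE.
Qed.

Section Criterion.
Variable V : bundle M.
Hypothesis vV : vector_bundle V.

(** Additivity, the Leibniz rule and smoothness are read off from the usual
    expression in local frames: differentials of the coefficients plus smooth
    connection forms [w].  The expression is only available for smooth sections,
    whereas locality concerns all of them. *)
Lemma connection_of_frame_formula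
    (w : forall x : M, 'I_(rank V x) -> section (homb (tanb M) V)) :
  (forall x (u u' : section V), (\forall y \near x, u y = u' y) ->
     conn u x = conn u' x) ->
  (forall x a, smooth_sec_near x (w x a)) ->
  (forall x (u : section V), smooth_sec_near x u -> \forall y \near x, forall v,
     conn u y v = \sum_a
       (dfun (fun z => coord (frame V x z) a (u z)) y v *: tnth (frame V x y) a +
        coord (frame V x y) a (u y) *:
          (w x a y : 'Hom('rV[C]_n, fib V y)) v)) ->
  is_connection V.
Proof.
move=> locV sw connE; split=> //.
- move=> x u u' Hu Hu'; apply/lfunP => v; rewrite add_lfunE.
  rewrite (nbhs_singleton (connE _ _ (smooth_sec_nearD Hu Hu'))).
  rewrite (nbhs_singleton (connE _ _ Hu)) (nbhs_singleton (connE _ _ Hu')).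
  rewrite -big_split /=; apply: eq_bigr => a _.
  rewrite linearD scalerDl [in RHS]addrACA; congr (_ + _).
  rewrite -scalerDl -(dfunD v (Hu a) (Hu' a)); congr (dfun _ x v *: _).
  by apply/funext => z; rewrite linearD.
- move=> x f u v Hf Hu.
  rewrite (nbhs_singleton (connE _ _ (smooth_sec_nearZ Hf Hu))).
  rewrite (nbhs_singleton (connE _ _ Hu)) scaler_sumr.
  rewrite {2}(basis_coordE (u x) (frame_basis_at vV x)) scaler_sumr -big_split /=.
  apply: eq_bigr => a _.
  have -> : (fun z => coord (frame V x z) a (f z *: u z)) =
      fun z => f z * coord (frame V x z) a (u z).
    by apply/funext => z; rewrite linearZ.
  rewrite (dfunM cl v Hf (Hu a)) linearZ /= scalerDl scalerDr !scalerA.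
  by rewrite addrA.
- move=> x u Hu; apply: (homb_smoothP cl tanb_vector_bundle vV) => X HX.
  have H : smooth_sec_near x (fun y => \sum_a
       (dfun (fun z => coord (frame V x z) a (u z)) y (X y) *: tnth (frame V x y) a +
        coord (frame V x y) a (u y) *:
          (w x a y : 'Hom('rV[C]_n, fib V y)) (X y))).
    apply: smooth_sec_near_sum => a; apply: smooth_sec_nearD.
      apply: smooth_sec_nearZ; last exact: (smooth_frame vV).
      by apply: smooth_dfun => //; exact: Hu.
    apply: smooth_sec_nearZ; first exact: Hu.
    exact: (homb_smooth_apply cl tanb_vector_bundle vV (sw x a) HX).
  apply: (smooth_sec_near_eq cl) H.
  by apply: filterS (connE _ _ Hu) => y ->.
Qed.

End Criterion.
End TangentBundle.

Section SimpleBundles.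
Variables (R : realType) (M : rmfd R).
Local Notation C := R[i].
Local Notation n := (mdim M).
Hypothesis cl : chart_laws M.
Let vT := tanb_vector_bundle cl.

Lemma trivb_basis x y : basis_of {: fib (trivb M) y} (frame (trivb M) x y).
Proof.
rewrite basisEdim; apply/andP; split; last by rewrite size_tuple dimvf.
apply/subvP => v _; have -> : v = (v : C) *: (1 : C^o) by rewrite [RHS]mulr1.
by apply: memvZ; apply: memv_span; rewrite inE.
Qed.

Lemma trivb_coord x y a (z : C) : coord (frame (trivb M) x y) a (z : C^o) = z.
Proof.
have := basis_coordE (z : C^o) (trivb_basis x y).
by rewrite big_ord1 /= (ord1 a) => {2}->; rewrite (tnth_nth 0) /= [_ *: _]mulr1.
Qed.

Lemma trivb_smoothE x (f : section (trivb M)) :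
  smooth_sec_near x f <-> smooth_near x (f : M -> C).
Proof.
split=> H; first by apply: smooth_near_ext (H ord0) => y; rewrite trivb_coord.
by move=> a; apply: smooth_near_ext H => y; rewrite trivb_coord.
Qed.

Lemma trivb_vector_bundle : vector_bundle (trivb M).
Proof.
split=> x; first by apply: nearW => y; exact: trivb_basis.
apply: nearW => y a; apply/trivb_smoothE; rewrite (ord1 a).
exact: (smooth_near_cst y 1).
Qed.

Lemma trivb_connE (f : section (trivb M)) x v :
  conn f x v = dfun (f : M -> C) x v.
Proof. by rewrite /= linfun_lin// => c u w; rewrite dfun_linear. Qed.

Lemma trivb_is_connection : is_connection (trivb M).
Proof.
apply: (connection_of_frame_formula cl trivb_vector_bundle
  (w := fun x a y => 0)).
- move=> x u u' uu'; apply/lfunP => v; rewrite !trivb_connE.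
  exact: (dfun_near_eq cl).
- by move=> x a; exact: smooth_sec_near0.
- move=> x u Hu; apply: nearW => y v.
  rewrite trivb_connE big_ord1 zero_lfunE scaler0 addr0 (tnth_nth 0) /=.
  rewrite [RHS]mulr1; congr (dfun _ y v).
  by apply/funext => z; rewrite trivb_coord.
Qed.

Section Conjugate.
Variable V : bundle M.
Hypotheses (vV : vector_bundle V) (cV : is_connection V).

Lemma conjv_expansion (W : vectType C) r (b : r.-tuple W) (w : W) :
  basis_of {:W} b ->
  (w : conjv W) = \sum_(a < r) (coord b a w)^* *: (tnth b a : conjv W).
Proof.
move=> bb; rewrite {1}(basis_coordE w bb).
apply: eq_bigr => a _.
by rewrite -{1}[coord b a w]conjcK.
Qed.

Lemma conjv_basis (W : vectType C) r (b : r.-tuple W) :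
  basis_of {:W} b -> basis_of {: conjv W} (b : r.-tuple (conjv W)).
Proof.
move=> bb; rewrite basisEdim; apply/andP; split; last first.
  by rewrite size_tuple -(size_basis bb) !dimvf.
apply/subvP => w _.
have E := @conjv_expansion W r b w bb.
have H : (\sum_(a < r) (coord b a w)^* *: (tnth b a : conjv W)) \in
    <<(b : r.-tuple (conjv W))>>%VS.
  apply: memv_suml => a _.
  apply: memvZ.
  apply: memv_span.
  exact: (mem_tnth a (b : r.-tuple (conjv W))).
exact: (eq_ind_r (fun z : conjv W => z \in <<(b : r.-tuple (conjv W))>>%VS) H E).
Qed.

Lemma conjv_coord (W : vectType C) r (b : r.-tuple W) (w : W) a :
  basis_of {:W} b ->
  coord (b : r.-tuple (conjv W)) a (w : conjv W) = (coord b a w)^*.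
Proof.
move=> bb; pose B : r.-tuple (conjv W) := b.
have E : (w : conjv W) = \sum_(a < r) (coord b a w)^* *: B`_a.
  rewrite {1}(@conjv_expansion W r b w bb); apply: eq_bigr => j _.
  by rewrite -(tnth_nth 0 B).
have H := coord_sum_free (fun a => (coord b a w)^*) a (basis_free (conjv_basis bb)).
by rewrite {1}E; exact: H.
Qed.

(** The coefficients of a section in the conjugate bundle are the conjugates of
    its coefficients. *)
Lemma conjb_smoothE x (u : section V) :
  smooth_sec_near (V := conjb V) x u <-> smooth_sec_near x u.
Proof.
split=> H a.
  apply: (smooth_near_eq cl) (smooth_near_conj (H a)).
  apply: filterS (frame_basis vV x) => y by_.
  by rewrite [coord _ _ _](conjv_coord _ _ by_) conjcK.
apply: (smooth_near_eq cl) (smooth_near_conj (H a)).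
apply: filterS (frame_basis vV x) => y by_.
by rewrite [RHS](conjv_coord _ _ by_).
Qed.

Lemma conjb_vector_bundle : vector_bundle (conjb V).
Proof.
split=> x.
  by apply: filterS (frame_basis vV x) => y; exact: conjv_basis.
apply: filterS (frame_smooth vV x) => y H a.
by apply/conjb_smoothE; exact: H.
Qed.

Lemma conjb_connE (u : section V) x v :
  (@conn _ _ (conjb V) u x v : fib V x) = conn u x (map_mx conjc v).
Proof.
rewrite /= linfun_lin// => c w w'.
by rewrite map_mxD map_mxZ linearP.
Qed.

(** Conjugation fixes the coordinate fields, which are real, and conjugates the
    coefficients. *)
Lemma smooth_conj_field x (X : section (tanb M)) : smooth_sec_near x X ->
  smooth_sec_near (V := tanb M) x (fun y => map_mx conjc (X y)).
Proof.
move=> HX.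
have H : smooth_sec_near (V := tanb M) x (fun y =>
    \sum_a (coord (frame (tanb M) x y) a (X y))^* *: tnth (frame (tanb M) x y) a).
  apply: smooth_sec_near_sum => a; apply: smooth_sec_nearZ.
    exact: smooth_near_conj (HX a).
  exact: (smooth_frame vT).
apply: (smooth_sec_near_eq cl) H; apply: filterS (frame_basis vT x) => y by_.
rewrite [in RHS](basis_coordE (X y) by_) map_mx_sum; apply: eq_bigr => a _.
rewrite map_mxZ; congr (_ *: _); apply/rowP => k.
by rewrite !tanb_frameE !mxE /= oppr0.
Qed.

Lemma conjb_is_connection : is_connection (conjb V).
Proof.
have vC := conjb_vector_bundle.
split.
- move=> x u w uw; apply/lfunP => v; rewrite [LHS]conjb_connE [RHS]conjb_connE.
  by rewrite (conn_local cV uw).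
- move=> x u w /conjb_smoothE Hu /conjb_smoothE Hw; apply/lfunP => v.
  rewrite [LHS]conjb_connE (conn_add cV Hu Hw) !add_lfunE.
  by rewrite -!conjb_connE.
- move=> x f u v Hf /conjb_smoothE Hu.
  have := conn_leibniz cV (map_mx conjc v) (smooth_near_conj Hf) Hu.
  have vK : map_mx conjc (map_mx conjc v) = v.
    by rewrite -map_mx_comp map_mx_id //; exact: conjcK.
  rewrite (dfun_conj _ Hf) vK.
  by move=> E; rewrite [LHS]conjb_connE [LHS]E -conjb_connE.
- move=> x u /conjb_smoothE Hu; apply: (homb_smoothP cl vT vC) => X HX.
  have H := homb_smooth_apply cl vT vV (conn_smooth cV Hu) (smooth_conj_field HX).
  apply/conjb_smoothE.
  apply: (smooth_sec_near_eq cl) H; apply: nearW => y.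
  by rewrite -conjb_connE.
Qed.

End Conjugate.

Section Perturbation.
Variable E : bundle M.
Hypotheses (vE : vector_bundle E) (cE : is_connection E).
Variable A : section (homb (tanb M) (homb E E)).
Hypothesis sA : smooth_sec A.

Lemma perturb_vector_bundle : vector_bundle (perturb A).
Proof. by case: vE => fb fs; split. Qed.

Lemma perturb_connE (u : section E) x v :
  @conn _ _ (perturb A) u x v = conn u x v + (A x v : 'Hom(fib E x, fib E x)) (u x).
Proof.
rewrite /= add_lfunE linfun_lin// => c w w'.
by rewrite linearP add_lfunE scale_lfunE.
Qed.

Lemma perturb_is_connection : is_connection (perturb A).
Proof.
split.
- move=> x u w uw; apply/lfunP => v; rewrite !perturb_connE.
  by rewrite (conn_local cE uw) (nbhs_singleton uw).
- move=> x u w Hu Hw; apply/lfunP => v; rewrite add_lfunE !perturb_connE.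
  by rewrite (conn_add cE)// add_lfunE linearD addrACA.
- move=> x f u v Hf Hu; rewrite !perturb_connE (conn_leibniz cE)//.
  by rewrite linearZ /= scalerDr addrA.
- move=> x u Hu; apply: (homb_smoothP cl vT perturb_vector_bundle) => X HX.
  have H1 := homb_smooth_apply cl vT vE (conn_smooth cE Hu) HX.
  have H2 := homb_smooth_apply cl vE vE
    (homb_smooth_apply cl vT (homb_vector_bundle cl vE vE) (@sA x) HX) Hu.
  apply: (smooth_sec_near_eq (V := perturb A) cl) (smooth_sec_nearD H1 H2).
  by apply: nearW => y; rewrite perturb_connE.
Qed.

End Perturbation.
End SimpleBundles.

(** * Functions on a product manifold *)

Section ProductCharts.
Variables (R : realType) (M N : mfd R).
Local Notation C := R[i].
Local Notation P := (prodm M N).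
Implicit Types (x y z : P).

Lemma near_fst x (Q : set M) : (\forall a \near x.1, Q a) ->
  \forall y \near x, Q y.1.
Proof. by move=> H; apply: (cvg_fst (F := nbhs x.1) (G := nbhs x.2)). Qed.

Lemma near_snd x (Q : set N) : (\forall a \near x.2, Q a) ->
  \forall y \near x, Q y.2.
Proof. by move=> H; apply: (cvg_snd (F := nbhs x.1) (G := nbhs x.2)). Qed.

(** Restriction to the slices through [x]; the connections of pulled back
    bundles are defined slice by slice. *)
Lemma near_slice1 x (Q : set P) : (\forall y \near x, Q y) ->
  \forall a \near x.1, Q (a, x.2).
Proof.
move=> [[A B] /= [nA nB] AB]; apply: filterS nA => a Aa.
by apply: AB; split => //=; exact: nbhs_singleton nB.
Qed.

Lemma near_slice2 x (Q : set P) : (\forall y \near x, Q y) ->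
  \forall a \near x.2, Q (x.1, a).
Proof.
move=> [[A B] /= [nA nB] AB]; apply: filterS nB => a Ba.
by apply: AB; split => //=; exact: nbhs_singleton nA.
Qed.

Hypotheses (clM : chart_laws M) (clN : chart_laws N).

Lemma near_lsub m n (p : 'rV[R]_m) (q : 'rV[R]_n) (Q : set 'rV[R]_m) :
  nbhs p Q -> \forall r \near row_mx p q, Q (lsubmx r).
Proof.
move=> H; have := @continuous_lsubmx R 1 m n (row_mx p q).
by rewrite /continuous_at row_mxKl; apply.
Qed.

Lemma near_rsub m n (p : 'rV[R]_m) (q : 'rV[R]_n) (Q : set 'rV[R]_n) :
  nbhs q Q -> \forall r \near row_mx p q, Q (rsubmx r).
Proof.
move=> H; have := @continuous_rsubmx R 1 m n (row_mx p q).
by rewrite /continuous_at row_mxKr; apply.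
Qed.

Lemma csmooth_lsub m n (p : 'rV[R]_(m + n)) (f : 'rV[R]_m -> R) :
  csmooth_at (lsubmx p) f -> csmooth_at p (fun r => f (lsubmx r)).
Proof.
apply: csmooth_comp => j.
by apply: (csmooth_ext _ (csmooth_coord p (lshift n j))) => q; rewrite mxE.
Qed.

Lemma csmooth_rsub m n (p : 'rV[R]_(m + n)) (f : 'rV[R]_n -> R) :
  csmooth_at (rsubmx p) f -> csmooth_at p (fun r => f (rsubmx r)).
Proof.
apply: csmooth_comp => j.
by apply: (csmooth_ext _ (csmooth_coord p (rshift m j))) => q; rewrite mxE.
Qed.

Lemma prodm_chart_laws : chart_laws P.
Proof.
split.
- move=> x y [xy1 xy2].
  by apply: filterS2 (near_fst (cl_open clM xy1)) (near_snd (cl_open clN xy2)).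
- by move=> x; split; exact: cl_mem.
- move=> x [y1 y2] [/= xy1 xy2].
  by rewrite row_mxKl row_mxKr (cl_K clM xy1) (cl_K clN xy2).
- move=> x y [xy1 xy2]; apply: continuous_row => j.
  case: (split_ordP j) => k ->.
    have -> : (fun q : P => chart x q 0 (lshift (mdim N) k)) =
        (fun q : P => chart x.1 q.1 0 k).
      by apply/funext => q; rewrite /= row_mxEl.
    move=> A nA; apply: (near_fst (x := y) (Q := fun a => A (chart x.1 a 0 k))).
    exact: (cl_chart clM xy1 (@coord_continuous R 1 (mdim M) 0 k (chart x.1 y.1) A nA)).
  have -> : (fun q : P => chart x q 0 (rshift (mdim M) k)) =
      (fun q : P => chart x.2 q.2 0 k).
    by apply/funext => q; rewrite /= row_mxEr.
  move=> A nA; apply: (near_snd (x := y) (Q := fun a => A (chart x.2 a 0 k))).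
  exact: (cl_chart clN xy2 (@coord_continuous R 1 (mdim N) 0 k (chart x.2 y.2) A nA)).
- move=> x y [xy1 xy2].
  have H1 := cl_cinv clM xy1; have H2 := cl_cinv clN xy2.
  move=> A; rewrite /= row_mxKl row_mxKr => -[[B D] /= [nB nD] BD].
  have nB' := near_lsub (chart x.2 y.2) (H1 _ nB).
  have nD' := near_rsub (chart x.1 y.1) (H2 _ nD).
  by apply: filterS2 nB' nD' => r Br Dr; apply: BD.
- move=> x y [xy1 xy2].
  have H1 := near_lsub (chart x.2 y.2) (cl_inv clM xy1).
  have H2 := near_rsub (chart x.1 y.1) (cl_inv clN xy2).
  by apply: filterS2 H1 H2 => r /= -> ->; rewrite hsubmxK.
- move=> x y z k [xz1 xz2] [yz1 yz2].
  case: (split_ordP k) => j ->.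
    apply: (@csmooth_ext _ _
      (fun p => chart y.1 (cinv x.1 (lsubmx p)) 0 j)).
      by move=> q; rewrite /= row_mxEl.
    apply: (csmooth_lsub (f := fun p => chart y.1 (cinv x.1 p) 0 j)).
    by rewrite row_mxKl; exact: cl_smooth.
  apply: (@csmooth_ext _ _ (fun p => chart y.2 (cinv x.2 (rsubmx p)) 0 j)).
    by move=> q; rewrite /= row_mxEr.
  apply: (csmooth_rsub (f := fun p => chart y.2 (cinv x.2 p) 0 j)).
  by rewrite row_mxKr; exact: cl_smooth.
Qed.

Lemma smooth_near_fst x (f : M -> C) : smooth_near x.1 f ->
  smooth_near x (fun y : P => f y.1).
Proof.
move=> [H1 H2]; split.
  apply: (csmooth_lsub (f := fun p => complex.Re (f (cinv x.1 p)))).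
  by rewrite row_mxKl.
apply: (csmooth_lsub (f := fun p => complex.Im (f (cinv x.1 p)))).
by rewrite row_mxKl.
Qed.

Lemma smooth_near_snd x (f : N -> C) : smooth_near x.2 f ->
  smooth_near x (fun y : P => f y.2).
Proof.
move=> [H1 H2]; split.
  apply: (csmooth_rsub (f := fun p => complex.Re (f (cinv x.2 p)))).
  by rewrite row_mxKr.
apply: (csmooth_rsub (f := fun p => complex.Im (f (cinv x.2 p)))).
by rewrite row_mxKr.
Qed.

Lemma csmooth_row_mxl m n (p : 'rV[R]_m) (q : 'rV[R]_n) j :
  csmooth_at p (fun r => row_mx r q 0 j).
Proof.
case: (split_ordP j) => k ->.
  by apply: (csmooth_ext _ (csmooth_coord p k)) => r; rewrite row_mxEl.
by apply: (csmooth_ext _ (csmooth_cst p (q 0 k))) => r; rewrite row_mxEr.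
Qed.

Lemma csmooth_row_mxr m n (p : 'rV[R]_m) (q : 'rV[R]_n) j :
  csmooth_at q (fun r => row_mx p r 0 j).
Proof.
case: (split_ordP j) => k ->.
  by apply: (csmooth_ext _ (csmooth_cst q (p 0 k))) => r; rewrite row_mxEl.
by apply: (csmooth_ext _ (csmooth_coord q k)) => r; rewrite row_mxEr.
Qed.

Lemma slice1E x (f : P -> C) p :
  f (cinv x (row_mx p (chart x.2 x.2))) = f (cinv x.1 p, x.2).
Proof. by rewrite /= row_mxKl row_mxKr (cl_K clN (cl_mem clN x.2)). Qed.

Lemma slice2E x (f : P -> C) p :
  f (cinv x (row_mx (chart x.1 x.1) p)) = f (x.1, cinv x.2 p).
Proof. by rewrite /= row_mxKl row_mxKr (cl_K clM (cl_mem clM x.1)). Qed.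

Lemma smooth_slice1 x (f : P -> C) : smooth_near x f ->
  smooth_near x.1 (fun a => f (a, x.2)).
Proof.
move=> H.
change (ccsmooth_at (chart x.1 x.1) (fun p => f (cinv x.1 p, x.2))).
apply: (ccsmooth_ext (slice1E x f)).
exact: (ccsmooth_comp (g := fun p => row_mx p (chart x.2 x.2))
  (f := fun p => f (cinv x p)) (fun j => csmooth_row_mxl _ _ j) H).
Qed.

Lemma smooth_slice2 x (f : P -> C) : smooth_near x f ->
  smooth_near x.2 (fun a => f (x.1, a)).
Proof.
move=> H.
change (ccsmooth_at (chart x.2 x.2) (fun p => f (x.1, cinv x.2 p))).
apply: (ccsmooth_ext (slice2E x f)).
exact: (ccsmooth_comp (g := fun p => row_mx (chart x.1 x.1) p)
  (f := fun p => f (cinv x p)) (fun j => csmooth_row_mxr _ _ j) H).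
Qed.

Lemma sum_kronecker (I : finType) (i : I) (F : I -> C) :
  \sum_j ((i == j)%:R)%:C * F j = F i.
Proof.
rewrite (bigD1 i) //= eqxx big1 ?addr0 ?mul1r // => j /negPf ij.
by rewrite eq_sym ij mul0r.
Qed.

Lemma derive_row_mxl m n (p : 'rV[R]_m) (q : 'rV[R]_n) k j :
  'D_(delta_mx 0 k) (fun r => row_mx r q 0 j) p = (lshift n k == j)%:R.
Proof.
case: (split_ordP j) => a ->.
  rewrite (_ : (fun r : 'rV_m => _) = fun r : 'rV_m => r 0 a).
    by rewrite derive_coord mxE eqxx /= eq_shift eq_sym.
  by apply/funext => r; rewrite row_mxEl.
rewrite (_ : (fun r : 'rV_m => _) = fun=> q 0 a) ?derive_cst ?eq_shift//.
by apply/funext => r; rewrite row_mxEr.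
Qed.

Lemma derive_row_mxr m n (p : 'rV[R]_m) (q : 'rV[R]_n) k j :
  'D_(delta_mx 0 k) (fun r => row_mx p r 0 j) q = (rshift m k == j)%:R.
Proof.
case: (split_ordP j) => a ->.
  rewrite (_ : (fun r : 'rV_n => _) = fun=> p 0 a) ?derive_cst ?eq_shift//.
  by apply/funext => r; rewrite row_mxEl.
rewrite (_ : (fun r : 'rV_n => _) = fun r : 'rV_n => r 0 a).
  by rewrite derive_coord mxE eqxx /= eq_shift eq_sym.
by apply/funext => r; rewrite row_mxEr.
Qed.

(** The slices of [f] are compositions of [f] with affine maps, whose partial
    derivatives are the coordinate directions of the factors. *)
Lemma dfun_prodm x (f : P -> C) v : smooth_near x f ->
  dfun f x v = dfun (fun a => f (a, x.2)) x.1 (lsubmx v) +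
               dfun (fun a => f (x.1, a)) x.2 (rsubmx v).
Proof.
move=> H; rewrite /dfun big_split_ord /=; congr (_ + _); apply: eq_bigr => k _.
  rewrite !mxE; congr (_ * _); rewrite !pderE.
  under [in RHS]eq_fun do rewrite -slice1E.
  rewrite (cderive_comp (g := fun p => row_mx p (chart x.2 x.2))
    (f := fun p => f (cinv x p)) _ (fun j => csmooth_row_mxl _ _ j) H).
  by under [in RHS]eq_bigr do rewrite derive_row_mxl; rewrite sum_kronecker.
rewrite !mxE; congr (_ * _); rewrite !pderE.
under [in RHS]eq_fun do rewrite -slice2E.
rewrite (cderive_comp (g := fun p => row_mx (chart x.1 x.1) p)
  (f := fun p => f (cinv x p)) _ (fun j => csmooth_row_mxr _ _ j) H).
by under [in RHS]eq_bigr do rewrite derive_row_mxr; rewrite sum_kronecker.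
Qed.

Lemma derive_lsub m n (f : 'rV[R]_m -> R) (p : 'rV[R]_(m + n)) v :
  csmooth_at (lsubmx p) f ->
  'D_v (fun r => f (lsubmx r)) p = 'D_(lsubmx v) f (lsubmx p).
Proof.
move=> H.
have lE j : (fun r : 'rV[R]_(m + n) => lsubmx r 0 j) = fun r => r 0 (lshift n j).
  by apply/funext => r; rewrite mxE.
rewrite (derive_comp (g := lsubmx)); last exact: csmooth_differentiable.
  rewrite (derive_partial _ (csmooth_differentiable H)); apply: eq_bigr => j _.
  by rewrite lE derive_coord mxE.
by move=> j; rewrite lE; exact: differentiable_coord.
Qed.

Lemma derive_rsub m n (f : 'rV[R]_n -> R) (p : 'rV[R]_(m + n)) v :
  csmooth_at (rsubmx p) f ->
  'D_v (fun r => f (rsubmx r)) p = 'D_(rsubmx v) f (rsubmx p).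
Proof.
move=> H.
have lE j : (fun r : 'rV[R]_(m + n) => rsubmx r 0 j) = fun r => r 0 (rshift m j).
  by apply/funext => r; rewrite mxE.
rewrite (derive_comp (g := rsubmx)); last exact: csmooth_differentiable.
  rewrite (derive_partial _ (csmooth_differentiable H)); apply: eq_bigr => j _.
  by rewrite lE derive_coord mxE.
by move=> j; rewrite lE; exact: differentiable_coord.
Qed.

Lemma lsub_delta m n (k : 'I_(m + n)) : lsubmx (delta_mx 0 k : 'rV[R]_(m + n)) =
  if fintype.split k is inl a then delta_mx 0 a else 0.
Proof.
apply/rowP => j; rewrite !mxE eqxx /=.
by case: splitP => a ka; rewrite !mxE ?eqxx /= -(inj_eq val_inj) /= ka // ltn_eqF//
  (leq_trans (ltn_ord j))// leq_addr.
Qed.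

Lemma rsub_delta m n (k : 'I_(m + n)) : rsubmx (delta_mx 0 k : 'rV[R]_(m + n)) =
  if fintype.split k is inr a then delta_mx 0 a else 0.
Proof.
apply/rowP => j; rewrite !mxE eqxx /=.
by case: splitP => a ka; rewrite !mxE ?eqxx /= -(inj_eq val_inj) /= ka ?eqn_add2l//
  gtn_eqF// (leq_trans (ltn_ord a))// leq_addr.
Qed.

(** Each component of a product chart depends on one factor only. *)
Lemma cvec_prodm x y (k : 'I_(mdim M + mdim N)) : cdom x y ->
  cvec x y k = match fintype.split k with
    | inl a => row_mx (cvec x.1 y.1 a) 0
    | inr b => row_mx 0 (cvec x.2 y.2 b) end.
Proof.
move=> [xy1 xy2]; apply/rowP => j; rewrite !mxE.
have S1 a : csmooth_at (lsubmx (chart x y)) (fun p => chart y.1 (cinv x.1 p) 0 a).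
  by rewrite row_mxKl; apply: cl_smooth => //; exact: cl_mem.
have S2 b : csmooth_at (rsubmx (chart x y)) (fun p => chart y.2 (cinv x.2 p) 0 b).
  by rewrite row_mxKr; apply: cl_smooth => //; exact: cl_mem.
case: (split_ordP j) => a ->.
  rewrite (_ : (fun p => _) = (fun p => chart y.1 (cinv x.1 (lsubmx p)) 0 a)); last first.
    by apply/funext => p; rewrite /= row_mxEl.
  rewrite (derive_lsub _ (S1 a)) lsub_delta row_mxKl.
  by case: (fintype.split k) => b; rewrite row_mxEl !mxE // derive0.
rewrite (_ : (fun p => _) = (fun p => chart y.2 (cinv x.2 (rsubmx p)) 0 a)); last first.
  by apply/funext => p; rewrite /= row_mxEr.
rewrite (derive_rsub _ (S2 a)) rsub_delta row_mxKr.
by case: (fintype.split k) => b; rewrite row_mxEr !mxE // derive0.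
Qed.

End ProductCharts.

(** * Pulled back bundles and the tangent bundle of a product *)

Lemma split_lshift m n (a : 'I_m) : fintype.split (lshift n a) = inl a.
Proof. exact: (unsplitK (inl a)). Qed.

Lemma split_rshift m n (b : 'I_n) : fintype.split (rshift m b) = inr b.
Proof. exact: (unsplitK (inr b)). Qed.

Section VectorValued.
Variables (R : realType) (N : mfd R).
Local Notation C := R[i].
Hypothesis cl : chart_laws N.

(** The change of basis has constant coefficients, which commute with
    differentiation. *)
Lemma dvec_basis (W : vectType C) r (b : r.-tuple W) (f : N -> W) x v :
  basis_of {:W} b -> (forall a, smooth_near x (fun y => coord b a (f y))) ->
  dvec f x v = \sum_a dfun (fun y => coord b a (f y)) x v *: tnth b a.
Proof.
move=> bb Hf; rewrite /dvec.
have E a y : coord (vbasis {:W}) a (f y) =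
    \sum_c coord (vbasis {:W}) a (tnth b c) * coord b c (f y).
  rewrite {1}(basis_coordE (f y) bb) linear_sum; apply: eq_bigr => c _.
  by rewrite linearZ /= mulrC.
under eq_bigr => a _.
  under [X in dfun X]eq_fun do rewrite E.
  rewrite dfun_sum//; last first.
    by move=> c; apply: smooth_nearM => //; exact: smooth_near_cst.
  rewrite scaler_suml; over.
rewrite exchange_big /=; apply: eq_bigr => c _.
rewrite [in RHS](basis_coordE (tnth b c) (vbasisP {:W})) scaler_sumr.
apply: eq_bigr => a _; rewrite -tnth_nth scalerA; congr (_ *: _).
rewrite (dfunM cl _ (smooth_near_cst x _) (Hf c)) dfun_cst mul0r add0r.
by rewrite mulrC.
Qed.

Lemma dvec_linear (W : vectType C) (f : N -> W) x : linear (dvec f x).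
Proof.
move=> c u v; rewrite /dvec scaler_sumr -big_split /=; apply: eq_bigr => a _.
by rewrite dfun_linear scalerDl scalerA.
Qed.

Lemma dvec_near_eq (W : vectType C) (f g : N -> W) x v :
  (\forall y \near x, f y = g y) -> dvec f x v = dvec g x v.
Proof.
move=> fg; apply: eq_bigr => a _; congr (_ *: _); apply: (dfun_near_eq cl).
by apply: filterS fg => y ->.
Qed.

End VectorValued.

Section ProductBundles.
Variables (R : realType) (M N : rmfd R).
Local Notation C := R[i].
Local Notation P := (rprod M N).
Hypotheses (clM : chart_laws M) (clN : chart_laws N).
Let clP : chart_laws P := prodm_chart_laws clM clN.
Let vTM := tanb_vector_bundle clM.
Let vTN := tanb_vector_bundle clN.
Let vTP : vector_bundle (tanb P) := tanb_vector_bundle clP.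

Lemma pull1_smooth_at (V : bundle M) (x : P) (u : section V) :
  smooth_sec_near x.1 u ->
  smooth_sec_near (V := (pull1 N V : bundle P)) x (fun y : P => u y.1).
Proof. by move=> Hu a; exact: (smooth_near_fst (x := x) (Hu a)). Qed.

Lemma pull1_vector_bundle (V : bundle M) : vector_bundle V ->
  vector_bundle (pull1 N V : bundle P).
Proof.
move=> vV; split=> x; first exact: near_fst (frame_basis vV x.1).
apply: (filterS _ (near_fst (frame_smooth vV x.1))) => y Hy a.
exact: (pull1_smooth_at (x := y) (Hy a)).
Qed.

(** The coefficients of the component are among those of the field. *)
Lemma lsub_smooth (x : P) (X : section (tanb P)) : smooth_sec_near x X ->
  smooth_sec_near (V := (pull1 N (tanb M) : bundle P)) x
    (fun y : P => lsubmx (X y : 'rV[C]_(mdim M + mdim N))).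
Proof.
move=> HX.
have H : smooth_sec_near (V := (pull1 N (tanb M) : bundle P)) x (fun y : P =>
    \sum_(a < mdim M) coord (frame (tanb P) x y) (lshift (mdim N) a) (X y) *:
      tnth (frame (tanb M) x.1 y.1) a).
  apply: smooth_sec_near_sum => a; apply: smooth_sec_nearZ; first exact: HX.
  exact: (pull1_smooth_at (smooth_frame vTM a)).
apply: (smooth_sec_near_eq clP) H.
apply: filterS2 (frame_basis vTP x) (cl_open clP (cl_mem clP x)) => y by_ xy.
have E : lsubmx (X y : 'rV[C]_(mdim M + mdim N)) =
    \sum_(k < mdim M + mdim N) coord (frame (tanb P) x y) k (X y) *:
      lsubmx (cvec (M := P) x y k : 'rV[C]_(mdim M + mdim N)).
  rewrite {1}(basis_coordE (X y) by_) linear_sum; apply: eq_bigr => k _.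
  by rewrite linearZ tanb_frameE.
rewrite E big_split_ord /= [X in _ = _ + X]big1 ?addr0.
  apply: eq_bigr => a _; rewrite (cvec_prodm clM clN _ xy) split_lshift row_mxKl.
  by rewrite tanb_frameE.
move=> b _; rewrite (cvec_prodm clM clN _ xy) split_rshift row_mxKl.
exact: scaler0.
Qed.

Section PullFirst.
Variable V : bundle M.
Hypotheses (vV : vector_bundle V) (cV : is_connection V).
Local Notation pV := (pull1 N V : bundle P).

Lemma pull1_connE (u : section pV) (x : P) v :
  conn u x v = conn (fun y : M => u (y, x.2)) x.1 (lsubmx v) +
    dvec (W := fib V x.1) (fun z : N => u (x.1, z)) x.2 (rsubmx v).
Proof.
rewrite /= linfun_lin// => c w w'.
by rewrite !linearP /= dvec_linear scalerDr addrACA.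
Qed.

(** In the pulled back frame, the covariant derivative along the first factor and
    the plain derivative along the second add up to the full differential of
    the coefficients plus the pulled back connection forms, which are smooth. *)
Lemma pull1_is_connection : is_connection pV.
Proof.
have vP := pull1_vector_bundle vV.
pose w (x : P) (a : 'I_(rank pV x)) : section (homb (tanb P) pV) := fun y : P =>
  linfun (fun v : 'rV[C]_(mdim M + mdim N) =>
    conn (fun z => tnth (frame V x.1 z) a) y.1 (lsubmx v)).
have wE x a (y : P) v : (w x a y : 'Hom('rV[C]_(mdim M + mdim N), fib V y.1)) v =
    conn (fun z => tnth (frame V x.1 z) a) y.1 (lsubmx v).
  by rewrite linfun_lin// => c v1 v2; rewrite !linearP.
apply: (connection_of_frame_formula clP vP (w := w)).
- move=> x u u' uu'; apply/lfunP => v; rewrite !pull1_connE.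
  rewrite (conn_local cV (near_slice1 uu')); congr (_ + _).
  have E2 : \forall a \near x.2, (u (x.1, a) : fib V x.1) = u' (x.1, a).
    exact: (near_slice2 uu').
  exact: (dvec_near_eq clN (W := fib V x.1) _ E2).
- move=> x a; apply: (homb_smoothP clP vTP vP) => X HX.
  have HL := lsub_smooth HX.
  have He := conn_smooth cV (smooth_frame vV a (x := x.1)).
  have Hp : smooth_sec_near (V := homb (pull1 N (tanb M) : bundle P) pV) x
      (fun y : P => conn (fun z => tnth (frame V x.1 z) a) y.1) by exact: pull1_smooth_at He.
  have H := homb_smooth_apply clP (pull1_vector_bundle vTM) vP Hp HL.
  by apply: (smooth_sec_near_eq (V := pV) clP) H; apply: (@nearW _ (nbhs x)) => y; rewrite wE.
- move=> x u Hu.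
  have N1 := near_fst (nbhs_interior (frame_basis vV x.1)).
  have N2 := near_fst (frame_smooth vV x.1).
  have N3 : \forall y \near x, forall a,
      smooth_near y (fun z => coord (frame pV x z) a (u z)).
    by apply: (@filter_forall _ _ _ (nbhs x)) => a; exact: (smooth_near_near clP (Hu a)).
  apply: filterS3 N1 N2 N3 => y bV sV su v.
  rewrite pull1_connE.
  have E1 : \forall z \near y.1, u (z, y.2) =
      \sum_a coord (frame V x.1 z) a (u (z, y.2)) *: tnth (frame V x.1 z) a.
    by apply: filterS bV => z bz; rewrite -basis_coordE.
  rewrite (conn_combination cV (f := fun a z => coord (frame V x.1 z) a (u (z, y.2)))
    _ (fun a => smooth_slice1 clN (su a)) sV E1).
  rewrite (dvec_basis clN _ (nbhs_singleton bV) (fun a => smooth_slice2 clM (su a))).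
  rewrite -big_split /=; apply: eq_bigr => a _.
  rewrite (dfun_prodm clM clN _ (su a)) scalerDl /= wE addrAC.
  by case: y {bV sV su E1}.
Qed.

End PullFirst.
Lemma pull2_smooth_at (V : bundle N) (x : P) (u : section V) :
  smooth_sec_near x.2 u ->
  smooth_sec_near (V := (pull2 M V : bundle P)) x (fun y : P => u y.2).
Proof. by move=> Hu a; exact: (smooth_near_snd (x := x) (Hu a)). Qed.

Lemma pull2_vector_bundle (V : bundle N) : vector_bundle V ->
  vector_bundle (pull2 M V : bundle P).
Proof.
move=> vV; split=> x; first exact: near_snd (frame_basis vV x.2).
apply: (filterS _ (near_snd (frame_smooth vV x.2))) => y Hy a.
exact: (pull2_smooth_at (x := y) (Hy a)).
Qed.

Lemma rsub_smooth (x : P) (X : section (tanb P)) : smooth_sec_near x X ->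
  smooth_sec_near (V := (pull2 M (tanb N) : bundle P)) x
    (fun y : P => rsubmx (X y : 'rV[C]_(mdim M + mdim N))).
Proof.
move=> HX.
have H : smooth_sec_near (V := (pull2 M (tanb N) : bundle P)) x (fun y : P =>
    \sum_(a < mdim N) coord (frame (tanb P) x y) (rshift (mdim M) a) (X y) *:
      tnth (frame (tanb N) x.2 y.2) a).
  apply: smooth_sec_near_sum => a; apply: smooth_sec_nearZ; first exact: HX.
  exact: (pull2_smooth_at (smooth_frame vTN a)).
apply: (smooth_sec_near_eq clP) H.
apply: filterS2 (frame_basis vTP x) (cl_open clP (cl_mem clP x)) => y by_ xy.
have E : rsubmx (X y : 'rV[C]_(mdim M + mdim N)) =
    \sum_(k < mdim M + mdim N) coord (frame (tanb P) x y) k (X y) *: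
      rsubmx (cvec (M := P) x y k : 'rV[C]_(mdim M + mdim N)).
  rewrite {1}(basis_coordE (X y) by_) linear_sum; apply: eq_bigr => k _.
  by rewrite linearZ tanb_frameE.
rewrite E big_split_ord /= [X in _ = X + _]big1 ?add0r.
  apply: eq_bigr => a _; rewrite (cvec_prodm clM clN _ xy) split_rshift row_mxKr.
  by rewrite tanb_frameE.
move=> b _; rewrite (cvec_prodm clM clN _ xy) split_lshift row_mxKr.
exact: scaler0.
Qed.

Section PullSecond.
Variable V : bundle N.
Hypotheses (vV : vector_bundle V) (cV : is_connection V).
Local Notation pV := (pull2 M V : bundle P).

Lemma pull2_connE (u : section pV) (x : P) v :
  conn u x v = dvec (W := fib V x.2) (fun y : M => u (y, x.2)) x.1 (lsubmx v) +
    conn (fun z : N => u (x.1, z)) x.2 (rsubmx v).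
Proof.
rewrite /= linfun_lin// => c w w'.
by rewrite !linearP /= dvec_linear scalerDr addrACA.
Qed.

Lemma pull2_is_connection : is_connection pV.
Proof.
have vP := pull2_vector_bundle vV.
pose w (x : P) (a : 'I_(rank pV x)) : section (homb (tanb P) pV) := fun y : P =>
  linfun (fun v : 'rV[C]_(mdim M + mdim N) =>
    conn (fun z => tnth (frame V x.2 z) a) y.2 (rsubmx v)).
have wE x a (y : P) v : (w x a y : 'Hom('rV[C]_(mdim M + mdim N), fib V y.2)) v =
    conn (fun z => tnth (frame V x.2 z) a) y.2 (rsubmx v).
  by rewrite linfun_lin// => c v1 v2; rewrite !linearP.
apply: (connection_of_frame_formula clP vP (w := w)).
- move=> x u u' uu'; apply/lfunP => v; rewrite !pull2_connE.
  rewrite (conn_local cV (near_slice2 uu')); congr (_ + _).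
  have E2 : \forall a \near x.1, (u (a, x.2) : fib V x.2) = u' (a, x.2).
    exact: (near_slice1 uu').
  exact: (dvec_near_eq clM (W := fib V x.2) _ E2).
- move=> x a; apply: (homb_smoothP clP vTP vP) => X HX.
  have HL := rsub_smooth HX.
  have He := conn_smooth cV (smooth_frame vV a (x := x.2)).
  have Hp : smooth_sec_near (V := homb (pull2 M (tanb N) : bundle P) pV) x
      (fun y : P => conn (fun z => tnth (frame V x.2 z) a) y.2) by exact: pull2_smooth_at He.
  have H := homb_smooth_apply clP (pull2_vector_bundle vTN) vP Hp HL.
  by apply: (smooth_sec_near_eq (V := pV) clP) H; apply: (@nearW _ (nbhs x)) => y; rewrite wE.
- move=> x u Hu.
  have N1 := near_snd (nbhs_interior (frame_basis vV x.2)).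
  have N2 := near_snd (frame_smooth vV x.2).
  have N3 : \forall y \near x, forall a,
      smooth_near y (fun z => coord (frame pV x z) a (u z)).
    by apply: (@filter_forall _ _ _ (nbhs x)) => a; exact: (smooth_near_near clP (Hu a)).
  apply: filterS3 N1 N2 N3 => y bV sV su v.
  rewrite pull2_connE.
  have E1 : \forall z \near y.2, u (y.1, z) =
      \sum_a coord (frame V x.2 z) a (u (y.1, z)) *: tnth (frame V x.2 z) a.
    by apply: filterS bV => z bz; rewrite -basis_coordE.
  rewrite (conn_combination cV (f := fun a z => coord (frame V x.2 z) a (u (y.1, z)))
    _ (fun a => smooth_slice2 clM (su a)) sV E1).
  rewrite (dvec_basis clM _ (nbhs_singleton bV) (fun a => smooth_slice1 clN (su a))).
  rewrite [LHS]addrC -big_split /=; apply: eq_bigr => a _.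
  rewrite (dfun_prodm clM clN _ (su a)) scalerDl /= wE [LHS]addrC addrA.
  by case: y {bV sV su E1}.
Qed.

End PullSecond.
Lemma row_mx_suml m n (I : Type) (s : seq I) (F : I -> 'rV[C]_m) :
  row_mx (\sum_(i <- s) F i) (0 : 'rV[C]_n) = \sum_(i <- s) row_mx (F i) 0.
Proof.
elim: s => [|i s IH]; first by rewrite !big_nil row_mx0.
by rewrite !big_cons -IH add_row_mx addr0.
Qed.

Lemma row_mx_sumr m n (I : Type) (s : seq I) (F : I -> 'rV[C]_n) :
  row_mx (0 : 'rV[C]_m) (\sum_(i <- s) F i) = \sum_(i <- s) row_mx 0 (F i).
Proof.
elim: s => [|i s IH]; first by rewrite !big_nil row_mx0.
by rewrite !big_cons -IH add_row_mx addr0.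
Qed.

Section ProductTangent.
Hypotheses (cTM : is_connection (tanb M)) (cTN : is_connection (tanb N)).
Local Notation d := (mdim M + mdim N)%N.

Lemma row_mx_smooth (x : P) (X : section (tanb P)) :
  smooth_sec_near (V := (pull1 N (tanb M) : bundle P)) x
    (fun y : P => lsubmx (X y : 'rV[C]_d)) ->
  smooth_sec_near (V := (pull2 M (tanb N) : bundle P)) x
    (fun y : P => rsubmx (X y : 'rV[C]_d)) ->
  smooth_sec_near x X.
Proof.
move=> Hl Hr.
have H : smooth_sec_near (V := tanb P) x (fun y : P =>
    \sum_(a < mdim M) coord (frame (tanb M) x.1 y.1) a (lsubmx (X y : 'rV[C]_d)) *:
      tnth (frame (tanb P) x y) (lshift (mdim N) a) +
    \sum_(b < mdim N) coord (frame (tanb N) x.2 y.2) b (rsubmx (X y : 'rV[C]_d)) *: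
      tnth (frame (tanb P) x y) (rshift (mdim M) b)).
  apply: smooth_sec_nearD; apply: smooth_sec_near_sum => a.
    by apply: smooth_sec_nearZ; [exact: Hl|exact: (smooth_frame vTP)].
  by apply: smooth_sec_nearZ; [exact: Hr|exact: (smooth_frame vTP)].
apply: (smooth_sec_near_eq clP) H.
have N1 := near_fst (frame_basis vTM x.1).
have N2 := near_snd (frame_basis vTN x.2).
apply: filterS3 N1 N2 (cl_open clP (cl_mem clP x)) => y b1 b2 xy.
rewrite -[RHS](hsubmxK (X y : 'rV[C]_d)).
rewrite [in RHS](basis_coordE (lsubmx (X y : 'rV[C]_d) : fib (tanb M) y.1) b1).
rewrite [in RHS](basis_coordE (rsubmx (X y : 'rV[C]_d) : fib (tanb N) y.2) b2).
have -> : row_mx (\sum_(a < mdim M) coord (frame (tanb M) x.1 y.1) a (lsubmx (X y : 'rV[C]_d)) *: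
      tnth (frame (tanb M) x.1 y.1) a)
    (\sum_(b < mdim N) coord (frame (tanb N) x.2 y.2) b (rsubmx (X y : 'rV[C]_d)) *:
      tnth (frame (tanb N) x.2 y.2) b) =
  row_mx (\sum_(a < mdim M) coord (frame (tanb M) x.1 y.1) a (lsubmx (X y : 'rV[C]_d)) *:
      tnth (frame (tanb M) x.1 y.1) a) 0 +
  row_mx 0 (\sum_(b < mdim N) coord (frame (tanb N) x.2 y.2) b (rsubmx (X y : 'rV[C]_d)) *:
      tnth (frame (tanb N) x.2 y.2) b).
  by rewrite add_row_mx addr0 add0r.
congr (_ + _).
  rewrite row_mx_suml; apply: eq_bigr => a _.
  rewrite tanb_frameE (cvec_prodm clM clN _ xy) split_lshift.
  by rewrite [LHS]scale_row_mx scaler0 tanb_frameE.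
rewrite row_mx_sumr; apply: eq_bigr => a _.
rewrite tanb_frameE (cvec_prodm clM clN _ xy) split_rshift.
by rewrite [LHS]scale_row_mx scaler0 tanb_frameE.
Qed.

Definition lpart (Y : section (tanb P)) : section (pull1 N (tanb M) : bundle P) :=
  fun y => lsubmx (Y y : 'rV[C]_d).

Definition rpart (Y : section (tanb P)) : section (pull2 M (tanb N) : bundle P) :=
  fun y => rsubmx (Y y : 'rV[C]_d).

Let conn1 := @conn R P (pull1 N (tanb M)).
Let conn2 := @conn R P (pull2 M (tanb N)).

Lemma tanb_rprod_connE (Y : section (tanb P)) (x : P) v :
  conn Y x v = row_mx (conn1 (lpart Y) x v) (conn2 (rpart Y) x v).
Proof.
rewrite [LHS]linfun_lin// => c u w.
by rewrite !linearP -add_row_mx -scale_row_mx.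
Qed.

(** The tangent bundle of the product is the direct sum of the two pulled back
    tangent bundles, and its connection is the direct sum of theirs. *)
Lemma tanb_rprod_is_connection : is_connection (tanb P).
Proof.
have c1 := pull1_is_connection vTM cTM; have c2 := pull2_is_connection vTN cTN.
split.
- move=> x u w uw; apply/lfunP => v; rewrite !tanb_rprod_connE.
  have E1 : conn1 (lpart u) x = conn1 (lpart w) x.
    by apply: (conn_local c1); apply: filterS uw => y; rewrite /lpart => ->.
  have E2 : conn2 (rpart u) x = conn2 (rpart w) x.
    by apply: (conn_local c2); apply: filterS uw => y; rewrite /rpart => ->.
  by rewrite E1 E2.
- move=> x u w Hu Hw; apply/lfunP => v; rewrite add_lfunE !tanb_rprod_connE.
  rewrite [RHS]add_row_mx -!add_lfunE.
  have E1 : conn1 (lpart (fun y : P => u y + w y)) x =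
      conn1 (lpart u) x + conn1 (lpart w) x.
    rewrite -(conn_add c1 (lsub_smooth Hu) (lsub_smooth Hw)) /lpart.
    by congr (conn1 _ x); apply/funext => y; rewrite linearD.
  have E2 : conn2 (rpart (fun y : P => u y + w y)) x =
      conn2 (rpart u) x + conn2 (rpart w) x.
    rewrite -(conn_add c2 (rsub_smooth Hu) (rsub_smooth Hw)) /rpart.
    by congr (conn2 _ x); apply/funext => y; rewrite linearD.
  by rewrite E1 E2.
- move=> x f u v Hf Hu; rewrite !tanb_rprod_connE.
  have E1 : conn1 (lpart (fun y : P => f y *: u y)) x v =
      dfun f x v *: lpart u x + f x *: conn1 (lpart u) x v.
    rewrite -(conn_leibniz c1 v Hf (lsub_smooth Hu)) /lpart.
    by congr (fun_of_lfun (conn1 _ x) v); apply/funext => y; rewrite linearZ.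
  have E2 : conn2 (rpart (fun y : P => f y *: u y)) x v =
      dfun f x v *: rpart u x + f x *: conn2 (rpart u) x v.
    rewrite -(conn_leibniz c2 v Hf (rsub_smooth Hu)) /rpart.
    by congr (fun_of_lfun (conn2 _ x) v); apply/funext => y; rewrite linearZ.
  etransitivity; first exact: (f_equal2 (row_mx (n1 := mdim M) (n2 := mdim N)) E1 E2).
  rewrite -add_row_mx -!scale_row_mx; congr (_ *: _ + _).
  exact: (hsubmxK (u x : 'rV[C]_d)).
- move=> x u Hu; apply: (homb_smoothP clP vTP vTP) => X HX.
  have H1 := homb_smooth_apply clP vTP (pull1_vector_bundle vTM)
     (conn_smooth c1 (lsub_smooth Hu)) HX.
  have H2 := homb_smooth_apply clP vTP (pull2_vector_bundle vTN)
     (conn_smooth c2 (rsub_smooth Hu)) HX.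
  apply: row_mx_smooth.
    apply: (smooth_sec_near_eq (V := (pull1 N (tanb M) : bundle P)) clP) H1.
    by apply: (@nearW _ (nbhs x)) => y; rewrite tanb_rprod_connE row_mxKl.
  apply: (smooth_sec_near_eq (V := (pull2 M (tanb N) : bundle P)) clP) H2.
  by apply: (@nearW _ (nbhs x)) => y; rewrite tanb_rprod_connE row_mxKr.
Qed.

End ProductTangent.
End ProductBundles.

(** * Expansion of iterated covariant derivatives in terms of another connection *)

Section LinearAlgebraOfHom.
Variables (K : fieldType) (U V W : vectType K).

Definition lflip (c : 'Hom(U, 'Hom(V, W))) : 'Hom(V, 'Hom(U, W)) :=
  linfun (fun w : V => linfun (fun v : U => c v w)).

Definition lpost (c : 'Hom(V, W)) : 'Hom('Hom(U, V), 'Hom(U, W)) :=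
  linfun (fun f : 'Hom(U, V) => (c \o f)%VF).

Lemma lflipE c w v : lflip c w v = c v w.
Proof.
have L w0 : linear (fun v : U => c v w0).
  by move=> k v1 v2; rewrite linearP add_lfunE scale_lfunE.
rewrite /lflip linfun_lin; first by rewrite linfun_lin.
move=> k w1 w2; apply/lfunP => v0; rewrite add_lfunE scale_lfunE !linfun_lin//.
by rewrite linearP.
Qed.

Lemma lpostE c f v : lpost c f v = c (f v).
Proof.
rewrite /lpost linfun_lin ?comp_lfunE// => k f1 f2.
by apply/lfunP => v0; rewrite !(add_lfunE, scale_lfunE, comp_lfunE) linearP.
Qed.

End LinearAlgebraOfHom.

Section GoodBundles.
Variables (R : realType) (M : rmfd R).
Local Notation C := R[i].
Local Notation n := (mdim M).

Record connection_bundle (V : bundle M) : Prop := {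
  cb_vector : vector_bundle V;
  cb_conn : is_connection V }.

Hypothesis cl : chart_laws M.
Hypothesis gT : connection_bundle (tanb M).

Lemma homb_good V W : connection_bundle V -> connection_bundle W ->
  connection_bundle (homb V W).
Proof.
case: gT => vT _ [vV cV] [vW cW]; split; first exact: homb_vector_bundle.
exact: homb_is_connection.
Qed.

Lemma ctens_good V j : connection_bundle V -> connection_bundle (ctens j V).
Proof. by move=> gV; elim: j => //= j IH; exact: homb_good. Qed.

Lemma nabla_smooth V (u : section V) j : connection_bundle V ->
  smooth_sec u -> smooth_sec (nabla u j).
Proof.
move=> gV su; elim: j => //= j IH x.
by have [_ cj] := ctens_good j gV; exact: (conn_smooth cj).
Qed.

Section SmoothOperations.
Variables V W Z : bundle M.
Hypotheses (vV : vector_bundle V) (vW : vector_bundle W) (vZ : vector_bundle Z).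

Lemma flip_smooth x (c : section (homb Z (homb V W))) : smooth_sec_near x c ->
  smooth_sec_near (V := homb V (homb Z W)) x
    (fun y => lflip (c y : 'Hom(fib Z y, 'Hom(fib V y, fib W y)))).
Proof.
move=> Hc; apply: (homb_smoothP cl vV (homb_vector_bundle cl vZ vW)) => u Hu.
apply: (homb_smoothP cl vZ vW) => X HX.
have H := homb_smooth_apply cl vV vW (homb_smooth_apply cl vZ (homb_vector_bundle cl vV vW) Hc HX) Hu.
apply: (smooth_sec_near_eq cl) H.
by apply: (@nearW _ (nbhs x)) => y; rewrite lflipE.
Qed.

Lemma post_smooth x (c : section (homb V W)) : smooth_sec_near x c ->
  smooth_sec_near (V := homb (homb Z V) (homb Z W)) x
    (fun y => lpost (fib Z y) (c y : 'Hom(fib V y, fib W y))).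
Proof.
move=> Hc; apply: (homb_smoothP cl (homb_vector_bundle cl vZ vV)
  (homb_vector_bundle cl vZ vW)) => f Hf.
apply: (homb_smoothP cl vZ vW) => X HX.
have H := homb_smooth_apply cl vV vW Hc (homb_smooth_apply cl vZ vV Hf HX).
apply: (smooth_sec_near_eq cl) H.
by apply: (@nearW _ (nbhs x)) => y; rewrite lpostE.
Qed.

Lemma comp_smooth x (c : section (homb V W)) (d : section (homb Z V)) :
  smooth_sec_near x c -> smooth_sec_near x d ->
  smooth_sec_near (V := homb Z W) x
   (fun y => ((c y : 'Hom(fib V y, fib W y)) \o (d y : 'Hom(fib Z y, fib V y)))%VF).
Proof.
move=> Hc Hd; apply: (homb_smoothP cl vZ vW) => X HX.
have H := homb_smooth_apply cl vV vW Hc (homb_smooth_apply cl vZ vV Hd HX).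
apply: (smooth_sec_near_eq cl) H.
by apply: (@nearW _ (nbhs x)) => y; rewrite comp_lfunE.
Qed.

End SmoothOperations.

Section Expansion.
Variables E E' : bundle M.
Hypotheses (gE : connection_bundle E) (gE' : connection_bundle E').
Variable J : section (homb E' E).

(** The coefficients in [nabla^i (J u) = sum_k coef i k (nabla^k u)].  The
    Leibniz rule gives
      [coef i.+1 k = nabla (coef i k) + coef i k.-1],
    up to the order of arguments: in the first term the new tangent vector is
    the first argument of the derivative and has to be moved behind the element
    of [ctens k E'] (flip), in the second it is the first argument of
    [nabla^k u] (postcomposition). *)
Fixpoint coef (i : nat) : forall k, section (homb (ctens k E') (ctens i E)) :=
  match i with
  | 0 => fun k => match k with 0 => J | _.+1 => fun x => 0 end
  | i'.+1 => fun k =>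
    match k return section (homb (ctens k E') (ctens i'.+1 E)) with
    | 0 => fun x => lflip (conn (coef i' 0) x :
        'Hom('rV[C]_n, 'Hom(fib E' x, fib (ctens i' E) x)))
    | k'.+1 => fun x =>
       lflip (conn (coef i' k'.+1) x :
         'Hom('rV[C]_n, 'Hom(fib (ctens k'.+1 E') x, fib (ctens i' E) x))) +
       lpost 'rV[C]_n (coef i' k' x : 'Hom(fib (ctens k' E') x, fib (ctens i' E) x))
    end
  end.

Hypothesis sJ : smooth_sec J.

Lemma coef_smooth i k : smooth_sec (coef i k).
Proof.
elim: i k => [|i IH] [|k] x.
- exact: (@sJ x).
- exact: (@smooth_sec_near0 _ _ (homb (ctens k.+1 E') E) x).
- have [vk ck] := homb_good (ctens_good 0 gE') (ctens_good i gE).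
  apply: (flip_smooth (V := E') (cb_vector gE') (cb_vector (ctens_good i gE))
    (cb_vector gT)).
  exact: (conn_smooth ck (IH 0%N x)).
- have [vk ck] := homb_good (ctens_good k.+1 gE') (ctens_good i gE).
  apply: smooth_sec_nearD.
    apply: (flip_smooth (V := ctens k.+1 E') (cb_vector (ctens_good k.+1 gE'))
     (cb_vector (ctens_good i gE)) (cb_vector gT)).
    exact: (conn_smooth ck (IH k.+1 x)).
  apply: (post_smooth (V := ctens k E') (cb_vector (ctens_good k gE'))
     (cb_vector (ctens_good i gE)) (cb_vector gT)).
  exact: IH.
Qed.

Lemma coef_gt i k x : (i < k)%N -> coef i k x = 0.
Proof.
elim: i k x => [|i IH] [|k] x //= ik.
have -> : coef i k.+1 = fun y => 0.
  by apply/functional_extensionality_dep => y; apply: IH; exact: ltnW.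
have [vk ck] := homb_good (ctens_good k.+1 gE') (ctens_good i gE).
apply/lfunP => f; apply/lfunP => v.
rewrite (IH k x ik) add_lfunE add_lfunE lflipE lpostE (conn0 ck).
by rewrite !zero_lfunE addr0.
Qed.

(** One more derivative of a summand splits by the Leibniz rule into the two
    terms that define [coef i.+1]; the sums can be extended to any [N > i]
    because [coef i k] vanishes for [i < k]. *)
Lemma nabla_expansion (u : section E') i N x : smooth_sec u -> (i < N)%N ->
  nabla (V := E) (fun y => (J y : 'Hom(fib E' y, fib E y)) (u y)) i x =
  \sum_(k < N) (coef i k x : 'Hom(fib (ctens k E') x, fib (ctens i E) x))
     (nabla u k x).
Proof.
move=> su; elim: i N x => [|i IH] N x.
  case: N => // N _; rewrite big_ord_recl /= big1 ?addr0// => k _.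
  exact: zero_lfunE.
case: N => // N iN; rewrite ltnS in iN.
apply/lfunP => v; rewrite [LHS]/=.
have -> : nabla (V := E) (fun y => (J y : 'Hom(fib E' y, fib E y)) (u y)) i =
  fun y => \sum_(k < N) (coef i k y : 'Hom(fib (ctens k E') y, fib (ctens i E) y))
     (nabla u k y).
  by apply/functional_extensionality_dep => y; exact: IH.
have [vi ci] := ctens_good i gE.
have ss k y : smooth_sec_near y (nabla u k) by exact: (nabla_smooth gE' su).
have sc k y : smooth_sec_near y (coef i k) by exact: coef_smooth.
rewrite (conn_sum (V := ctens i E) ci); last first.
  move=> k; apply: (homb_smooth_apply cl (cb_vector (ctens_good k gE')) vi) => //.
have L k : conn (fun y => (coef i k y : 'Hom(fib (ctens k E') y, fib (ctens i E) y))
     (nabla u k y)) x v =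
   (conn (coef i k) x v : 'Hom(fib (ctens k E') x, fib (ctens i E) x)) (nabla u k x) +
   (coef i k x : 'Hom(fib (ctens k E') x, fib (ctens i E) x)) (conn (nabla u k) x v).
  have [vk ck] := ctens_good k gE'.
  exact: (hom_leibniz cl vk vi ck ci).
under eq_bigr do rewrite L.
rewrite big_split /= sum_lfunE big_ord_recl /=.
have -> : \sum_(k < N) (conn (coef i k) x v :
     'Hom(fib (ctens k E') x, fib (ctens i E) x)) (nabla u k x) =
   \sum_(k < N.+1) (conn (coef i k) x v :
     'Hom(fib (ctens k E') x, fib (ctens i E) x)) (nabla u k x).
  rewrite big_ord_recr /=.
  have -> : coef i N = fun y => 0.
    by apply/functional_extensionality_dep => y; exact: coef_gt.
  have [_ cN] := homb_good (ctens_good N gE') (ctens_good i gE).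
  by rewrite (conn0 cN) zero_lfunE addr0.
rewrite big_ord_recl /= -addrA; congr (_ + _); first by rewrite lflipE.
rewrite -big_split /=; apply: eq_bigr => k _.
by rewrite add_lfunE add_lfunE lflipE lpostE.
Qed.

End Expansion.
End GoodBundles.

(** * Finite-dimensional inner product spaces *)

Section InnerProducts.
Variable R : realType.
Local Notation C := R[i].

Record inner_product (U : vectType C) (h : U -> U -> C) : Prop := {
  ip_lin : forall (c : C) (u v w : U), h (c *: u + v) w = c * h u w + h v w;
  ip_sym : forall u w : U, h u w = conjc (h w u);
  ip_pos : forall u : U, u != 0 -> 0 < h u u }.

Definition ipnorm (U : vectType C) (h : U -> U -> C) (u : U) : R :=
  Num.sqrt (complex.Re (h u u)).

Section OneSpace.
Variables (U : vectType C) (h : U -> U -> C).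
Hypothesis ip : inner_product h.

Lemma ip_suml (I : Type) (s : seq I) (c : I -> C) (v : I -> U) w :
  h (\sum_(i <- s) c i *: v i) w = \sum_(i <- s) c i * h (v i) w.
Proof.
elim: s => [|i s IH]; last by rewrite !big_cons (ip_lin ip) IH.
rewrite !big_nil; have := ip_lin ip 1 0 0 w.
by rewrite scaler0 addr0 mul1r => /esym /eqP; rewrite -subr_eq0 addrK => /eqP.
Qed.

Lemma ip_sumr (I : Type) (s : seq I) (c : I -> C) (v : I -> U) w :
  h w (\sum_(i <- s) c i *: v i) = \sum_(i <- s) conjc (c i) * h w (v i).
Proof.
rewrite (ip_sym ip) ip_suml rmorph_sum; apply: eq_bigr => i _.
by rewrite rmorphM /= -(ip_sym ip).
Qed.

Lemma ipZl c u w : h (c *: u) w = c * h u w.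
Proof. by have := @ip_suml _ [:: tt] (fun=> c) (fun=> u) w; rewrite !big_seq1. Qed.

Lemma ipZr c u w : h w (c *: u) = conjc c * h w u.
Proof. by have := @ip_sumr _ [:: tt] (fun=> c) (fun=> u) w; rewrite !big_seq1. Qed.

Lemma ipDl u v w : h (u + v) w = h u w + h v w.
Proof. by have := ip_lin ip 1 u v w; rewrite scale1r mul1r. Qed.

Lemma ipDr u v w : h w (u + v) = h w u + h w v.
Proof. by rewrite (ip_sym ip) ipDl rmorphD /= -!(ip_sym ip). Qed.

Lemma ip0 : h 0 0 = 0.
Proof. by have := ipZl 0 0 0; rewrite scaler0 mul0r. Qed.

Lemma ip_ge0 u : 0 <= h u u.
Proof. by have [->|/(ip_pos ip)/ltW//] := eqVneq u 0; rewrite ip0. Qed.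

Lemma Re_ip_ge0 u : 0 <= complex.Re (h u u).
Proof. by have := ip_ge0 u; rewrite lecE => /andP[]. Qed.

Lemma ip_real u : h u u = (complex.Re (h u u))%:C.
Proof. by case: (h u u) (ger0_Im (ip_ge0 u)) => a b /= ->. Qed.

Lemma ipnorm_ge0 u : 0 <= ipnorm h u.
Proof. exact: sqrtr_ge0. Qed.

Lemma ipnorm_sqr u : ipnorm h u ^+ 2 = complex.Re (h u u).
Proof. by rewrite sqr_sqrtr// Re_ip_ge0. Qed.

Lemma ipnorm0 : ipnorm h 0 = 0.
Proof. by rewrite /ipnorm ip0 sqrtr0. Qed.

Lemma ipnorm_eq0 u : ipnorm h u = 0 -> u = 0.
Proof.
move=> u0; apply/eqP; apply: contraT => /(ip_pos ip).
by rewrite ip_real -ipnorm_sqr u0 expr0n ltxx.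
Qed.

Lemma ReZ (t : R) (z : C) : complex.Re (t%:C * z) = t * complex.Re z.
Proof. by case: z => a b; rewrite /= mul0r subr0. Qed.

Lemma Re_conj (z : C) : complex.Re (conjc z) = complex.Re z.
Proof. by case: z. Qed.

Lemma Re_sum (I : Type) (s : seq I) (F : I -> C) :
  complex.Re (\sum_(i <- s) F i) = \sum_(i <- s) complex.Re (F i).
Proof. by elim: s => [|i s IH]; rewrite ?big_nil// !big_cons ReD IH. Qed.

(** The squared norm of [u + t w] is nonnegative at its minimum over real
    [t]. *)
Lemma Cauchy_Schwarz_Re u w : complex.Re (h u w) <= ipnorm h u * ipnorm h w.
Proof.
have [/eqP/ipnorm_eq0 w0|wn0] := boolP (ipnorm h w == 0).
  have -> : h u w = 0 by rewrite w0 -(scale0r (0 : U)) ipZr rmorph0 mul0r.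
  by rewrite mulr_ge0 ?ipnorm_ge0.
apply: le_trans (ler_norm _) _.
rewrite -(@ler_pXn2r _ 2)// ?nnegrE ?mulr_ge0 ?ipnorm_ge0// real_normK ?num_real//.
rewrite exprMn !ipnorm_sqr.
have w2 : 0 < complex.Re (h w w) by rewrite -ipnorm_sqr exprn_gt0// lt0r wn0 ipnorm_ge0.
pose t := - (complex.Re (h u w) / complex.Re (h w w)).
have := Re_ip_ge0 (u + t%:C *: w).
rewrite ipDl !ipDr !ipZl !ipZr !conjc_real !ReD !ReZ.
have -> : complex.Re (h w u) = complex.Re (h u w) by rewrite (ip_sym ip) Re_conj.
set a := complex.Re (h u u); set b := complex.Re (h u w).
rewrite /t -/b; set c := complex.Re (h w w) in w2 * => H.
have : 0 <= (a - b ^+ 2 / c) * c.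
  apply: mulr_ge0; last exact: ltW.
  apply: le_trans H _; rewrite le_eqVlt; apply/orP; left; apply/eqP.
  by have := lt0r_neq0 w2 => c0; field.
rewrite mulrBl divfK ?gt_eqF// subr_ge0; exact.
Qed.

Lemma ipnormD u w : ipnorm h (u + w) <= ipnorm h u + ipnorm h w.
Proof.
rewrite -(@ler_pXn2r _ 2)// ?nnegrE ?addr_ge0 ?ipnorm_ge0//.
rewrite sqrrD !ipnorm_sqr ipDl !ipDr !ReD.
have -> : complex.Re (h w u) = complex.Re (h u w) by rewrite (ip_sym ip) Re_conj.
by have := Cauchy_Schwarz_Re u w; lra.
Qed.

Lemma ipnormN u : ipnorm h (- u) = ipnorm h u.
Proof.
by rewrite /ipnorm -scaleN1r ipZl ipZr rmorphN1 mulrA mulrNN !mul1r.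
Qed.

Definition orthonormal_basis r (e : 'I_r -> U) : Prop :=
  (forall i j, h (e i) (e j) = (i == j)%:R) /\
  (forall w, w = \sum_i h w (e i) *: e i).

Section Orthonormal.
Variables (r : nat) (e : 'I_r -> U).
Hypothesis he : orthonormal_basis e.

Lemma Parseval w : ipnorm h w ^+ 2 =
  \sum_i complex.Re (h w (e i) * conjc (h w (e i))).
Proof.
rewrite ipnorm_sqr -Re_sum; congr complex.Re.
rewrite {2}(he.2 w) ip_sumr; apply: eq_bigr => i _; exact: mulrC.
Qed.

Lemma ipnorm_orthonormal i : ipnorm h (e i) = 1.
Proof. by rewrite /ipnorm (he.1 i i) eqxx sqrtr1. Qed.

End Orthonormal.

(** The Gram matrix of a basis is diagonalised by a unitary change of basis;
    rescaling gives an orthonormal basis, and a factorisation of the inverse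
    of the Gram matrix. *)
Lemma orthonormal_basis_exists r (b : r.-tuple U) : basis_of {:U} b ->
  exists P : 'M[C]_r,
   orthonormal_basis (fun i => \sum_a P i a *: tnth b a) /\
   invmx (\matrix_(a, c) h (tnth b a) (tnth b c)) =
     (map_mx conjc P)^T *m P.
Proof.
move=> bb; set G := \matrix_(a, c) _.
have GE (Q S : 'M[C]_r) i j :
    h (\sum_a Q i a *: tnth b a) (\sum_a S j a *: tnth b a) =
    (Q *m G *m (map_mx conjc S)^T) i j.
  rewrite ip_suml -mulmxA mxE; apply: eq_bigr => a _; congr (_ * _).
  rewrite ip_sumr mxE; apply: eq_bigr => c _.
  by rewrite !mxE mulrC.
have Gh : (map_mx conjc G)^T = G.
  by apply/matrixP => i j; rewrite !mxE -(ip_sym ip).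
have Gn : G \is normalmx.
  by apply/normalmxP; rewrite map_trmx in Gh; rewrite [map_mx _ _]Gh.
have /orthomx_spectral_subproof [[U0 D] /= Uu GD] := Gn.
have UV : (map_mx conjc U0)^T = invmx U0 by rewrite invmx_unitary// map_trmx.
have Uunit := unitarymx_unit Uu.
pose f i := \sum_a U0 i a *: tnth b a.
have fE i j : h (f i) (f j) = (diag_mx D) i j.
  by rewrite GE UV GD !mulmxA mulmxV// mul1mx mulmxK.
have f0 i : f i != 0.
  apply/eqP => fi0.
  have Ui0 a : U0 i a = 0.
    have /freeP H := basis_free bb; apply: (H (fun a => U0 i a)).
    transitivity (f i) => //.
    by apply: eq_bigr => c _; rewrite (tnth_nth 0).
  have := mulmxV Uunit => /matrixP/(_ i i); rewrite !mxE big1 ?eqxx.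
    by move=> /esym/eqP; rewrite oner_eq0.
  by move=> a _; rewrite Ui0 mul0r.
pose d i := complex.Re (D 0 i).
have dE i : D 0 i = (d i)%:C.
  by have := ip_real (f i); rewrite fE mxE eqxx mulr1n.
have d_gt0 i : 0 < d i.
  by have := ip_pos ip (f0 i); rewrite fE mxE eqxx mulr1n dE ltcR.
pose s i := (Num.sqrt (d i))^-1.
have sd i : (s i)%:C * (s i)%:C * D 0 i = 1.
  rewrite dE -!rmorphM /= /s -invfM -expr2 sqr_sqrtr ?ltW//.
  by rewrite mulVf ?gt_eqF.
pose P := diag_mx (\row_i (s i)%:C) *m U0.
have PE i : \sum_a P i a *: tnth b a = (s i)%:C *: f i.
  rewrite scaler_sumr; apply: eq_bigr => a _; rewrite scalerA; congr (_ *: _).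
  by rewrite /P mul_diag_mx !mxE.
have Po i j : h (\sum_a P i a *: tnth b a) (\sum_a P j a *: tnth b a) = (i == j)%:R.
  rewrite !PE ipZl ipZr conjc_real fE mxE.
  have [<-|ij] := eqVneq i j; last by rewrite mulr0n !mulr0.
  by rewrite mulr1n mulrA sd.
have PG : P *m G *m (map_mx conjc P)^T = 1%:M.
  by apply/matrixP => i j; rewrite -GE Po mxE.
exists P; split; [split => //|].
  move=> w.
  have [Pu _] : P \in unitmx /\ _ := mulmx1_unit (etrans (mulmxA _ _ _) PG).
  pose q := (\row_a coord b a w) *m invmx P.
  have wE : w = \sum_i q 0 i *: (\sum_a P i a *: tnth b a).
    under eq_bigr do rewrite scaler_sumr.
    rewrite exchange_big {1}(basis_coordE w bb) /=; apply: eq_bigr => a _.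
    under eq_bigr do rewrite scalerA.
    rewrite -scaler_suml; congr (_ *: _).
    have : (q *m P) 0 a = coord b a w by rewrite mulmxKV// mxE.
    by rewrite mxE => <-.
  rewrite {1}wE; apply: eq_bigr => i _; congr (_ *: _).
  rewrite [in RHS]wE ip_suml (bigD1 i) //= Po eqxx mulr1 big1 ?addr0//.
  by move=> j /negPf ji; rewrite Po ji mulr0.
have := PG; rewrite -mulmxA => /mulmx1C; rewrite -mulmxA => GI.
have [Gu _] := mulmx1_unit GI.
by rewrite -[RHS](mulKmx Gu) GI mulmx1.
Qed.

End OneSpace.
End InnerProducts.

(** * The Hilbert-Schmidt norm on the Hom bundle *)

Section HilbertSchmidt.
Variables (R : realType) (M : rmfd R).
Local Notation C := R[i].

Record metric_bundle (V : bundle M) : Prop := {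
  mb_ip : forall x, inner_product (@herm R M V x);
  mb_basis : forall x, basis_of {: fib V x} (frame V x x) }.

Lemma hermitian_metric_bundle (V : bundle M) :
  vector_bundle V -> hermitian_metric V -> metric_bundle V.
Proof.
move=> vV [hl hs hp _]; split=> x; last exact: frame_basis_at.
by split=> *; [exact: hl|exact: hs|exact: hp].
Qed.

(** In an orthonormal basis the Gram matrix of the defining formula
    disappears. *)
Lemma homb_orthonormal (V : bundle M) x : metric_bundle V ->
  exists e : 'I_(rank V x) -> fib V x,
    orthonormal_basis (@herm R M V x) e /\
    forall W, metric_bundle W -> forall c d : 'Hom(fib V x, fib W x),
      @herm R M (homb V W) x c d = \sum_i herm (c (e i)) (d (e i)).
Proof.
move=> [ipV bV]; have [P [oP GP]] := orthonormal_basis_exists (ipV x) (bV x).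
exists (fun i => \sum_a P i a *: tnth (frame V x x) a); split=> // W [ipW _] c d.
have ->: @herm R M (homb V W) x c d = \sum_a \sum_b
    (invmx (\matrix_(a, b) herm (tnth (frame V x x) a) (tnth (frame V x x) b))) b a *
      herm (c (tnth (frame V x x) a)) (d (tnth (frame V x x) b)) by [].
rewrite GP.
have E i : herm (c (\sum_a P i a *: tnth (frame V x x) a))
      (d (\sum_a P i a *: tnth (frame V x x) a)) =
   \sum_a \sum_b P i a * conjc (P i b) *
      herm (c (tnth (frame V x x) a)) (d (tnth (frame V x x) b)).
  rewrite !linear_sum /=.
  under eq_bigr do rewrite linearZ.
  under [X in herm _ X]eq_bigr do rewrite linearZ.
  rewrite (ip_suml (ipW x)); apply: eq_bigr => a _.
  rewrite (ip_sumr (ipW x)) mulr_sumr; apply: eq_bigr => b _.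
  by rewrite mulrA.
under [RHS]eq_bigr do rewrite E.
rewrite [RHS]exchange_big /=; apply: eq_bigr => a _.
rewrite [RHS]exchange_big /=; apply: eq_bigr => b _.
rewrite -mulr_suml; congr (_ * _); rewrite mxE; apply: eq_bigr => i _.
by rewrite !mxE mulrC.
Qed.

Lemma homb_metric V W : metric_bundle V -> metric_bundle W ->
  metric_bundle (homb V W).
Proof.
move=> mV mW; split=> x; last first.
  by apply: homb_basis; exact: mb_basis.
have [e [[eo eE] He]] := homb_orthonormal x mV.
have ipW := mb_ip mW x.
split=> [k c d f|c d|c c0]; rewrite !(He W mW).
- rewrite mulr_sumr -big_split /=; apply: eq_bigr => i _.
  by rewrite add_lfunE scale_lfunE (ip_lin ipW).
- by rewrite rmorph_sum; apply: eq_bigr => i _; rewrite (ip_sym ipW).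
- have [i ci] : exists i, c (e i) != 0.
    apply: contrapT => H; case/negP: c0; apply/eqP/lfunP => v.
    rewrite zero_lfunE (eE v) linear_sum big1// => i _.
    rewrite linearZ /=; suff -> : c (e i) = 0 by rewrite scaler0.
    by apply/eqP; apply: contrapT => ci; apply: H; exists i; apply/negP.
  rewrite (bigD1 i) //=; apply: ltr_wpDr; last exact: (ip_pos ipW).
  by apply: sumr_ge0 => j _; exact: (ip_ge0 ipW).
Qed.

Section Norms.
Variables (U V W : bundle M).
Hypotheses (mU : metric_bundle U) (mV : metric_bundle V) (mW : metric_bundle W).
Variable x : M.

Lemma vnorm_ge0 (w : fib V x) : 0 <= vnorm w.
Proof. exact: sqrtr_ge0. Qed.

Lemma vnorm_add (u w : fib V x) : vnorm (u + w) <= vnorm u + vnorm w.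
Proof. exact: (ipnormD (mb_ip mV x) u w). Qed.

Lemma vnorm_opp (u : fib V x) : vnorm (- u) = vnorm u.
Proof. exact: (ipnormN (mb_ip mV x) u). Qed.

Lemma le_of_sqr (a b : R) : 0 <= b -> a ^+ 2 <= b ^+ 2 -> a <= b.
Proof.
move=> b0 ab; have [a0|/ltW a0] := leP 0 a; last exact: le_trans a0 b0.
by rewrite -(@ler_pXn2r _ 2).
Qed.

(** This is the Cauchy-Schwarz inequality between [c] and a map of rank one, in
    the Hilbert-Schmidt inner product. *)
Lemma vnorm_hom_apply (c : 'Hom(fib V x, fib W x)) (u : fib V x) :
  vnorm (c u) <= @vnorm R M (homb V W) x c * vnorm u.
Proof.
have [e [eo He]] := homb_orthonormal x mV.
have ipV := mb_ip mV x; have ipW := mb_ip mW x.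
have ipH := mb_ip (homb_metric mV mW) x.
(* d has rank one, and c pairs with d to the squared norm of c u *)
pose d : 'Hom(fib V x, fib W x) := linfun (fun v => herm v u *: c u).
have dE v : d v = herm v u *: c u.
  by rewrite linfun_lin// => k a b; rewrite (ip_lin ipV) scalerDl scalerA.
have cd : complex.Re (@herm R M (homb V W) x c d) = vnorm (c u) ^+ 2.
  rewrite (He W mW) [RHS](ipnorm_sqr ipW); congr complex.Re.
  rewrite {1}(eo.2 u) linear_sum /=.
  under [X in herm X _]eq_bigr do rewrite linearZ.
  rewrite (ip_suml ipW); apply: eq_bigr => i _.
  by rewrite dE (ipZr ipW) -(ip_sym ipV).
have dd : @vnorm R M (homb V W) x d = vnorm u * vnorm (c u).
  apply/eqP; rewrite -(@eqrXn2 _ 2)// ?mulr_ge0 ?vnorm_ge0 ?sqrtr_ge0//.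
  rewrite exprMn [X in X == _](ipnorm_sqr ipH) (He W mW).
  rewrite [vnorm u ^+ 2](Parseval ipV eo u) Re_sum mulr_suml.
  apply/eqP; apply: eq_bigr => i _.
  rewrite dE (ipZl ipW) (ipZr ipW) mulrA [vnorm (c u) ^+ 2](ipnorm_sqr ipW) (ip_real ipW) /=.
  rewrite mulrC ReZ mulrC [herm (e i) u](ip_sym ipV) conjcK.
  by rewrite [conjc _ * _]mulrC.
have := Cauchy_Schwarz_Re ipH c d.
rewrite cd -[ipnorm _ d]/(@vnorm R M (homb V W) x d) dd => H.
have [cu0|cu0] := eqVneq (vnorm (c u)) 0.
  by rewrite cu0 mulr_ge0 ?sqrtr_ge0.
rewrite -(@ler_pM2r _ (vnorm (c u))) ?lt0r ?cu0 ?sqrtr_ge0//.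
by rewrite -expr2 -mulrA.
Qed.

Lemma vnorm_post (c : 'Hom(fib V x, fib W x)) (f : 'Hom(fib U x, fib V x)) K :
  0 <= K -> (forall w, vnorm (c w) <= K * vnorm w) ->
  @vnorm R M (homb U W) x (c \o f)%VF <= K * @vnorm R M (homb U V) x f.
Proof.
move=> K0 cK; have [e [eo He]] := homb_orthonormal x mU.
have ipUV := mb_ip (homb_metric mU mV) x; have ipUW := mb_ip (homb_metric mU mW) x.
apply: le_of_sqr; first by rewrite mulr_ge0 ?sqrtr_ge0.
rewrite exprMn [X in X <= _](ipnorm_sqr ipUW) [X in _ <= _ * X](ipnorm_sqr ipUV).
rewrite (He W mW) (He V mV) !Re_sum mulr_sumr; apply: ler_sum => i _.
rewrite comp_lfunE -(ipnorm_sqr (mb_ip mW x)) -(ipnorm_sqr (mb_ip mV x)) -exprMn.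
by rewrite ler_pXn2r ?nnegrE ?mulr_ge0 ?sqrtr_ge0//; exact: cK.
Qed.

Lemma vnorm_hom_le (f : 'Hom(fib V x, fib W x)) K : 0 <= K ->
  (forall v, vnorm (f v) <= K * vnorm v) ->
  @vnorm R M (homb V W) x f <= Num.sqrt (rank V x)%:R * K.
Proof.
move=> K0 fK; have [e [eo He]] := homb_orthonormal x mV.
have ipVW := mb_ip (homb_metric mV mW) x.
apply: le_of_sqr; first by rewrite mulr_ge0 ?sqrtr_ge0.
rewrite exprMn [Num.sqrt _%:R ^+ 2]sqr_sqrtr ?ler0n// [X in X <= _](ipnorm_sqr ipVW) (He W mW) Re_sum.
have -> : (rank V x)%:R * K ^+ 2 = \sum_(i < rank V x) K ^+ 2.
  by rewrite sumr_const card_ord mulr_natl.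
apply: ler_sum => i _; rewrite -(ipnorm_sqr (mb_ip mW x)).
rewrite ler_pXn2r ?nnegrE ?sqrtr_ge0//.
by have := fK (e i); rewrite [vnorm (e i)](ipnorm_orthonormal eo) mulr1.
Qed.

(** Precomposition needs a duality argument: the functional
    [v |-> herm (a v) z] is represented by a vector. *)
Lemma vnorm_pre (a : 'Hom(fib V x, fib W x)) (c : 'Hom(fib U x, fib V x)) K :
  0 <= K -> (forall w, vnorm (c w) <= K * vnorm w) ->
  @vnorm R M (homb U W) x (a \o c)%VF <= @vnorm R M (homb V W) x a * K.
Proof.
move=> K0 cK.
have [e [eo He]] := homb_orthonormal x mU.
have [f [fo Hf]] := homb_orthonormal x mV.
have [g [go _]] := homb_orthonormal x mW.
have ipU := mb_ip mU x; have ipV := mb_ip mV x; have ipW := mb_ip mW x.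
have ipUW := mb_ip (homb_metric mU mW) x; have ipVW := mb_ip (homb_metric mV mW) x.
pose sq (z : C) : R := complex.Re (z * conjc z).
have key z : \sum_i sq (herm (a (c (e i))) z) <=
    K ^+ 2 * \sum_j sq (herm (a (f j)) z).
  (* y represents the functional, u is where the pulled back one is attained *)
  pose u := \sum_i conjc (herm (a (c (e i))) z) *: e i.
  pose y := \sum_j conjc (herm (a (f j)) z) *: f j.
  have lE v : herm (a v) z = herm v y.
    rewrite /y (ip_sumr ipV) {1}(fo.2 v) linear_sum /=.
    under eq_bigr do rewrite linearZ.
    rewrite (ip_suml ipW); apply: eq_bigr => j _.
    by rewrite conjcK mulrC.
  have uu : vnorm u ^+ 2 = \sum_i sq (herm (a (c (e i))) z).
    rewrite [LHS](Parseval ipU eo); apply: eq_bigr => i _.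
    have -> : herm u (e i) = conjc (herm (a (c (e i))) z).
      rewrite /u (ip_suml ipU) (bigD1 i)//= (eo.1 i i) eqxx mulr1 big1 ?addr0// => j ji.
      by rewrite (eo.1 j i) (negPf ji) mulr0.
    by rewrite conjcK /sq mulrC.
  have yy : vnorm y ^+ 2 = \sum_j sq (herm (a (f j)) z).
    rewrite [LHS](Parseval ipV fo); apply: eq_bigr => i _.
    have -> : herm y (f i) = conjc (herm (a (f i)) z).
      rewrite /y (ip_suml ipV) (bigD1 i)//= (fo.1 i i) eqxx mulr1 big1 ?addr0// => j ji.
      by rewrite (fo.1 j i) (negPf ji) mulr0.
    by rewrite conjcK /sq mulrC.
  have cuy : complex.Re (herm (c u) y) = vnorm u ^+ 2.
    rewrite uu -lE /u !linear_sum /=.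
    under eq_bigr do rewrite !linearZ.
    rewrite (ip_suml ipW) Re_sum; apply: eq_bigr => i _.
    by rewrite /sq mulrC.
  rewrite -uu -yy -exprMn ler_pXn2r ?nnegrE ?mulr_ge0 ?sqrtr_ge0//.
  have [u0|u0] := eqVneq (vnorm u) 0; first by rewrite u0 mulr_ge0 ?sqrtr_ge0.
  rewrite -(@ler_pM2r _ (vnorm u)) ?lt0r ?u0 ?sqrtr_ge0// -expr2 -cuy.
  apply: le_trans (Cauchy_Schwarz_Re ipV _ _) _.
  rewrite mulrAC; apply: ler_wpM2r; first exact: sqrtr_ge0.
  exact: cK.
apply: le_of_sqr; first by rewrite mulr_ge0 ?sqrtr_ge0.
rewrite mulrC exprMn [X in X <= _](ipnorm_sqr ipUW) [X in _ <= _ * X](ipnorm_sqr ipVW).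
rewrite (He W mW) (Hf W mW) !Re_sum.
have E r (b : 'I_r -> fib W x) : \sum_i complex.Re (herm (b i) (b i)) =
    \sum_k \sum_i sq (herm (b i) (g k)).
  rewrite exchange_big; apply: eq_bigr => i _.
  by rewrite -(ipnorm_sqr ipW) (Parseval ipW go).
rewrite (E _ (fun i => (a \o c)%VF (e i))) (E _ (fun j => a (f j))) mulr_sumr.
apply: ler_sum => k _.
by under eq_bigr do rewrite comp_lfunE; exact: key.
Qed.

End Norms.
End HilbertSchmidt.

(** * Sections with bounded covariant derivatives *)

Section BoundedSections.
Variables (R : realType) (M : rmfd R).
Local Notation C := R[i].
Local Notation n := (mdim M).
Local Notation T := (tanb M).
Hypotheses (cl : chart_laws M) (gT : connection_bundle T) (mT : metric_bundle T).

Implicit Types (U V W : bundle M).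

(** A size of vectors, recorded as the relation that a vector is at most [K]:
    operator norms can then be used without suprema. *)
Definition bound_pred (V : bundle M) := forall x : M, fib V x -> R -> Prop.

Definition norm_bound V : bound_pred V := fun x u K => vnorm u <= K.

Definition op_bound V W : bound_pred (homb V W) :=
  fun x (c : 'Hom(fib V x, fib W x)) K => forall w, vnorm (c w) <= K * vnorm w.

Definition form_bound V (N : bound_pred V) : bound_pred (homb T V) :=
  fun x (f : 'Hom('rV[C]_n, fib V x)) K =>
    forall v : fib T x, N x (f v) (K * vnorm v).

Record bound_laws V (N : bound_pred V) : Prop := {
  bl_zero : forall x, N x 0 0;
  bl_add : forall x u w K L, N x u K -> N x w L -> N x (u + w) (K + L);
  bl_opp : forall x u K, N x u K -> N x (- u) K }.

Lemma form_bound_laws V (N : bound_pred V) : bound_laws N -> bound_laws (form_bound N).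
Proof.
move=> [N0 ND NN]; split=> x.
- by move=> v; rewrite zero_lfunE mul0r; exact: N0.
- by move=> f g K L Hf Hg v; rewrite add_lfunE mulrDl; exact: ND.
- by move=> f K Hf v; rewrite opp_lfunE; exact: NN.
Qed.

Lemma norm_bound_laws V : metric_bundle V -> bound_laws (@norm_bound V).
Proof.
move=> mV; split=> x; rewrite /norm_bound.
- by rewrite [vnorm 0](ipnorm0 (mb_ip mV x)).
- by move=> u w K L Hu Hw; apply: le_trans (vnorm_add mV u w) _; exact: lerD.
- by move=> u K; rewrite vnorm_opp.
Qed.

Lemma op_bound_laws V W : metric_bundle W -> bound_laws (@op_bound V W).
Proof.
move=> mW; have [N0 ND NN] := norm_bound_laws mW.
split=> x; rewrite /op_bound.
- by move=> w; rewrite zero_lfunE mul0r; exact: N0.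
- by move=> c d K L Hc Hd w; rewrite add_lfunE mulrDl; exact: (ND x _ _ _ _ (Hc w) (Hd w)).
- by move=> c K Hc w; rewrite opp_lfunE; exact: (NN x _ _ (Hc w)).
Qed.

(** Boundedness of the covariant derivatives up to order [k], with the tangent
    directions measured one at a time by operator bounds: this turns the Leibniz
    rule into an induction on [k]. *)
Fixpoint bounded_upto (k : nat) (V : bundle M) (N : bound_pred V) (u : section V)
    {struct k} : Prop :=
  (exists K, 0 <= K /\ forall x, N x (u x) K) /\
  match k with
  | 0 => True
  | k'.+1 => bounded_upto k' (form_bound N) (conn u : section (homb T V))
  end.

Lemma bounded_upto0 k V N (u : section V) : bounded_upto k N u ->
  exists K, 0 <= K /\ forall x, N x (u x) K.
Proof. by case: k => [|k] []. Qed.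

Lemma bounded_upto_weak k V N (u : section V) :
  bounded_upto k.+1 N u -> bounded_upto k N u.
Proof.
elim: k V N u => [|k IH] V N u [H1 H2]; first by split.
by split=> //; exact: IH.
Qed.

Lemma bounded_upto_ext k V N (u w : section V) : (forall x, u x = w x) ->
  bounded_upto k N u -> bounded_upto k N w.
Proof.
by move=> uw; rewrite (functional_extensionality_dep uw).
Qed.

Lemma conn_smooth_sec V (u : section V) : connection_bundle V -> smooth_sec u ->
  smooth_sec (conn u : section (homb T V)).
Proof. by move=> gV su x; exact: (conn_smooth (cb_conn gV) (@su x)). Qed.

Lemma bounded_uptoD k V N (u w : section V) : connection_bundle V -> bound_laws N ->
  smooth_sec u -> smooth_sec w ->
  bounded_upto k N u -> bounded_upto k N w -> bounded_upto k N (fun x => u x + w x).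
Proof.
elim: k V N u w => [|k IH] V N u w gV lN su sw [[K [K0 HK]] Hu] [[L [L0 HL]] Hw];
  (split; first by exists (K + L); split; [exact: addr_ge0|move=> x; exact: (bl_add lN)]) => //.
apply: (@bounded_upto_ext k (homb T V) _ (fun x => conn u x + conn w x)).
  by move=> x; rewrite (conn_add (cb_conn gV) (@su x) (@sw x)).
apply: IH => //; first exact: homb_good.
- exact: form_bound_laws.
- exact: conn_smooth_sec.
- exact: conn_smooth_sec.
Qed.

Lemma bounded_uptoN k V N (u : section V) : connection_bundle V -> bound_laws N ->
  smooth_sec u -> bounded_upto k N u -> bounded_upto k N (fun x => - u x).
Proof.
elim: k V N u => [|k IH] V N u gV lN su [[K [K0 HK]] Hu];
  (split; first by exists K; split => // x; exact: (bl_opp lN)) => //.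
apply: (@bounded_upto_ext k (homb T V) _ (fun x => - conn u x)).
  move=> x; apply/lfunP => v.
  by rewrite (connN (cb_conn gV) v (@su x)) opp_lfunE.
apply: IH => //; [exact: homb_good|exact: form_bound_laws|exact: conn_smooth_sec].
Qed.

Lemma bounded_upto_zero k V N : connection_bundle V -> bound_laws N ->
  bounded_upto k N (fun x => 0 : fib V x).
Proof.
elim: k V N => [|k IH] V N gV lN;
  (split; first by exists 0; split => // x; exact: (bl_zero lN)) => //.
apply: (@bounded_upto_ext k (homb T V) _ (fun x => 0)).
  move=> x; apply/lfunP => v; rewrite zero_lfunE.
  by rewrite (conn0 (cb_conn gV)).
apply: IH => //; [exact: homb_good|exact: form_bound_laws].
Qed.

Lemma bounded_upto_sum k V N (m : nat) (F : 'I_m -> section V) :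
  connection_bundle V -> bound_laws N ->
  (forall i, smooth_sec (F i)) -> (forall i, bounded_upto k N (F i)) ->
  bounded_upto k N (fun x => \sum_(i < m) F i x).
Proof.
move=> gV lN sF bF; elim: (index_enum _) => [|i s IH].
  apply: (@bounded_upto_ext _ _ _ (fun x => 0)); last exact: bounded_upto_zero.
  by move=> x; rewrite big_nil.
apply: (@bounded_upto_ext _ _ _ (fun x => F i x + \sum_(i <- s) F i x)).
  by move=> x; rewrite big_cons.
apply: bounded_uptoD => // x.
by apply: smooth_sec_near_sum => j; exact: sF.
Qed.

Definition bound_le V (N N' : bound_pred V) := exists c, 0 <= c /\
  forall x u K, 0 <= K -> N x u K -> N' x u (c * K).

Lemma bound_le_trans V (N1 N2 N3 : bound_pred V) :
  bound_le N1 N2 -> bound_le N2 N3 -> bound_le N1 N3.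
Proof.
move=> [c [c0 H]] [d [d0 H']]; exists (d * c); split; first exact: mulr_ge0.
by move=> x u K K0 HK; rewrite -mulrA; apply: H'; [exact: mulr_ge0|exact: H].
Qed.

Lemma form_bound_le V (N N' : bound_pred V) : bound_le N N' ->
  bound_le (form_bound N) (form_bound N').
Proof.
move=> [c [c0 H]]; exists c; split => // x f K K0 Hf v; rewrite -mulrA.
by apply: H; [rewrite mulr_ge0 ?sqrtr_ge0|exact: Hf].
Qed.

Lemma bounded_upto_le k V (N N' : bound_pred V) u : bound_le N N' ->
  bounded_upto k N u -> bounded_upto k N' u.
Proof.
elim: k V N N' u => [|k IH] V N N' u NN' [[K [K0 HK]] Hu].
  split=> //; have [c [c0 H]] := NN'; exists (c * K); split; first exact: mulr_ge0.
  by move=> x; exact: H.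
split; last by apply: IH Hu; exact: form_bound_le.
have [c [c0 H]] := NN'; exists (c * K); split; first exact: mulr_ge0.
by move=> x; exact: H.
Qed.

Lemma norm_bound_form V : metric_bundle V ->
  bound_le (@norm_bound (homb T V)) (form_bound (@norm_bound V)).
Proof.
move=> mV; exists 1; split => // x f K K0 Hf v; rewrite mul1r /norm_bound.
apply: le_trans (vnorm_hom_apply mT mV f v) _.
by apply: ler_wpM2r => //; exact: sqrtr_ge0.
Qed.

Lemma form_bound_norm V : metric_bundle V ->
  bound_le (form_bound (@norm_bound V)) (@norm_bound (homb T V)).
Proof.
move=> mV; exists (Num.sqrt n%:R); split; first exact: sqrtr_ge0.
by move=> x f K K0 Hf; exact: (vnorm_hom_le mT mV).
Qed.

Lemma norm_bound_op V W : metric_bundle V -> metric_bundle W ->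
  bound_le (@norm_bound (homb V W)) (@op_bound V W).
Proof.
move=> mV mW; exists 1; split => // x c K K0 Hc w; rewrite mul1r.
apply: le_trans (vnorm_hom_apply mV mW c w) _.
by apply: ler_wpM2r => //; exact: sqrtr_ge0.
Qed.

Definition bounded_derivatives V (u : section V) :=
  forall j, exists K : R, forall x : M, vnorm (nabla u j x) <= K.

(** The bundles [ctens j.+1 V] and [ctens j (homb T V)] agree only up to a
    transport, so the shift of indices is stated for arbitrary predicates. *)
Lemma nabla_shift V (u : section V) j (P : forall V : bundle M, section V -> Prop) :
  P (ctens j.+1 V) (nabla u j.+1) <->
  P (ctens j (homb T V)) (nabla (conn u : section (homb T V)) j).
Proof.
elim: j P => [|j IH] P //.
exact: (IH (fun W (w : section W) => P (homb T W) (conn w))).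
Qed.

Lemma bounded_derivatives_conn V (u : section V) : bounded_derivatives u ->
  bounded_derivatives (conn u : section (homb T V)).
Proof.
move=> Hu j.
apply/(nabla_shift u j (fun W (w : section W) => exists K : R, forall x : M, vnorm (w x) <= K)).
exact: Hu.
Qed.

Lemma bounded_derivatives_upto k V (u : section V) : metric_bundle V ->
  bounded_derivatives u -> bounded_upto k (@norm_bound V) u.
Proof.
elim: k V u => [|k IH] V u mV Hu; have [K HK] := Hu 0%N;
  (split; first by exists `|K|; split => // x; apply: le_trans (HK x) _; exact: ler_norm) => //.
apply: bounded_upto_le (norm_bound_form mV) _.
by apply: IH; [exact: homb_metric|exact: bounded_derivatives_conn].
Qed.

Lemma upto_bounded_derivatives V (u : section V) : metric_bundle V ->
  (forall k, bounded_upto k (@norm_bound V) u) -> bounded_derivatives u.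
Proof.
move=> mV Hu j; elim: j V mV u Hu => [|j IH] V mV u Hu.
  by have [K [_ HK]] := bounded_upto0 (Hu 0%N); exists K.
apply/(nabla_shift u j (fun W (w : section W) => exists K : R, forall x : M, vnorm (w x) <= K)).
apply: IH; first exact: homb_metric.
move=> k; have [_ Hk] := Hu k.+1.
exact: bounded_upto_le (form_bound_norm mV) Hk.
Qed.

Record parallel_map V W (L : forall x, fib V x -> fib W x) : Prop := {
  pm_lin : forall x, linear (L x);
  pm_smooth : forall x (u : section V), smooth_sec_near x u ->
    smooth_sec_near x (fun y => L y (u y));
  pm_conn : forall x (u : section V) v, smooth_sec_near x u ->
    @conn R M W (fun y => L y (u y)) x v = L x (@conn R M V u x v) }.

Definition form_map V W (L : forall x, fib V x -> fib W x) x
    (f : fib (homb T V) x) : fib (homb T W) x :=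
  linfun (fun v : 'rV[C]_n => L x ((f : 'Hom('rV[C]_n, fib V x)) v)).

Lemma form_mapE V W (L : forall x, fib V x -> fib W x) x f v :
  linear (L x) -> (form_map L f : 'Hom('rV[C]_n, fib W x)) v =
  L x ((f : 'Hom('rV[C]_n, fib V x)) v).
Proof. by move=> lL; rewrite linfun_lin// => c a b; rewrite linearP lL. Qed.

(** The Leibniz rule, solved for the derivative of [c]. *)
Lemma hom_conn_ext V W (c : section (homb V W)) x v (w : fib V x) :
  connection_bundle V -> connection_bundle W -> smooth_sec_near x c ->
  (conn c x v : 'Hom(fib V x, fib W x)) w =
  conn (fun y => (c y : 'Hom(fib V y, fib W y)) (const_ext w y)) x v -
  (c x : 'Hom(fib V x, fib W x)) (conn (const_ext w) x v).
Proof.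
move=> [vV cV] [vW cW] Hc.
have Hw := smooth_const_ext vV w.
by rewrite (hom_leibniz cl vV vW cV cW v Hc Hw) const_ext_val// addrK.
Qed.

Lemma lin_sub (U W : vectType C) (f : U -> W) a b : linear f ->
  f (a - b) = f a - f b.
Proof. by move=> lf; rewrite addrC -scaleN1r lf scaleN1r addrC. Qed.

(** The derivative of a form on a vector is the derivative of its value on an
    extension of the vector, up to a term in the derivative of the extension;
    the map commutes with both. *)
Lemma form_map_parallel V W (L : forall x, fib V x -> fib W x) :
  connection_bundle V -> connection_bundle W -> parallel_map L ->
  parallel_map (V := homb T V) (W := homb T W) (form_map L).
Proof.
move=> gV gW [lL sL cL]; have [vT cT] := gT.
have sF x (f : section (homb T V)) : smooth_sec_near x f ->
    smooth_sec_near (V := homb T W) x (fun y => form_map L (f y)).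
  move=> Hf; apply: (homb_smoothP cl vT (cb_vector gW)) => X HX.
  have H := sL x _ (homb_smooth_apply cl vT (cb_vector gV) Hf HX).
  apply: (smooth_sec_near_eq cl) H.
  by apply: (@nearW _ (nbhs x)) => y; rewrite form_mapE.
split=> // [x c a b|x f v Hf].
  apply/lfunP => v; rewrite add_lfunE scale_lfunE !form_mapE//.
  by rewrite add_lfunE scale_lfunE lL.
apply/lfunP => X; rewrite [RHS]form_mapE//.
rewrite (hom_conn_ext v X gT gW (sF x f Hf)) (hom_conn_ext v X gT gV Hf).
rewrite lin_sub// form_mapE//; congr (_ - _).
have E : (fun y => (form_map L (f y) : 'Hom('rV[C]_n, fib W y)) (const_ext X y)) =
    fun y => L y ((f y : 'Hom('rV[C]_n, fib V y)) (const_ext X y)).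
  by apply/functional_extensionality_dep => y; rewrite form_mapE.
rewrite [X in conn X]E cL//.
exact: (homb_smooth_apply cl vT (cb_vector gV) Hf (smooth_const_ext vT X)).
Qed.

(** The covariant derivative of [L u] is the induced map applied to that of
    [u], and the induced map is again parallel and bounded. *)
Lemma bounded_upto_parallel k V W (L : forall x, fib V x -> fib W x)
    (N : bound_pred V) (N' : bound_pred W) c (u : section V) :
  connection_bundle V -> connection_bundle W -> parallel_map L -> 0 <= c ->
  (forall x a K, 0 <= K -> N x a K -> N' x (L x a) (c * K)) ->
  smooth_sec u -> bounded_upto k N u -> bounded_upto k N' (fun x => L x (u x)).
Proof.
elim: k V W L N N' u => [|k IH] V W L N N' u gV gW pL c0 HL su [[K [K0 HK]] Hu];
  (split; first by exists (c * K); split; [exact: mulr_ge0|move=> x; exact: HL]) => //.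
apply: (@bounded_upto_ext k (homb T W) _ (fun x => form_map L (conn u x : fib (homb T V) x))).
  move=> x; apply/lfunP => v; rewrite form_mapE; last exact: (pm_lin pL).
  by rewrite (pm_conn pL v (@su x)).
apply: (IH _ _ _ (form_bound N) (form_bound N')) => //.
- exact: homb_good.
- exact: homb_good.
- exact: form_map_parallel.
- move=> x f L0 L00 Hf v; rewrite form_mapE; last exact: (pm_lin pL).
  by rewrite -mulrA; apply: HL; [rewrite mulr_ge0 ?sqrtr_ge0|exact: Hf].
- exact: conn_smooth_sec.
Qed.

Record parallel_pairing U V W (b : forall x, fib U x -> fib V x -> fib W x) : Prop := {
  pp_linl : forall x v, linear (fun u => b x u v);
  pp_linr : forall x u, linear (b x u);
  pp_smooth : forall x (u : section U) (v : section V), smooth_sec_near x u ->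
    smooth_sec_near x v -> smooth_sec_near x (fun y => b y (u y) (v y));
  pp_conn : forall x (u : section U) (v : section V) X, smooth_sec_near x u ->
    smooth_sec_near x v -> 
    @conn R M W (fun y => b y (u y) (v y)) x X =
    b x (@conn R M U u x X) (v x) + b x (u x) (@conn R M V v x X) }.

Lemma swap_pairing U V W (b : forall x, fib U x -> fib V x -> fib W x) :
  parallel_pairing b -> parallel_pairing (fun x v u => b x u v).
Proof.
move=> [bl br bs bc]; split=> // [x u v Hu Hv|x u v X Hu Hv]; first exact: bs.
by rewrite (bc x v u)// addrC.
Qed.

Definition form_pairing U V W (b : forall x, fib U x -> fib V x -> fib W x) x
    (f : fib (homb T U) x) (v : fib V x) : fib (homb T W) x :=
  linfun (fun X : 'rV[C]_n => b x ((f : 'Hom('rV[C]_n, fib U x)) X) v).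

Lemma form_pairingE U V W (b : forall x, fib U x -> fib V x -> fib W x) x f v X :
  parallel_pairing b -> (form_pairing b f v : 'Hom('rV[C]_n, fib W x)) X =
  b x ((f : 'Hom('rV[C]_n, fib U x)) X) v.
Proof.
by move=> pb; rewrite linfun_lin// => c a a'; rewrite linearP (pp_linl pb).
Qed.

Lemma form_pairing_parallel U V W (b : forall x, fib U x -> fib V x -> fib W x) :
  connection_bundle U -> connection_bundle V -> connection_bundle W ->
  parallel_pairing b ->
  parallel_pairing (U := homb T U) (V := V) (W := homb T W) (form_pairing b).
Proof.
move=> gU gV gW pb; have [bl br bs bc] := pb; have [vT cT] := gT.
have sF x (f : section (homb T U)) (u : section V) : smooth_sec_near x f ->
    smooth_sec_near x u ->
    smooth_sec_near (V := homb T W) x (fun y => form_pairing b (f y) (u y)).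
  move=> Hf Hu; apply: (homb_smoothP cl vT (cb_vector gW)) => X HX.
  have H := bs x _ _ (homb_smooth_apply cl vT (cb_vector gU) Hf HX) Hu.
  apply: (smooth_sec_near_eq cl) H.
  by apply: (@nearW _ (nbhs x)) => y; rewrite form_pairingE.
split=> // [x v c f g|x f c u v|x f u v Hf Hu].
- apply/lfunP => X; rewrite add_lfunE scale_lfunE !form_pairingE//.
  by rewrite add_lfunE scale_lfunE bl.
- apply/lfunP => X; rewrite add_lfunE scale_lfunE !form_pairingE//.
  exact: br.
- apply/lfunP => X; rewrite add_lfunE !form_pairingE//.
  rewrite (hom_conn_ext v X gT gW (sF x f u Hf Hu)) (hom_conn_ext v X gT gU Hf).
  rewrite (lin_sub _ _ (bl x (u x))) form_pairingE//.
  have E : (fun y => (form_pairing b (f y) (u y) : 'Hom('rV[C]_n, fib W y)) (const_ext X y)) =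
      fun y => b y ((f y : 'Hom('rV[C]_n, fib U y)) (const_ext X y)) (u y).
    by apply/functional_extensionality_dep => y; rewrite form_pairingE.
  rewrite [X in conn X]E bc//; last first.
    exact: (homb_smooth_apply cl vT (cb_vector gU) Hf (smooth_const_ext vT X)).
  by rewrite const_ext_val// addrAC.
Qed.

(** The Leibniz rule gives the derivative of a product as a sum of two products
    for the induced pairings, which are again parallel and bounded. *)
Lemma bounded_upto_pairing k U V W (b : forall x, fib U x -> fib V x -> fib W x)
    (N1 : bound_pred U) (N2 : bound_pred V) (N : bound_pred W) c
    (u : section U) (v : section V) :
  connection_bundle U -> connection_bundle V -> connection_bundle W ->
  parallel_pairing b -> bound_laws N -> 0 <= c ->
  (forall x p q K L, 0 <= K -> 0 <= L -> N1 x p K -> N2 x q L ->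
     N x (b x p q) (c * K * L)) ->
  smooth_sec u -> smooth_sec v ->
  bounded_upto k N1 u -> bounded_upto k N2 v ->
  bounded_upto k N (fun x => b x (u x) (v x)).
Proof.
elim: k U V W b N1 N2 N u v => [|k IH] U V W b N1 N2 N u v gU gV gW pb lN c0 Hb su sv Bu Bv;
  have [K [K0 HK]] := bounded_upto0 Bu; have [L [L0 HL]] := bounded_upto0 Bv;
  (split; first by exists (c * K * L); split; [rewrite !mulr_ge0|move=> x; exact: Hb]) => //.
have pb' := swap_pairing pb.
apply: (@bounded_upto_ext k (homb T W) _ (fun x =>
    form_pairing b (conn u x : fib (homb T U) x) (v x) +
    form_pairing (fun x v u => b x u v) (conn v x : fib (homb T V) x) (u x))).
  move=> x; apply/lfunP => X; rewrite add_lfunE !form_pairingE//.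
  by rewrite (pp_conn pb X (@su x) (@sv x)).
have lN' := form_bound_laws lN.
have gTU := homb_good cl gT gT gU; have gTV := homb_good cl gT gT gV.
have gTW := homb_good cl gT gT gW.
have p1 := form_pairing_parallel gU gV gW pb.
have p2 := form_pairing_parallel gV gU gW pb'.
have su' := conn_smooth_sec gU su; have sv' := conn_smooth_sec gV sv.
apply: bounded_uptoD => //.
- by move=> x; exact: (pp_smooth p1 (@su' x) (@sv x)).
- by move=> x; exact: (pp_smooth p2 (@sv' x) (@su x)).
- apply: (IH _ _ _ _ (form_bound N1) N2 (form_bound N)) => //.
  + move=> x f q K' L' K0' L0' Hf Hq X; rewrite form_pairingE//.
    have := Hb x _ _ _ _ _ L0' (Hf X) Hq.
    rewrite (_ : c * (K' * vnorm X) * L' = c * K' * L' * vnorm X); last by ring.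
    by apply; rewrite mulr_ge0 ?sqrtr_ge0.
  + by case: Bu.
  + exact: bounded_upto_weak.
- apply: (IH _ _ _ _ (form_bound N2) N1 (form_bound N)) => //.
  + move=> x f q K' L' K0' L0' Hf Hq X; rewrite form_pairingE//.
    have := Hb x _ _ _ _ L0' _ Hq (Hf X).
    rewrite (_ : c * L' * (K' * vnorm X) = c * K' * L' * vnorm X); last by ring.
    by apply; rewrite mulr_ge0 ?sqrtr_ge0.
  + by case: Bv.
  + exact: bounded_upto_weak.
Qed.

End BoundedSections.

(** * Boundedness of the expansion coefficients *)

Section ConcreteOperations.
Variables (R : realType) (M : rmfd R).
Local Notation C := R[i].
Local Notation n := (mdim M).
Local Notation T := (tanb M).
Hypotheses (cl : chart_laws M) (gT : connection_bundle T) (mT : metric_bundle T).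
Implicit Types (U V W Z : bundle M).

Definition comp_pairing V W Z x (c : fib (homb V W) x) (d : fib (homb Z V) x) :
    fib (homb Z W) x :=
  ((c : 'Hom(fib V x, fib W x)) \o (d : 'Hom(fib Z x, fib V x)))%VF.

Definition flip_map Z V W x (c : fib (homb Z (homb V W)) x) :
    fib (homb V (homb Z W)) x :=
  lflip (c : 'Hom(fib Z x, 'Hom(fib V x, fib W x))).

Definition post_map Z V W x (c : fib (homb V W) x) :
    fib (homb (homb Z V) (homb Z W)) x :=
  lpost (fib Z x) (c : 'Hom(fib V x, fib W x)).

(** The three operations are made from evaluation, and evaluation satisfies the
    Leibniz rule; so everything is checked on extensions of vectors. *)
Lemma comp_parallel V W Z : connection_bundle V -> connection_bundle W ->
  connection_bundle Z ->
  parallel_pairing (@comp_pairing V W Z).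
Proof.
move=> gV gW gZ; split.
- move=> x d k c c'; apply/lfunP => w.
  by rewrite add_lfunE scale_lfunE !comp_lfunE add_lfunE scale_lfunE.
- move=> x c k d d'; apply/lfunP => w.
  by rewrite add_lfunE scale_lfunE !comp_lfunE add_lfunE scale_lfunE linearP.
- by move=> x c d Hc Hd; apply: comp_smooth => //; exact: cb_vector.
- move=> x c d X Hc Hd; apply/lfunP => w.
  have Hcd : smooth_sec_near (V := homb Z W) x (fun y => comp_pairing (c y) (d y)).
    by apply: comp_smooth => //; exact: cb_vector.
  have sw := smooth_const_ext (cb_vector gZ) w.
  have sdw := homb_smooth_apply cl (cb_vector gZ) (cb_vector gV) Hd sw.
  rewrite (hom_conn_ext cl X w gZ gW Hcd) add_lfunE !comp_lfunE.
  have -> : (fun y => (comp_pairing (c y) (d y) : 'Hom(fib Z y, fib W y))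
      (const_ext w y)) = fun y => (c y : 'Hom(fib V y, fib W y))
       ((d y : 'Hom(fib Z y, fib V y)) (const_ext w y)).
    by apply/functional_extensionality_dep => y; rewrite comp_lfunE.
  have [vV cV] := gV; have [vW cW] := gW; have [vZ cZ] := gZ.
  rewrite (hom_leibniz cl vV vW cV cW X Hc sdw).
  rewrite (hom_leibniz cl vZ vV cZ cV X Hd sw) const_ext_val// linearD /=.
  by rewrite addrA addrK.
Qed.

Lemma flip_parallel Z V W : connection_bundle Z -> connection_bundle V ->
  connection_bundle W -> parallel_map (@flip_map Z V W).
Proof.
move=> gZ gV gW; have [vV cV] := gV; have [vW cW] := gW; have [vZ cZ] := gZ.
have gVW := homb_good cl gT gV gW; have gZW := homb_good cl gT gZ gW.
split.
- move=> x k c d; apply/lfunP => w; apply/lfunP => z.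
  by rewrite !(add_lfunE, scale_lfunE, lflipE).
- by move=> x c Hc; apply: flip_smooth.
- move=> x c X Hc; apply/lfunP => w; apply/lfunP => z.
  have Hf : smooth_sec_near (V := homb V (homb Z W)) x (fun y => flip_map (c y)).
    exact: flip_smooth.
  have sw := smooth_const_ext vV w; have sz := smooth_const_ext vZ z.
  have Hfw := homb_smooth_apply cl vV (cb_vector gZW) Hf sw.
  have Hcz := homb_smooth_apply cl vZ (cb_vector gVW) Hc sz.
  rewrite (hom_conn_ext cl X w gV gZW Hf) add_lfunE opp_lfunE.
  rewrite (hom_conn_ext cl X z gZ gW Hfw) !lflipE.
  have -> : (fun y => ((flip_map (c y) : 'Hom(fib V y, 'Hom(fib Z y, fib W y)))
        (const_ext w y)) (const_ext z y)) =
      fun y => ((c y : 'Hom(fib Z y, 'Hom(fib V y, fib W y))) (const_ext z y))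
        (const_ext w y).
    by apply/functional_extensionality_dep => y; rewrite lflipE.
  have [vVW cVW] := gVW.
  rewrite (hom_leibniz cl vV vW cV cW X Hcz sw).
  rewrite (hom_leibniz cl vZ vVW cZ cVW X Hc sz) add_lfunE.
  by rewrite !const_ext_val// addrAC addrK addrK.
Qed.

Lemma post_parallel Z V W : connection_bundle Z -> connection_bundle V ->
  connection_bundle W -> parallel_map (@post_map Z V W).
Proof.
move=> gZ gV gW; have [vV cV] := gV; have [vW cW] := gW; have [vZ cZ] := gZ.
have gZV := homb_good cl gT gZ gV; have gZW := homb_good cl gT gZ gW.
split.
- move=> x k c d; apply/lfunP => f; apply/lfunP => z.
  by rewrite !(add_lfunE, scale_lfunE, lpostE).
- by move=> x c Hc; apply: post_smooth.
- move=> x c X Hc; apply/lfunP => f.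
  have Hp : smooth_sec_near (V := homb (homb Z V) (homb Z W)) x
      (fun y => post_map Z (c y)) by exact: post_smooth.
  have sf := smooth_const_ext (cb_vector gZV) f.
  rewrite (hom_conn_ext cl X f gZV gZW Hp).
  have pE y (d : fib (homb V W) y) (g : fib (homb Z V) y) :
      (post_map Z d : 'Hom('Hom(fib Z y, fib V y), 'Hom(fib Z y, fib W y))) g =
      comp_pairing d g.
    by apply/lfunP => z; rewrite lpostE comp_lfunE.
  have -> : (fun y => (post_map Z (c y) : 'Hom('Hom(fib Z y, fib V y), 'Hom(fib Z y, fib W y)))
      (const_ext f y)) = fun y => comp_pairing (c y) (const_ext f y).
    by apply/functional_extensionality_dep => y; exact: pE.
  rewrite (pp_conn (comp_parallel gV gW gZ) X Hc sf) !pE.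
  by rewrite const_ext_val ?addrK//; exact: cb_vector.
Qed.

Section CoefficientBounds.
Variables E E' : bundle M.
Hypotheses (gE : connection_bundle E) (gE' : connection_bundle E').
Hypotheses (mE : metric_bundle E) (mE' : metric_bundle E').
Variable J : section (homb E' E).
Hypotheses (sJ : smooth_sec J) (bJ : forall k, bounded_upto k (@op_bound _ _ E' E) J).

Lemma ctens_metric (V : bundle M) j : metric_bundle V -> metric_bundle (ctens j V).
Proof. by move=> mV; elim: j => //= j IH; exact: homb_metric. Qed.

(** The bound is on the operator norm.  The Hilbert-Schmidt norm would not do:
    that of the identity is the square root of the rank, and ranks need not be
    bounded on a manifold with infinitely many components.  Only tangent
    arguments are turned from operator to Hilbert-Schmidt norms, at the cost of
    the square root of the dimension. *)
Lemma coef_bounded i k q :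
  bounded_upto q (@op_bound _ _ (ctens k E') (ctens i E)) (coef J i k).
Proof.
have gH k' i' := homb_good cl gT (ctens_good cl gT k' gE') (ctens_good cl gT i' gE).
have lH k' i' : bound_laws (@op_bound _ _ (ctens k' E') (ctens i' E)).
  by apply: op_bound_laws; exact: ctens_metric.
have sH k' i' : smooth_sec (coef J i' k') by exact: coef_smooth.
have sF k' i' : smooth_sec (V := homb (ctens k' E') (ctens i'.+1 E)) (fun x =>
    flip_map (conn (coef J i' k') x : fib (homb T (homb (ctens k' E') (ctens i' E))) x)).
  move=> x; apply: (pm_smooth (flip_parallel gT (ctens_good cl gT k' gE')
    (ctens_good cl gT i' gE))).
  exact: (conn_smooth_sec (gH k' i') (sH k' i')).
have flipB i' k' q' : (forall q, bounded_upto q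
      (@op_bound _ _ (ctens k' E') (ctens i' E)) (coef J i' k')) ->
    bounded_upto q' (@op_bound _ _ (ctens k' E') (ctens i'.+1 E))
      (fun x => flip_map (conn (coef J i' k') x : fib (homb T (homb (ctens k' E') (ctens i' E))) x)).
  move=> H; have [_ Hq] := H q'.+1.
  have sc := conn_smooth_sec (gH k' i') (sH k' i').
  apply: (bounded_upto_parallel cl gT _ _ (flip_parallel gT (ctens_good cl gT k' gE')
    (ctens_good cl gT i' gE)) (sqrtr_ge0 n%:R) _ sc Hq).
  - exact: homb_good.
  - exact: (gH k' i'.+1).
  - move=> x c K K0 Hc w; rewrite -mulrA.
    apply: (vnorm_hom_le mT (ctens_metric i' mE)).
      by rewrite mulr_ge0 ?sqrtr_ge0.
    move=> v; rewrite lflipE mulrAC; exact: Hc.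
elim: i k q => [|i IH] [|k] q.
- exact: bJ.
- exact: (bounded_upto_zero cl gT q (gH k.+1 0%N) (lH k.+1 0%N)).
- by apply: flipB => q'; apply: IH.
- have gi := ctens_good cl gT i gE; have gk := ctens_good cl gT k gE'.
  have pP := post_parallel gT gk gi.
  have sP : smooth_sec (V := homb (ctens k.+1 E') (ctens i.+1 E)) (fun x =>
      post_map T (coef J i k x)).
    by move=> x; apply: (pm_smooth pP); exact: sH.
  have bP : bounded_upto q (@op_bound _ _ (ctens k.+1 E') (ctens i.+1 E)) (fun x =>
      post_map T (coef J i k x)).
    apply: (bounded_upto_parallel cl gT _ _ pP ler01 _ (sH k i) (IH k q)).
    + exact: (gH k i).
    + exact: (gH k.+1 i.+1).
    + move=> x c K K0 Hc f; rewrite mul1r.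
      have -> : (post_map T c : 'Hom('Hom('rV[C]_n, fib (ctens k E') x),
          'Hom('rV[C]_n, fib (ctens i E) x))) f =
          ((c : 'Hom(fib (ctens k E') x, fib (ctens i E) x)) \o
           (f : 'Hom('rV[C]_n, fib (ctens k E') x)))%VF.
        by apply/lfunP => v; rewrite lpostE comp_lfunE.
      exact: (vnorm_post mT (ctens_metric k mE') (ctens_metric i mE) _ K0 Hc).
  apply: (bounded_uptoD cl gT (gH k.+1 i.+1) (lH k.+1 i.+1) (sF k.+1 i) sP _ bP).
  by apply: flipB => q'; apply: IH.
Qed.

End CoefficientBounds.
End ConcreteOperations.

(** * Coefficients of bidifferential operators under a change of connection *)

Section Transfer.
Variables (R : realType) (M : rmfd R).
Local Notation C := R[i].
Local Notation T := (tanb M).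
Hypotheses (cl : chart_laws M) (gT : connection_bundle T).
Variables E E' : bundle M.
Hypotheses (gE : connection_bundle E) (gE' : connection_bundle E').
Variable J : section (homb E' E).
Hypothesis sJ : smooth_sec J.

Section OneTarget.
Variable W : bundle M.
Hypothesis gW : connection_bundle W.

(** The coefficients, with respect to the iterated connection of [E'], of the
    operator with coefficients [a]. *)
Definition transfer (a : forall i, section (homb (ctens i E) W)) (N k : nat) :
    section (homb (ctens k E') W) :=
  fun x => \sum_(i < N) comp_pairing (a i x) (coef J i k x).

Lemma transfer_smooth a N k : (forall i, smooth_sec (a i)) ->
  smooth_sec (transfer a N k).
Proof.
move=> sa x; apply: smooth_sec_near_sum => i.
have sc : smooth_sec_near x (coef J i k) by exact: coef_smooth.
exact: (pp_smooth (comp_parallel cl (ctens_good cl gT i gE) gW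
  (ctens_good cl gT k gE')) (@sa i x) sc).
Qed.

Lemma transfer_nabla (a : forall i, section (homb (ctens i E) W)) N (u : section E') x : smooth_sec u ->
  \sum_(i < N) (a i x : 'Hom(fib (ctens i E) x, fib W x))
     (nabla (V := E) (fun y => (J y : 'Hom(fib E' y, fib E y)) (u y)) i x) =
  \sum_(k < N) (transfer a N k x : 'Hom(fib (ctens k E') x, fib W x)) (nabla u k x).
Proof.
move=> su.
under [RHS]eq_bigr do rewrite sum_lfunE.
rewrite [RHS]exchange_big /=; apply: eq_bigr => i _.
rewrite (nabla_expansion cl gT gE gE' sJ x su (ltn_ord i)) linear_sum /=.
by apply: eq_bigr => k _; rewrite comp_lfunE.
Qed.

(** [coef i k] vanishes for [i < k] and [a i] for [m < i]. *)
Lemma transfer_order (a : forall i, section (homb (ctens i E) W)) N k m :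
  (forall i, (m < i)%N -> forall x, a i x = 0) ->
  (m < k)%N -> forall x, transfer a N k x = 0.
Proof.
move=> a0 mk x; apply: big1 => i _; apply/lfunP => w.
rewrite comp_lfunE zero_lfunE.
have [mi|im] := ltnP m i; first by rewrite a0// zero_lfunE.
by rewrite (coef_gt cl gT gE gE' J x (leq_ltn_trans im mk)) zero_lfunE linear0.
Qed.

Hypotheses (mT : metric_bundle T) (mE : metric_bundle E) (mE' : metric_bundle E').
Hypothesis mW : metric_bundle W.

(** The product of a coefficient bounded in Hilbert-Schmidt norm with one bounded
    in operator norm is bounded in Hilbert-Schmidt norm. *)
Lemma transfer_bounded a N k : (forall k, bounded_upto k (@op_bound _ _ E' E) J) ->
  (forall i, bounded_sec (a i)) -> bounded_sec (transfer a N k).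
Proof.
move=> bJ ba; split; first by apply: transfer_smooth => i; have [] := ba i.
have mk := ctens_metric mT k mE'; have gk := ctens_good cl gT k gE'.
apply: (upto_bounded_derivatives mT (homb_metric mk mW)) => q.
have lN := norm_bound_laws (homb_metric mk mW).
have gH := homb_good cl gT gk gW.
apply: (bounded_upto_sum cl gT gH lN) => i.
  move=> x; have [sa _] := ba i.
  have sc : smooth_sec_near x (coef J i k) by exact: coef_smooth.
  exact: (pp_smooth (comp_parallel cl (ctens_good cl gT i gE) gW gk) (@sa x) sc).
have mi := ctens_metric mT i mE; have gi := ctens_good cl gT i gE.
have [sa bd] := ba i.
apply: (bounded_upto_pairing cl gT (homb_good cl gT gi gW) (homb_good cl gT gk gi)
  gH (comp_parallel cl gi gW gk) lN ler01 (N1 := @norm_bound _ _ _)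
  (N2 := @op_bound _ _ _ _)) => //.
- move=> x p d K L K0 L0 Hp Hd; rewrite mul1r.
  apply: le_trans (vnorm_pre mk mi mW p L0 Hd) _.
  exact: ler_wpM2r.
- by move=> x; exact: coef_smooth.
- exact: (bounded_derivatives_upto mT q (homb_metric mi mW) bd).
- exact: (coef_bounded cl gT mT gE gE' mE mE' sJ bJ).
Qed.

End OneTarget.
End Transfer.

Section Bidifferential.
Variables (R : realType) (M : rmfd R).
Local Notation C := R[i].
Local Notation T := (tanb M).
Local Notation M2 := (rprod M M).
Hypotheses (cl : chart_laws M) (gT : connection_bundle T) (mT : metric_bundle T).

Let cl2 : chart_laws M2 := prodm_chart_laws cl cl.

Lemma tanb2_good : connection_bundle (tanb M2).
Proof.
split; first exact: tanb_vector_bundle.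
by apply: tanb_rprod_is_connection => //; exact: cb_conn.
Qed.

Lemma etens_good (E F : bundle M) : connection_bundle E -> connection_bundle F ->
  connection_bundle (etens E F : bundle M2).
Proof.
move=> [vE cE] [vF cF].
have g1 : connection_bundle (pull1 M E : bundle M2).
  by split; [exact: pull1_vector_bundle|exact: pull1_is_connection].
have vC := conjb_vector_bundle cl vF; have cC := conjb_is_connection cl vF cF.
have g2 : connection_bundle (pull2 M (conjb F) : bundle M2).
  by split; [exact: pull2_vector_bundle|exact: pull2_is_connection].
have gt : connection_bundle (trivb M2).
  by split; [exact: trivb_vector_bundle|exact: trivb_is_connection].
have gd := homb_good cl2 tanb2_good g2 gt.
have H := homb_good cl2 tanb2_good gd g1.
exact H.
Qed.

Section ChangeOfConnection.
Variables (E F : bundle M).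

(** Varying only the connection keeps the types of sections and of operators
    fixed, so that one statement serves for both inclusions. *)
Definition with_conn (D : (forall y : M, fib E y) ->
    forall x : M, 'Hom('rV[C]_(mdim M), fib E x)) : bundle M :=
  {| fib := fib E; rank := rank E; frame := frame E; herm := @herm R M E;
     conn := D |}.

Variables D D' : (forall y : M, fib E y) ->
  forall x : M, 'Hom('rV[C]_(mdim M), fib E x).
Local Notation E1 := (with_conn D).
Local Notation E2 := (with_conn D').
Hypotheses (g1 : connection_bundle E1) (g2 : connection_bundle E2).
Hypotheses (gF : connection_bundle F) (mE : metric_bundle E) (mF : metric_bundle F).

(** The identity, between two bundles that differ in their connections; it is
    smooth, but in general not parallel. *)
Definition id_section : section (homb E2 E1) := fun x => \1%VF.

Lemma id_section_smooth : smooth_sec id_section.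
Proof.
move=> x; apply: (homb_smoothP (V := E2) (W := E1) cl (cb_vector g2) (cb_vector g1)) => u Hu.
have -> : (fun y => (id_section y : 'Hom(fib E y, fib E y)) (u y)) = u.
  by apply/functional_extensionality_dep => y; rewrite id_lfunE.
exact: Hu.
Qed.

Definition id_section2 : section (homb (etens E2 F) (etens E1 F) : bundle M2) :=
  fun x => \1%VF.

Lemma id_section2_smooth : smooth_sec id_section2.
Proof.
move=> x; apply: (homb_smoothP (M := M2) (V := etens E2 F) (W := etens E1 F) cl2
  (cb_vector (etens_good g2 gF)) (cb_vector (etens_good g1 gF))) => u Hu.
have -> : (fun y => (id_section2 y : 'Hom(fib (etens E F) y, fib (etens E F) y)) (u y)) = u.
  by apply/functional_extensionality_dep => y; rewrite id_lfunE.
exact: Hu.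
Qed.

Lemma nabla_id (u : section E) i x :
  nabla (V := E1) u i x =
  nabla (V := E1) (fun y => (id_section y : 'Hom(fib E y, fib E y)) (u y)) i x.
Proof.
have -> : (fun y => (id_section y : 'Hom(fib E y, fib E y)) (u y)) = u => //.
by apply/functional_extensionality_dep => y; rewrite id_lfunE.
Qed.

(** The induced connections of the external tensor product differ as well; the
    same expansion is used on the product manifold, and then restricted to the
    diagonal. *)
Lemma restr_diffop_change (b : bimap E1 F) :
  restr_diffop b -> restr_diffop (b : bimap E2 F).
Proof.
have ge1 := etens_good g1 gF; have ge2 := etens_good g2 gF.
have gt : connection_bundle (trivb M2).
  by split; [exact: trivb_vector_bundle|exact: trivb_is_connection].
move=> [N [a [sa bE]]]; exists N.
exists (transfer id_section2 (W := trivb M2) a N); split.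
  by move=> j; apply: (transfer_smooth cl2 tanb2_good ge1 ge2 id_section2_smooth gt).
move=> v x; rewrite bE.
have [sv _] := svalP v.
have H := transfer_nabla cl2 tanb2_good ge1 ge2 id_section2_smooth (W := trivb M2) a N
  (u := sval v) ((x, x) : M2) sv.
have idE : (fun y => (id_section2 y : 'Hom(fib (etens E F) y, fib (etens E F) y))
    (sval v y)) = sval v.
  by apply/functional_extensionality_dep => y; rewrite id_lfunE.
rewrite idE in H.
exact H.
Qed.

Definition transfer_coef (N : nat) (a : bilin_coef E1 F) : bilin_coef E2 F :=
  fun k j => transfer id_section (W := ctens j F) (fun i => a i j) N k.

Lemma canonical_form_change (b : bimap E1 F) N (a : bilin_coef E1 F) :
  has_canonical_form b N a ->
  has_canonical_form (b : bimap E2 F) N (transfer_coef N a).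
Proof.
move=> bE u w tu tw v vE x.
rewrite (bE u w tu tw v vE x) exchange_big [RHS]exchange_big /=.
apply: eq_bigr => j _.
have [su _] := tu.
have ipj := mb_ip (ctens_metric mT j mF) x.
have ipS (G : 'I_N -> fib (ctens j F) x) z :
    \sum_i herm (G i) z = herm (\sum_i G i) z.
  have := ip_suml ipj (index_enum 'I_N) (fun=> 1) G z.
  under eq_bigr do rewrite scale1r.
  by move=> ->; apply: eq_bigr => i _; rewrite mul1r.
rewrite (ipS (fun i : 'I_N => (a i j x : 'Hom(fib (ctens i E1) x, fib (ctens j F) x))
  (nabla (V := E1) u i x))).
rewrite (ipS (fun i : 'I_N => (transfer_coef N a i j x :
  'Hom(fib (ctens i E2) x, fib (ctens j F) x)) (nabla (V := E2) u i x))).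
congr (herm _ _).
rewrite -(transfer_nabla cl gT g1 g2 id_section_smooth (W := ctens j F)
  (fun i => a i j) N x su).
by apply: eq_bigr => i _; rewrite nabla_id.
Qed.

Lemma transfer_coef_smooth N a : (forall i j, smooth_sec (a i j)) ->
  forall i j, smooth_sec (transfer_coef N a i j).
Proof.
move=> sa i j; apply: (transfer_smooth cl gT g1 g2 id_section_smooth
  (ctens_good cl gT j gF)) => k; exact: sa.
Qed.

Lemma biDiff_change m (b : bimap E1 F) :
  biDiff E1 F m b -> biDiff E2 F m (b : bimap E2 F).
Proof.
move=> [[bl br bf] [N [a [sa a0 bE]]]]; split.
  by split; [exact bl|exact br|exact (restr_diffop_change bf)].
exists N, (transfer_coef N a); split; first exact: transfer_coef_smooth.
- move=> k j kj x; case: (ltnP m j) => [mj|jm].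
    apply: big1 => i _; apply/lfunP => z.
    by rewrite comp_lfunE a0 ?zero_lfunE//; right.
  have mk : (m < k)%N by case: kj => //; rewrite ltnNge jm.
  have a0j i : (m < i)%N -> forall y, a i j y = 0 by move=> mi y; apply: a0; left.
  exact: (transfer_order cl gT g1 g2 id_section (W := ctens j F)
    (a := fun i => a i j) N a0j mk x).
- exact (canonical_form_change bE).
Qed.

Lemma biDiffb_change m (b : bimap E1 F) :
  (forall k, bounded_upto k (@op_bound R M E2 E1) id_section) ->
  biDiffb E1 F m b -> biDiffb E2 F m (b : bimap E2 F).
Proof.
move=> bJ [Hb [N [a [ba bE]]]]; split; first exact (biDiff_change Hb).
exists N, (transfer_coef N a); split; last exact (canonical_form_change bE).
have m1 : metric_bundle E1 by case: mE => ? ?; split.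
have m2 : metric_bundle E2 by case: mE => ? ?; split.
move=> k j.
have H := transfer_bounded cl gT g1 g2 id_section_smooth
  (ctens_good cl gT j gF) mT m1 m2 (ctens_metric mT j mF) (a := fun i => a i j)
  N k bJ (fun i => ba i j).
exact H.
Qed.

End ChangeOfConnection.
End Bidifferential.

(** * Boundedness of the identity, and the theorem *)

Section IdentityBounded.
Variables (R : realType) (M : rmfd R).
Local Notation C := R[i].
Local Notation T := (tanb M).
Hypotheses (cl : chart_laws M) (gT : connection_bundle T) (mT : metric_bundle T).
Variables (E : bundle M) (A : section (homb T (homb E E))).
Hypotheses (gE : connection_bundle E) (mE : metric_bundle E).
Hypotheses (gA : connection_bundle (perturb A)) (sA : smooth_sec A).
Hypothesis bA : forall k, bounded_upto k (form_bound (@op_bound _ _ E E)) A.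

Definition id_from : section (homb (perturb A) E) := fun x => \1%VF.
Definition id_to : section (homb E (perturb A)) := fun x => \1%VF.

Lemma id_from_smooth : smooth_sec id_from.
Proof.
move=> x; apply: (homb_smoothP (V := perturb A) (W := E) cl (cb_vector gA)
  (cb_vector gE)) => u Hu.
have -> : (fun y => (id_from y : 'Hom(fib E y, fib E y)) (u y)) = u.
  by apply/functional_extensionality_dep => y; rewrite id_lfunE.
exact: Hu.
Qed.

Lemma id_to_smooth : smooth_sec id_to.
Proof.
move=> x; apply: (homb_smoothP (V := E) (W := perturb A) cl (cb_vector gE)
  (cb_vector gA)) => u Hu.
have -> : (fun y => (id_to y : 'Hom(fib E y, fib E y)) (u y)) = u.
  by apply/functional_extensionality_dep => y; rewrite id_lfunE.
exact: Hu.
Qed.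

Lemma conn_id_from x X : conn id_from x X = - (A x X : 'Hom(fib E x, fib E x)).
Proof.
apply/lfunP => w.
rewrite (hom_conn_ext cl X (w : fib (perturb A) x) gA gE (@id_from_smooth x)).
have -> : (fun y => (id_from y : 'Hom(fib E y, fib E y))
    (const_ext (V := perturb A) w y)) = const_ext (V := E) w.
  by apply/functional_extensionality_dep => y; rewrite id_lfunE.
rewrite id_lfunE (perturb_connE A (const_ext (V := E) w)).
by rewrite opprD addNKr opp_lfunE const_ext_val//; exact: cb_vector.
Qed.

Lemma conn_id_to x X : conn id_to x X = (A x X : 'Hom(fib E x, fib E x)).
Proof.
apply/lfunP => w.
rewrite (hom_conn_ext cl X (w : fib E x) gE gA (@id_to_smooth x)).
have -> : (fun y => (id_to y : 'Hom(fib E y, fib E y))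
    (const_ext (V := E) w y)) = const_ext (V := E) w.
  by apply/functional_extensionality_dep => y; rewrite id_lfunE.
rewrite id_lfunE (perturb_connE A (const_ext (V := E) w)).
by rewrite addrAC subrr add0r const_ext_val//; exact: cb_vector.
Qed.

Lemma perturb_metric : metric_bundle (perturb A).
Proof. by case: mE => ip b; split. Qed.

Lemma comp_op_bound (U V W : bundle M) x c d K L : 0 <= K -> 0 <= L ->
  @op_bound _ _ V W x c K -> @op_bound _ _ U V x d L ->
  @op_bound _ _ U W x (comp_pairing c d) (1 * K * L).
Proof.
move=> K0 L0 Hc Hd w; rewrite comp_lfunE mul1r -mulrA.
by apply: le_trans (Hc _) _; apply: ler_wpM2l => //; exact: Hd.
Qed.

(** A bootstrap: the covariant derivative of the identity is the product of
    [- A] with the identity, so its boundedness to order [k] gives order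
    [k.+1]. *)
Lemma id_from_bounded k : bounded_upto k (@op_bound _ _ (perturb A) E) id_from.
Proof.
have gEE := homb_good cl gT gE gE; have gAE := homb_good cl gT gA gE.
have pc := comp_parallel cl gE gE gA.
have pf := form_pairing_parallel cl gT gEE gAE gAE pc.
have lO : bound_laws (@op_bound _ _ (perturb A) E) by exact: op_bound_laws.
have B0 : exists K, 0 <= K /\ forall x, @op_bound _ _ (perturb A) E x (id_from x) K.
  by exists 1; split => // x w; rewrite id_lfunE mul1r.
elim: k => [|k IH]; split=> //.
apply: (@bounded_upto_ext _ _ k (homb T (homb (perturb A) E)) _ (fun x =>
   form_pairing (@comp_pairing _ _ E E (perturb A))
     (- A x : fib (homb T (homb E E)) x) (id_from x))).
  move=> x; apply/lfunP => X; rewrite form_pairingE// conn_id_from.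
  by apply/lfunP => w; rewrite comp_lfunE id_lfunE opp_lfunE.
have sN : smooth_sec (V := homb T (homb E E)) (fun x => - A x).
  by move=> x; exact: (smooth_sec_nearN (@sA x)).
have lN : bound_laws (form_bound (@op_bound _ _ E E)).
  by apply: form_bound_laws; exact: op_bound_laws.
have bN := bounded_uptoN cl gT (homb_good cl gT gT gEE) lN sA (bA k).
apply: (bounded_upto_pairing cl gT (homb_good cl gT gT gEE) gAE
  (homb_good cl gT gT gAE) pf (form_bound_laws lO) ler01 _ sN id_from_smooth bN IH).
move=> x p q K L K0 L0 Hp Hq X; rewrite form_pairingE//.
rewrite (_ : 1 * K * L * vnorm X = 1 * (K * vnorm X) * L); last by ring.
by apply: comp_op_bound => //; rewrite mulr_ge0 ?sqrtr_ge0.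
Qed.

Lemma id_to_bounded k : bounded_upto k (@op_bound _ _ E (perturb A)) id_to.
Proof.
have gEE := homb_good cl gT gE gE; have gEA := homb_good cl gT gE gA.
have pc := comp_parallel cl gE gA gE.
have pf := form_pairing_parallel cl gT gEE gEA gEA (swap_pairing pc).
have lO : bound_laws (@op_bound _ _ E (perturb A)) by apply: op_bound_laws; exact: perturb_metric.
have B0 : exists K, 0 <= K /\ forall x, @op_bound _ _ E (perturb A) x (id_to x) K.
  by exists 1; split => // x w; rewrite id_lfunE mul1r.
elim: k => [|k IH]; split=> //.
apply: (@bounded_upto_ext _ _ k (homb T (homb E (perturb A))) _ (fun x =>
   form_pairing (fun x v u => @comp_pairing _ _ E (perturb A) E x u v)
     (A x : fib (homb T (homb E E)) x) (id_to x))).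
  move=> x; apply/lfunP => X; rewrite form_pairingE ?conn_id_to//; last exact: swap_pairing.
  by apply/lfunP => w; rewrite comp_lfunE id_lfunE.
apply: (bounded_upto_pairing cl gT (homb_good cl gT gT gEE) gEA
  (homb_good cl gT gT gEA) pf (form_bound_laws lO) ler01 _ sA id_to_smooth (bA k) IH).
move=> x p q K L K0 L0 Hp Hq X; rewrite form_pairingE//; last exact: swap_pairing.
rewrite (_ : 1 * K * L * vnorm X = 1 * L * (K * vnorm X)); last by ring.
by apply: comp_op_bound => //; rewrite mulr_ge0 ?sqrtr_ge0.
Qed.

End IdentityBounded.

Theorem proposition3p26 (R : realType) (M : rmfd R) (E F : bundle M)
    (A : section (homb (tanb M) (homb E E))) (m : nat) :
  riemannian M -> hermitian_bundle E -> hermitian_bundle F ->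
  smooth_sec A -> skew_form A ->
  biDiff E F m = biDiff (perturb A) F m /\
  (bounded_sec A -> biDiffb E F m = biDiffb (perturb A) F m).
Proof.
case: E A => fb rk fr hm cn; set E0 := @Bundle R M fb rk fr hm cn => A rM hE hF sA _.
have cl := manifold_chart_laws (riem_manifold rM).
have vT := tanb_vector_bundle cl.
have gT : connection_bundle (tanb M) by split=> //; exact: lc_connection.
have mT := hermitian_metric_bundle vT (riem_metric rM).
have [vE meE cE _] := hE;  have [vF meF cF _] := hF.
have gE : connection_bundle E0 by split.
have gF : connection_bundle F by split.
have mE := hermitian_metric_bundle vE meE.
have mF := hermitian_metric_bundle vF meF.
have gA : connection_bundle (perturb A).
  by split; [exact: perturb_vector_bundle|exact: perturb_is_connection].
have bA : bounded_sec A ->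
    forall k, bounded_upto k (form_bound (@op_bound _ _ E0 E0)) A.
  move=> [_ dA] k.
  have mEE := homb_metric mE mE.
  apply: bounded_upto_le (bounded_derivatives_upto mT k (homb_metric mT mEE) dA).
  apply: bound_le_trans (norm_bound_form mT mEE) _.
  by apply: form_bound_le; exact: norm_bound_op.
have bF b := id_from_bounded cl gT gE mE gA sA (bA b).
have bT b := id_to_bounded cl gT gE mE gA sA (bA b).
have change1 := @biDiff_change R M cl gT mT E0 F cn (@conn R M (perturb A)) gE gA gF mF m.
have change2 := @biDiff_change R M cl gT mT E0 F (@conn R M (perturb A)) cn gA gE gF mF m.
split; first by apply/seteqP; split=> b; [exact: change1|exact: change2].
move=> HA.
have changeb1 b := @biDiffb_change R M cl gT mT E0 F cn (@conn R M (perturb A))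
  gE gA gF mE mF m b (bF HA).
have changeb2 b := @biDiffb_change R M cl gT mT E0 F (@conn R M (perturb A)) cn
  gA gE gF mE mF m b (bT HA).
by apply/seteqP; split=> b; [exact: changeb1|exact: changeb2].
Qed.
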